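(* Let $\Omega\subset\mathbb{R}^n$ be open, $s>1$, and let $P$ be a linear partial differential operator on $\Omega$ with coefficients of class $G^{(s)}$. Let $x_0\in\Omega$ and suppose that $P$ has no solution of delta type at $x_0$. If $P$ is $\mathfrak{h}(\mathscr{D}'_{(s)},\mathscr{D}')$ on $\Omega$, then its transpose ${}^{\mathrm t}P$ is $\mathcal{C}^\infty$-locally solvable at $x_0$.
   Context: $G^{(s)}(U)$ is the Gevrey space of Beurling type: $f\in\mathcal{C}^\infty(U)$ such that for every compact $K\subset U$ and every $h>0$ there is $C>0$ with $\sup_K|\partial^\alpha f|\le C h^{|\alpha|}|\alpha|!^{s}$ for all $\alpha$. $\mathscr{D}'_{(s)}(U)$, the ultradistributions of Beurling type of order $s$, is the topological dual of the space $G^{(s)}_c(U)$ of compactly supported elements of $G^{(s)}(U)$. $P$ is $\mathfrak{h}(\mathscr{D}'_{(s)},\mathscr{D}')$ on $\Omega$ if for every open $U\subset\Omega$: whenever $u\in\mathscr{D}'_{(s)}(U)$ satisfies $Pu\in\mathscr{D}'(U)$, then $u\in\mathscr{D}'(U)$. $P$ has a solution of delta type at $x_0$ if there exists a distribution $u\in\mathscr{E}'(\Omega)$ with $\operatorname{supp}u=\{x_0\}$ and $Pu=0$. ${}^{\mathrm t}P$ is the formal transpose: $\int(P\varphi)\psi=\int\varphi\,({}^{\mathrm t}P\psi)$ for test functions. An operator $A$ is $\mathcal{C}^\infty$-locally solvable at $x_0$ if for every open $U\subset\Omega$ containing $x_0$ and every $g\in\mathcal{C}^\infty(U)$ there exist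 an open neighborhood $V\subset U$ of $x_0$ and $f\in\mathcal{C}^\infty(V)$ with $Af=g$ on $V$. *)

(* Defs.v *)
From HB Require Import structures.
From mathcomp Require Import all_boot all_order all_algebra.
From mathcomp Require Import complex.
From mathcomp Require Import all_classical all_reals all_analysis.

Set Implicit Arguments.
Unset Strict Implicit.
Unset Printing Implicit Defensive.

Import Order.TTheory GRing.Theory Num.Theory.
Import numFieldNormedType.Exports.

Local Open Scope classical_set_scope.
Local Open Scope complex_scope.
Local Open Scope ring_scope.

(** A function on an open set [U] of R^n is represented by a total function
    whose values outside [U] are irrelevant: every predicate "on [U]" below
    only looks at points of [U] (derivatives at a point of [U] only depend on
    the germ there).  A compactly supported function on [U] is represented by
    its extension by zero.  Functions, coefficients and distributions are
    complex valued. *)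

Section Functions.
Context {R : realType} {n : nat}.
Local Notation E := 'rV[R]_n.
Local Notation C := R[i].
Implicit Types (U K : set E) (f g phi psi : E -> C) (i : 'I_n).

Definition cmod (z : C) : R := Normc.normc z.

Definition partial_re i (f : E -> R) : E -> R :=
  fun x => 'D_(delta_mx 0 i) f x.

Definition re_part f : E -> R := fun x => complex.Re (f x).
Definition im_part f : E -> R := fun x => complex.Im (f x).

Definition partial i f : E -> C :=
  fun x => partial_re i (re_part f) x +i* partial_re i (im_part f) x.

Definition multi_index := {ffun 'I_n -> nat}.
Implicit Types (a : multi_index).

Definition mabs a : nat := (\sum_(i < n) a i)%N.

Definition dpart a f : E -> C :=
  foldr (fun i g => iter (a i) (partial i) g) f (enum 'I_n).

(** C^oo(U): every iterated partial derivative, in any order of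
    differentiation, is continuous and has all its first partial derivatives
    at every point of [U]. *)
Definition real_smooth U (f : E -> R) : Prop :=
  forall (w : seq 'I_n) (x : E), U x ->
    {for x, continuous (foldr partial_re f w)} /\
    forall i, derivable (foldr partial_re f w) x (delta_mx 0 i).

Definition smooth U f : Prop :=
  real_smooth U (re_part f) /\ real_smooth U (im_part f).

Definition supp f : set E := closure [set x | f x != 0].

Definition gevrey_weight (s h : R) (k : nat) : R := h ^+ k * (k`!%:R `^ s).

Definition gevrey (s : R) U f : Prop :=
  smooth U f /\
  forall K, compact K -> K `<=` U -> forall h : R, 0 < h ->
    exists2 c : R, 0 < c &
      forall a x, K x -> cmod (dpart a f x) <= c * gevrey_weight s h (mabs a).

Definition test_fun U phi : Prop :=
  [/\ smooth setT phi, compact (supp phi) & supp phi `<=` U].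

Definition gevrey_test_fun (s : R) U phi : Prop :=
  test_fun U phi /\ gevrey s U phi.

(** Linear forms on a space [T] of test functions; the value of [u] outside
    [T] is irrelevant. *)
Definition linear_form (T : (E -> C) -> Prop) (u : (E -> C) -> C) : Prop :=
  forall (c : C) phi psi, T phi -> T psi ->
    u (fun x => c * phi x + psi x) = c * u phi + u psi.

(** D'(U).  A linear form on the strict inductive limit of the Fréchet spaces
    C^oo_K(U) is continuous iff its restriction to each of them is, i.e. is
    bounded by [c] times one of the seminorms
    [sup {|dpart a phi x| : x, |a| <= N}].  "Every upper bound [M] of the set
    works" spells out the bound by the supremum. *)
Definition distribution U (u : (E -> C) -> C) : Prop :=
  linear_form (test_fun U) u /\
  forall K, compact K -> K `<=` U -> exists (c : R) (N : nat), 0 < c /\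
    forall phi, test_fun U phi -> supp phi `<=` K ->
    forall M : R,
      (forall a x, (mabs a <= N)%N -> cmod (dpart a phi x) <= M) ->
      cmod (u phi) <= c * M.

(** D'_(s)(U): the same for the inductive limit over [K] of the Fréchet spaces
    of Beurling-Gevrey functions supported in [K], topologized by the
    (directed) family of seminorms, [h > 0],
    [sup {|dpart a phi x| / (h ^ |a| * |a|! ^ s) : x, a}]. *)
Definition ultradistribution (s : R) U (u : (E -> C) -> C) : Prop :=
  linear_form (gevrey_test_fun s U) u /\
  forall K, compact K -> K `<=` U -> exists c h : R, [/\ 0 < c, 0 < h &
    forall phi, gevrey_test_fun s U phi -> supp phi `<=` K ->
    forall M : R,
      (forall a x, cmod (dpart a phi x) <= M * gevrey_weight s h (mabs a)) ->
      cmod (u phi) <= c * M].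

(** An ultradistribution on [U] is identified with a distribution when it is
    the restriction of that distribution to the Gevrey test functions. *)
Definition is_distribution (s : R) U (u : (E -> C) -> C) : Prop :=
  exists2 v, distribution U v & forall phi, gevrey_test_fun s U phi ->
    u phi = v phi.

Definition dsupp U (u : (E -> C) -> C) : set E :=
  [set x | U x /\ forall V : set E, open V -> V x -> V `<=` U ->
     exists2 phi, test_fun V phi & u phi != 0].

Definition compactly_supported_distribution U (u : (E -> C) -> C) : Prop :=
  distribution U u /\ compact (dsupp U u).

(** The operator sum_(|a| <= pdo_order) (pdo_coef a) * dpart a; coefficients of larger
    multi-indices are ignored. *)
Record pdo := Pdo { pdo_order : nat; pdo_coef : multi_index -> E -> C }.
Implicit Types P Q : pdo.

Definition pdo_sum P (F : multi_index -> C) : C :=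
  let index (b : {ffun 'I_n -> 'I_(pdo_order P).+1}) : multi_index :=
    [ffun i => b i : nat] in
  \sum_(b | (mabs (index b) <= pdo_order P)%N) F (index b).

Definition coefs_in (S : (E -> C) -> Prop) P : Prop :=
  forall a, (mabs a <= pdo_order P)%N -> S (pdo_coef P a).

Definition pdo_fun P f : E -> C :=
  fun x => pdo_sum P (fun a => pdo_coef P a x * dpart a f x).

(** Action on (ultra)distributions, from <g u, phi> = <u, g phi> and
    <dpart a u, phi> = (-1)^|a| <u, dpart a phi>. *)
Definition mul_form g (u : (E -> C) -> C) : (E -> C) -> C :=
  fun phi => u (fun x => g x * phi x).

Definition dpart_form a (u : (E -> C) -> C) : (E -> C) -> C :=
  fun phi => (-1) ^+ mabs a * u (dpart a phi).

Definition pdo_form P (u : (E -> C) -> C) : (E -> C) -> C :=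
  fun phi => pdo_sum P (fun a => mul_form (pdo_coef P a) (dpart_form a u) phi).

Definition h_ultradistribution_distribution (s : R) (Om : set E) P : Prop :=
  forall U, open U -> U `<=` Om -> forall u, ultradistribution s U u ->
    is_distribution s U (pdo_form P u) -> is_distribution s U u.

Definition has_delta_solution (Om : set E) P (x0 : E) : Prop :=
  exists u, [/\ compactly_supported_distribution Om u,
    dsupp Om u = [set x0] &
    forall phi, test_fun Om phi -> pdo_form P u phi = 0].

Definition smoothly_locally_solvable (Om : set E) P (x0 : E) : Prop :=
  forall U, open U -> U `<=` Om -> U x0 -> forall g, smooth U g ->
    exists V : set E, [/\ open V, V x0, V `<=` U &
      exists2 f, smooth V f & forall x, V x -> pdo_fun P f x = g x].

End Functions.

Arguments multi_index n : clear implicits.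
Arguments pdo R n : clear implicits.

(** Integral over R^n as an iterated Lebesgue integral; it is only used for
    continuous compactly supported functions, for which it is the
    n-dimensional Lebesgue integral. *)
Fixpoint integral_rV {R : realType} (n : nat) : ('rV[R]_n -> R) -> R :=
  match n return ('rV[R]_n -> R) -> R with
  | 0%N => fun f => f 0
  | n'.+1 => fun f =>
      Rintegral (@lebesgue_measure R) setT
        (fun t => integral_rV (fun y : 'rV[R]_n' =>
           f (row_mx (t%:M : 'rV[R]_1) y)))
  end.

Definition cintegral {R : realType} {n : nat} (f : 'rV[R]_n -> R[i]) : R[i] :=
  integral_rV (re_part f) +i* integral_rV (im_part f).

Definition formal_transpose {R : realType} {n : nat} (Om : set 'rV[R]_n)
    (P tP : pdo R n) : Prop :=
  coefs_in (smooth Om) tP /\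
  forall phi psi, test_fun Om phi -> test_fun Om psi ->
    cintegral (fun x => pdo_fun P phi x * psi x) =
    cintegral (fun x => phi x * pdo_fun tP psi x).

(* Main.v *)
(* Write T for the formal transpose of P, p_(N,r) for the C^N seminorm on the box
   of radius r around x0.  By Hahn-Banach, T f = g is approximately solvable by test
   functions as soon as every linear form u carried by a box of radius r with
   |u (T f)| <= p_(N,r) f satisfies |u| <= C p_(M,r1), for r < r1; corrections made on
   boxes decreasing to one of positive radius then sum up to a smooth solution.
   If u is moreover bounded by a fixed Gevrey seminorm, then u o T extends to a
   distribution, the hypothesis on P says that u is one too, and a gliding hump
   makes the resulting bound uniform in u.  The Gevrey bound is removed by
   compactness: otherwise normalized counterexamples u_j with u_j o T -> 0 would
   converge, by Ascoli and the uniform bound, to a form v <> 0 carried by the box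
   with v o T = 0.  If such v existed in arbitrarily small boxes, the same compactness
   would produce one carried by x0, that is a solution of delta type.  Gevrey test
   functions are dense because primitives of Gevrey step functions approximate
   smooth functions of one variable. *)
From mathcomp Require Import all_boot all_order all_algebra.
From mathcomp Require Import complex ring lra zify.
From mathcomp Require Import all_classical all_reals all_analysis.
Require Import Defs.

Set Implicit Arguments.
Unset Strict Implicit.
Unset Printing Implicit Defensive.

Import Order.TTheory GRing.Theory Num.Theory.
Import numFieldNormedType.Exports.

Local Open Scope classical_set_scope.
Local Open Scope complex_scope.
Local Open Scope ring_scope.

(** * Calculus of iterated partial derivatives *)

(** The hypothesis on [P] is qualitative: it turns one ultradistribution into one distribution,
    without an estimate. Estimates come from applying it to all forms under one common Gevrey
    seminorm, because this set is pointwise bounded and stable under limits and signed series.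
    Duality, however, yields forms bounded by some C^L seminorm with uncontrolled [L] and constant;
    these are distributions from the start, so the hypothesis says nothing about each of them, and
    only the compactness argument makes order and constant uniform. Independence of [L] is what lets
    each step of the iteration ask for a residual small in whatever seminorm the next step needs.
    The losses of radius pay for cutoffs: a form carried by a box does not change when its argument
    is multiplied by a cutoff equal to 1 around that box. As [tP] is known only through its defining
    identity, it is compared once, on test functions, with the explicit operator [transpose P], and
    the estimates concern the latter. Limits are taken along one ultrafilter, which replaces
    extraction of subsequences. *)

Section Calculus.
Context {R : realType} {n : nat}.
Local Notation E := 'rV[R]_n.
Local Notation C := R[i].
Implicit Types (U : set E) (f g : E -> C) (w : seq 'I_n) (x : E).

(* Iterated derivatives are indexed by words instead of multi-indices; both agree
   on smooth functions by Schwarz's theorem, see [pw_dpart]. *)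
Definition pw w f : E -> C := foldr partial f w.

Definition ccont f x :=
  {for x, continuous (re_part f)} /\ {for x, continuous (im_part f)}.
Definition cdiff i f x :=
  derivable (re_part f) x (delta_mx 0 i) /\
  derivable (im_part f) x (delta_mx 0 i).

Lemma re_pw w f : re_part (pw w f) = foldr partial_re (re_part f) w.
Proof. by elim: w => //= i w <-. Qed.

Lemma im_pw w f : im_part (pw w f) = foldr partial_re (im_part f) w.
Proof. by elim: w => //= i w <-. Qed.

Lemma smoothP U f : smooth U f <->
  forall w x, U x -> ccont (pw w f) x /\ forall i, cdiff i (pw w f) x.
Proof.
split=> [[Hr Hi] w x Ux|H].
  have [a b] := Hr w x Ux; have [c d] := Hi w x Ux.
  by split=> [|i]; rewrite /ccont /cdiff re_pw im_pw; split.
by split=> w x Ux; have [[a b] c] := H w x Ux;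
  (split=> [|i]; [move: a b|have := c i]; rewrite /cdiff re_pw im_pw // => -[]).
Qed.

Lemma smooth_re_im U f :
  smooth U f <-> real_smooth U (re_part f) /\ real_smooth U (im_part f).
Proof. by []. Qed.

Opaque smooth.

Lemma pw_rcons w i f : pw (rcons w i) f = pw w (partial i f).
Proof. by rewrite /pw foldr_rcons. Qed.

Lemma pw_cat w1 w2 f : pw (w1 ++ w2) f = pw w1 (pw w2 f).
Proof. by rewrite /pw foldr_cat. Qed.

Lemma smooth_pw U w f : smooth U f -> smooth U (pw w f).
Proof.
move/smoothP => H; apply/smoothP => w' x Ux.
by rewrite -pw_cat; exact: H.
Qed.

Lemma smooth_partial U i f : smooth U f -> smooth U (partial i f).
Proof. exact: (@smooth_pw U [:: i]). Qed.

Lemma smooth_cont U f x : smooth U f -> U x -> ccont f x.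
Proof. by move=> /smoothP H /(H [::])[]. Qed.

Lemma smooth_cdiff U f x i : smooth U f -> U x -> cdiff i f x.
Proof. by move=> /smoothP H /(H [::])[]. Qed.

Lemma subset_smooth U V f : V `<=` U -> smooth U f -> smooth V f.
Proof. by move=> VU /smoothP H; apply/smoothP => w x /VU; apply: H. Qed.

(** [V] can be any set containing the point: [smooth V f] already speaks of the germs of the total
    function [f] at the points of [V]. *)
Lemma smooth_locally (U : set E) f :
  (forall x, U x -> exists V, V x /\ smooth V f) -> smooth U f.
Proof.
move=> H; apply/smoothP => w x /H[V [Vx] /smoothP sV]; exact: sV.
Qed.

Section Germ.
Variables (U : set E) (oU : open U).

Lemma near_open (P : E -> Prop) x : U x -> (forall y, U y -> P y) ->
  \forall y \near x, P y.
Proof.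
move=> Ux H; have : \forall y \near x, U y by exact: open_nbhs_nbhs.
by apply: filterS.
Qed.

Lemma eq_ccont f g x : (forall y, U y -> f y = g y) -> U x ->
  ccont f x -> ccont g x.
Proof.
move=> fg Ux [cf1 cf2]; split.
  have e : \forall y \near x, re_part f y = re_part g y.
    by apply: near_open => // y Uy; rewrite /re_part fg.
  have e' : re_part f x = re_part g x by exact: nbhs_singleton e.
  change (re_part g @ x --> re_part g x); rewrite -[X in _ --> X]e'.
  exact: (cvg_trans (near_eq_cvg e) cf1).
have e : \forall y \near x, im_part f y = im_part g y.
  by apply: near_open => // y Uy; rewrite /im_part fg.
have e' : im_part f x = im_part g x by exact: nbhs_singleton e.
change (im_part g @ x --> im_part g x); rewrite -[X in _ --> X]e'.
exact: (cvg_trans (near_eq_cvg e) cf2).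
Qed.

Lemma eq_cdiff i f g x : (forall y, U y -> f y = g y) -> U x ->
  cdiff i f x -> cdiff i g x.
Proof.
move=> fg Ux [cf1 cf2]; split.
- apply: (near_eq_derivable (f := re_part f)) => //.
  by apply: near_open => // y Uy; rewrite /re_part fg.
- apply: (near_eq_derivable (f := im_part f)) => //.
  by apply: near_open => // y Uy; rewrite /im_part fg.
Qed.

Lemma eq_partial i f g x : (forall y, U y -> f y = g y) -> U x ->
  partial i f x = partial i g x.
Proof.
move=> fg Ux; congr (_ +i* _).
- apply: near_eq_derive.
  by apply: near_open => // y Uy; rewrite /re_part fg.
- apply: near_eq_derive.
  by apply: near_open => // y Uy; rewrite /im_part fg.
Qed.

Lemma eq_pw w f g x : (forall y, U y -> f y = g y) -> U x ->
  pw w f x = pw w g x.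
Proof.
by move=> fg; elim: w x => [|i w IH] x Ux /=; [exact: fg|exact: eq_partial].
Qed.

Lemma eq_smooth f g : (forall y, U y -> f y = g y) -> smooth U f -> smooth U g.
Proof.
move=> fg /smoothP sf; apply/smoothP => w x Ux.
have [h1 h2] := sf w x Ux.
have e y : U y -> pw w f y = pw w g y by exact: eq_pw.
by split=> [|i]; [exact: eq_ccont e _ _|exact: eq_cdiff e _ _].
Qed.

(* Smoothness by coinduction: [S] is an invariant stable under [partial]. *)
Lemma smooth_coind (S : (E -> C) -> Prop) :
  (forall f, S f -> forall x, U x -> ccont f x /\ forall i, cdiff i f x) ->
  (forall f, S f -> forall i, exists2 g, S g &
     forall x, U x -> partial i f x = g x) ->
  forall f, S f -> smooth U f.
Proof.
move=> Sd Sp f Sf; apply/smoothP => w.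
suff [g Sg fg] : exists2 g, S g & forall x, U x -> pw w f x = g x.
  move=> x Ux; have [c d] := Sd _ Sg x Ux.
  by split=> [|i]; [apply: (eq_ccont _ Ux c)|apply: (eq_cdiff _ Ux (d i))];
    move=> y /fg.
elim: w => [|i w [g Sg fg]]; first by exists f.
have [h Sh gh] := Sp _ Sg i; exists h => // x Ux.
by rewrite /= -gh //; exact: eq_partial.
Qed.

End Germ.

Lemma re_partD f g : re_part (fun x => f x + g x) = re_part f + re_part g.
Proof. by apply/funext => x; rewrite /re_part raddfD. Qed.
Lemma im_partD f g : im_part (fun x => f x + g x) = im_part f + im_part g.
Proof. by apply/funext => x; rewrite /im_part raddfD. Qed.
Lemma re_partM f g : re_part (fun x => f x * g x) =
  re_part f * re_part g - im_part f * im_part g.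
Proof.
by apply/funext => x; rewrite /re_part /im_part !fctE; case: (f x); case: (g x).
Qed.
Lemma im_partM f g : im_part (fun x => f x * g x) =
  re_part f * im_part g + im_part f * re_part g.
Proof.
by apply/funext => x; rewrite /re_part /im_part !fctE; case: (f x); case: (g x).
Qed.

Lemma ccontD f g x : ccont f x -> ccont g x -> ccont (fun x => f x + g x) x.
Proof.
move=> [a b] [c d]; split; rewrite ?re_partD ?im_partD; exact: continuousD.
Qed.

Lemma ccontM f g x : ccont f x -> ccont g x -> ccont (fun x => f x * g x) x.
Proof.
move=> [a b] [c d]; split; rewrite ?re_partM ?im_partM.
  by apply: continuousB; apply: continuousM.
by apply: continuousD; apply: continuousM.
Qed.

Lemma cdiffD i f g x : cdiff i f x -> cdiff i g x ->
  cdiff i (fun x => f x + g x) x.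
Proof.
move=> [a b] [c d]; split; rewrite ?re_partD ?im_partD; exact: derivableD.
Qed.

Lemma cdiffM i f g x : cdiff i f x -> cdiff i g x ->
  cdiff i (fun x => f x * g x) x.
Proof.
move=> [a b] [c d]; split; rewrite ?re_partM ?im_partM.
  exact: derivableB (derivableM a c) (derivableM b d).
exact: derivableD (derivableM a d) (derivableM b c).
Qed.

Lemma partialD i f g x : cdiff i f x -> cdiff i g x ->
  partial i (fun x => f x + g x) x = partial i f x + partial i g x.
Proof.
move=> [a b] [c d]; rewrite /partial /partial_re re_partD im_partD.
by rewrite !deriveD.
Qed.

Lemma partialM i f g x : cdiff i f x -> cdiff i g x ->
  partial i (fun x => f x * g x) x = partial i f x * g x + f x * partial i g x.
Proof.
move=> [a b] [c d]; rewrite /partial /partial_re re_partM im_partM.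
rewrite (deriveB (derivableM a c) (derivableM b d)).
rewrite (deriveD (derivableM a d) (derivableM b c)).
rewrite (deriveM a c) (deriveM b d) (deriveM a d) (deriveM b c).
move: ('D__ (re_part f) x) ('D__ (im_part f) x) => f'r f'i.
move: ('D__ (re_part g) x) ('D__ (im_part g) x) => g'r g'i.
rewrite /re_part /im_part; case: (f x) (g x) => fr fi [gr gi].
apply/eqP; rewrite eq_complex; apply/andP.
by split; apply/eqP; rewrite /= /GRing.scale /=; ring.
Qed.

Lemma smooth_cst U (c : C) : smooth U (fun=> c).
Proof.
suff e (w : seq 'I_n) : exists d, pw w (fun=> c) = fun=> d.
  apply/smoothP => w x _; have [d ->] := e w.
  split=> [|i]; split; rewrite /re_part /im_part.
  - exact: cst_continuous.
  - exact: cst_continuous.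
  - exact: derivable_cst.
  - exact: derivable_cst.
elim: w => [|i w [d dE]] /=; first by exists c.
exists 0; apply/funext => x; rewrite dE /partial /partial_re.
by rewrite !(derive_cst _ x).
Qed.

Lemma partial_cst (i : 'I_n) (c : C) : partial i (fun _ : E => c) = fun=> 0.
Proof.
by apply/funext => x; rewrite /partial /partial_re !(derive_cst _ x).
Qed.

(** By Leibniz's rule a derivative of a product is a sum of products, so products alone are not
    stable under [partial]; finite sums of them are, which makes this class an invariant for
    [smooth_coind]. *)
Inductive prod_alg U : (E -> C) -> Prop :=
| prod_alg_mul f g : smooth U f -> smooth U g -> prod_alg U (fun x => f x * g x)
| prod_alg_add f g : prod_alg U f -> prod_alg U g ->
    prod_alg U (fun x => f x + g x).

Lemma prod_alg_smooth U f : open U -> prod_alg U f -> smooth U f.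
Proof.
move=> oU; apply: (smooth_coind oU) => {}f.
  elim=> {f}[f g sf sg x Ux|f g _ hf _ hg x Ux].
    split=> [|i].
      by apply: ccontM; apply: (smooth_cont (U := U)).
    by apply: cdiffM; apply: (smooth_cdiff (U := U)).
  have [a b] := hf x Ux; have [c d] := hg x Ux.
  by split=> [|i]; [exact: ccontD|exact: cdiffD].
have Hd h : prod_alg U h -> forall x i, U x -> cdiff i h x.
  elim=> {f h}[f g sf sg x i Ux|f g _ hf _ hg x i Ux].
    by apply: cdiffM; apply: (smooth_cdiff (U := U)).
  by apply: cdiffD; [exact: hf|exact: hg].
move=> + i; elim=> {f}[f g sf sg|f g Sf [f' Sf' ff'] Sg [g' Sg' gg']].
  exists (fun x => partial i f x * g x + f x * partial i g x).
    exact: (prod_alg_add (prod_alg_mul (smooth_partial i sf) sg)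
                         (prod_alg_mul sf (smooth_partial i sg))).
  by move=> x Ux; rewrite partialM //; apply: (smooth_cdiff (U := U)).
exists (fun x => f' x + g' x); first exact: prod_alg_add.
by move=> x Ux; rewrite partialD ?ff' ?gg' //; exact: Hd.
Qed.

Lemma smoothM U f g : open U -> smooth U f -> smooth U g ->
  smooth U (fun x => f x * g x).
Proof. by move=> oU sf sg; apply: prod_alg_smooth => //; exact: prod_alg_mul. Qed.

Lemma smoothD U f g : open U -> smooth U f -> smooth U g ->
  smooth U (fun x => f x + g x).
Proof.
move=> oU sf sg; apply: prod_alg_smooth => //.
have -> : (fun x => f x + g x) = (fun x => (f x * 1) + (g x * 1)).
  by apply/funext => x; rewrite !mulr1.
exact: (prod_alg_add (prod_alg_mul sf (smooth_cst U 1))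
                     (prod_alg_mul sg (smooth_cst U 1))).
Qed.

Lemma smoothZ U c f : open U -> smooth U f -> smooth U (fun x => c * f x).
Proof. by move=> oU sf; exact: (smoothM oU (smooth_cst U c) sf). Qed.

Lemma smooth_sum U (I : Type) (r : seq I) (P : pred I) (F : I -> E -> C) :
  open U -> (forall i, P i -> smooth U (F i)) ->
  smooth U (fun x => \sum_(i <- r | P i) F i x).
Proof.
move=> oU sF; elim: r => [|j r IH].
  apply: (eq_smooth oU _ (smooth_cst U 0)) => y _; by rewrite big_nil.
have [Pj|/negbTE Pj] := boolP (P j).
  by apply: (eq_smooth oU _ (smoothD oU (sF j Pj) IH)) => y _; rewrite big_cons Pj.
by apply: (eq_smooth oU _ IH) => y _; rewrite big_cons Pj.
Qed.

Lemma pwD U w f g x : open U -> smooth U f -> smooth U g -> U x ->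
  pw w (fun x => f x + g x) x = pw w f x + pw w g x.
Proof.
move=> oU sf sg; elim: w x => [|i w IH] x Ux //=.
rewrite (eq_partial oU i IH Ux) partialD; first by [].
- exact: (smooth_cdiff i (smooth_pw w sf) Ux).
- exact: (smooth_cdiff i (smooth_pw w sg) Ux).
Qed.

Lemma pwZ U w c f x : open U -> smooth U f -> U x ->
  pw w (fun x => c * f x) x = c * pw w f x.
Proof.
move=> oU sf; elim: w x => [|i w IH] x Ux //=.
rewrite (eq_partial oU i IH Ux) partialM.
- by rewrite partial_cst mul0r add0r.
- exact: (smooth_cdiff i (smooth_cst U c) Ux).
- exact: (smooth_cdiff i (smooth_pw w sf) Ux).
Qed.

Lemma pwZD U w c f g x : open U -> smooth U f -> smooth U g -> U x ->
  pw w (fun x => c * f x + g x) x = c * pw w f x + pw w g x.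
Proof.
by move=> oU sf sg Ux; rewrite (pwD w oU (smoothZ c oU sf) sg Ux) (pwZ w c oU sf Ux).
Qed.

Lemma pw_cst0 w : pw w (fun _ : E => 0 : C) = fun=> 0.
Proof. by elim: w => //= i w ->; rewrite partial_cst. Qed.

Lemma pw_sum U w (I : Type) (r : seq I) (P : pred I) (F : I -> E -> C) x :
  open U -> (forall i, P i -> smooth U (F i)) -> U x ->
  pw w (fun x => \sum_(i <- r | P i) F i x) x = \sum_(i <- r | P i) pw w (F i) x.
Proof.
move=> oU sF Ux; elim: r => [|j r IH].
  rewrite big_nil -[RHS](congr1 (@^~ x) (pw_cst0 w)); apply: (eq_pw oU) => // y _.
  by rewrite big_nil.
rewrite big_cons -IH; have [Pj|/negbTE Pj] := boolP (P j).
  rewrite -(pwD w oU (sF j Pj) (smooth_sum r oU sF) Ux).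
  by apply: (eq_pw oU) => // y _; rewrite big_cons Pj.
by apply: (eq_pw oU) => // y _; rewrite big_cons Pj.
Qed.

End Calculus.

Section Cmod.
Context {R : realType}.
Implicit Types z : R[i].

Lemma cmod_ge0 z : 0 <= cmod z.
Proof. by case: z => a b; exact: sqrtr_ge0. Qed.
Lemma cmodM z1 z2 : cmod (z1 * z2) = cmod z1 * cmod z2.
Proof. exact: Normc.normcM. Qed.
Lemma cmodD z1 z2 : cmod (z1 + z2) <= cmod z1 + cmod z2.
Proof. exact: le_normcD. Qed.
Lemma cmodN z : cmod (- z) = cmod z.
Proof. exact: normcN. Qed.
Lemma cmod0 : cmod (0 : R[i]) = 0.
Proof. exact: Normc.normc0. Qed.
Lemma cmod1 : cmod (1 : R[i]) = 1.
Proof. exact: Normc.normc1. Qed.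
Lemma cmodB z1 z2 : cmod (z1 - z2) <= cmod z1 + cmod z2.
Proof. by rewrite -(cmodN z2); exact: cmodD. Qed.
Lemma cmod_distC z1 z2 : cmod (z1 - z2) = cmod (z2 - z1).
Proof. by rewrite -cmodN opprB. Qed.
Lemma cmod_eq0 z : cmod z = 0 -> z = 0.
Proof. exact: Normc.eq0_normc. Qed.
Lemma cmodX z k : cmod (z ^+ k) = cmod z ^+ k.
Proof. by elim: k => [|k IH]; rewrite ?expr0 ?cmod1 // !exprS cmodM IH. Qed.
Lemma cmod_real (a : R) : cmod a%:C = `|a|.
Proof. by rewrite /cmod /= expr0n /= addr0 sqrtr_sqr. Qed.
Lemma cmod_Re z : `|complex.Re z| <= cmod z.
Proof.
case: z => a b; rewrite /cmod /= -sqrtr_sqr ler_wsqrtr //.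
by rewrite lerDl sqr_ge0.
Qed.
Lemma cmod_Im z : `|complex.Im z| <= cmod z.
Proof.
case: z => a b; rewrite /cmod /= -sqrtr_sqr ler_wsqrtr //.
by rewrite lerDr sqr_ge0.
Qed.
Lemma complexE z : z = (complex.Re z)%:C + 'i * (complex.Im z)%:C.
Proof.
case: z => a b; apply/eqP; rewrite eq_complex /=.
by apply/andP; split; apply/eqP; ring.
Qed.
Lemma cmod_le z : cmod z <= `|complex.Re z| + `|complex.Im z|.
Proof.
rewrite {1}(complexE z); apply: le_trans (cmodD _ _) _.
rewrite cmodM !cmod_real lerD2l; case: z => a b /=.
by rewrite /cmod /= expr0n expr1n /= add0r sqrtr1 mul1r.
Qed.
Lemma cmod_le2 z (A B : R) : `|complex.Re z| <= A -> `|complex.Im z| <= B ->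
  cmod z <= A + B.
Proof. by move=> a b; apply: le_trans (cmod_le z) (lerD a b). Qed.
Lemma cmod_sum (I : Type) (r : seq I) (P : pred I) (F : I -> R[i]) :
  cmod (\sum_(i <- r | P i) F i) <= \sum_(i <- r | P i) cmod (F i).
Proof.
elim/big_ind2: _ => [|x a y b xa yb|//]; first by rewrite cmod0.
exact: le_trans (cmodD _ _) (lerD xa yb).
Qed.
End Cmod.

(** * Mean value theorem, Taylor remainders and equality of mixed derivatives *)

Section OneVar.
Context {R : realType}.

Lemma is_derive_continuous (f : R -> R) (x d : R) : is_derive x 1 f d ->
  {for x, continuous f}.
Proof.
by move=> [df _]; apply: differentiable_continuous; apply/derivable1_diffP.
Qed.

(** Writing the intermediate point as [u * h] with [u] in the unit interval covers both signs of
    [h], so that no later use has to distinguish them. *)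
Lemma MVT01 (f df : R -> R) (h : R) :
  (forall u : R, 0 <= u <= 1 -> is_derive (u * h) 1 f (df (u * h))) ->
  exists2 u, 0 <= u <= 1 & f h - f 0 = h * df (u * h).
Proof.
move=> H.
have K (t : R) : h != 0 -> 0 <= t / h <= 1 -> is_derive t 1 f (df t).
  by move=> h0 th; have := H _ th; rewrite divfK.
have [h0|h0|->] := ltgtP h 0; last first.
- by exists 0; rewrite ?lexx ?ler01 // subrr mul0r.
- have hn : h != 0 by rewrite gt_eqF.
  have I t : 0 <= t <= h -> 0 <= t / h <= 1.
    by move=> /andP[a b]; rewrite divr_ge0 ?ler_pdivrMr ?mul1r // ltW.
  have [|||c] := @MVT_segment R f df 0 h.
  + exact: ltW.
  + by move=> x; rewrite in_itv /= => /andP[a b]; apply: K hn (I _ _); rewrite !ltW.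
  + apply: derivable_within_continuous => x; rewrite in_itv /= => xh.
    by have [] := K x hn (I _ xh).
  rewrite in_itv /= => ch ->; exists (c / h); first exact: I.
  by rewrite divfK // subr0 mulrC.
- have hn : h != 0 by rewrite lt_eqF.
  have I t : h <= t <= 0 -> 0 <= t / h <= 1.
    move=> /andP[a b]; rewrite ler_ndivrMr // mul1r a andbT.
    by rewrite nmulr_lge0 // invr_lt0.
  have [|||c] := @MVT_segment R f df h 0.
  + exact: ltW.
  + by move=> x; rewrite in_itv /= => /andP[a b]; apply: K hn (I _ _); rewrite !ltW.
  + apply: derivable_within_continuous => x; rewrite in_itv /= => xh.
    by have [] := K x hn (I _ xh).
  rewrite in_itv /= => ch e; exists (c / h); first exact: I.
  by rewrite divfK // -opprB e sub0r mulrN opprK mulrC.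
Qed.

(** A remainder of order [h ^+ 2] forces the difference quotient to converge. This is how
    derivatives are found for functions not built by the usual rules: limits, integrals with a
    parameter, functions glued at a point. *)
Lemma quad_is_derive (V : normedModType R) (f : V -> R) (x v : V) (d A e : R) :
  0 < e -> (forall h, `|h| < e -> `|f (h *: v + x) - f x - h * d| <= A * h ^+ 2) ->
  is_derive x v f d.
Proof.
move=> e0 H.
have A0 : 0 <= `|A| + 1 by rewrite addr_ge0.
have L : (fun h => h^-1 *: ((f \o shift x) (h *: v) - f x)) @ 0^' --> d.
  apply/cvgrPdist_le => r r0; near=> h.
  have h0 : h != 0 by near: h; exact: nbhs_dnbhs_neq.
  have he : `|h| < e by near: h; apply: dnbhs0_lt.
  have hr : `|h| < r / (`|A| + 1).
    by near: h; apply: dnbhs0_lt; rewrite divr_gt0 // ltr_wpDl.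
  rewrite distrC -[X in `|_ - X|](mulKf h0) -mulrBr normrM normfV.
  rewrite ler_pdivrMl ?normr_gt0 //=; apply: le_trans (H h he) _.
  apply: le_trans (_ : (`|A| + 1) * `|h| ^+ 2 <= _).
    by rewrite -[h ^+ 2](real_normK (num_real h)) ler_wpM2r ?sqr_ge0 //
      (le_trans (ler_norm _)) // lerDl.
  rewrite expr2 mulrCA ler_wpM2l // mulrC -ler_pdivlMr ?ltr_wpDl //.
  exact: ltW.
apply: DeriveDef; first by apply/cvg_ex; exists d.
exact/cvg_lim.
Unshelve. all: by end_near. Qed.

End OneVar.

Section Lines.
Context {R : realType} {n : nat}.
Local Notation E := 'rV[R]_n.
Local Notation C := R[i].
Local Notation ei i := (delta_mx 0 i : E).
Implicit Types (U V : set E) (f g : E -> C) (w : seq 'I_n) (x y : E) (i j : 'I_n).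

Lemma rV_norm_leP x (r : R) : 0 <= r ->
  `|x| <= r <-> forall i, `|x 0 i| <= r.
Proof.
move=> r0; rewrite /Num.norm /= mx_normrE; split=> [/bigmax_leP[_ H] i|H].
  exact: (H (0, i)).
apply/bigmax_leP; split=> // -[a i] _ /=; rewrite ord1; exact: H.
Qed.

Lemma rV_norm_ltP x (r : R) : 0 < r ->
  `|x| < r <-> forall i, `|x 0 i| < r.
Proof.
move=> r0; rewrite /Num.norm /= mx_normrE; split=> [/bigmax_ltP[_ H] i|H].
  exact: (H (0, i)).
apply/bigmax_ltP; split=> // -[a i] _ /=; rewrite ord1; exact: H.
Qed.

Lemma line_is_derive (f : E -> R) x (v : E) (t : R) :
  derivable f (x + t *: v) v ->
  is_derive t 1 (fun u => f (x + u *: v)) ('D_v f (x + t *: v)).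
Proof.
move=> df; rewrite /derivable /derive in df *.
have e : (fun h : R => h^-1 *: (((fun u => f (x + u *: v)) \o shift t) (h *: 1)
      - f (x + t *: v))) =
    (fun h => h^-1 *: ((f \o shift (x + t *: v)) (h *: v) - f (x + t *: v))).
  apply/funext => h /=; congr (_ *: (f _ - _)).
  by rewrite [_%:A]mulr1 scalerDl addrCA addrA.
apply: DeriveDef; first by rewrite /derivable e.
by rewrite /derive e.
Qed.

Lemma MVT_line (f : E -> R) x i (h : R) :
  (forall u : R, 0 <= u <= 1 -> derivable f (x + (u * h) *: ei i) (ei i)) ->
  exists2 u, 0 <= u <= 1 &
    f (x + h *: ei i) - f x = h * partial_re i f (x + (u * h) *: ei i).
Proof.
move=> H; have [|u u01 e] := @MVT01 R (fun t => f (x + t *: ei i))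
   (fun t => partial_re i f (x + t *: ei i)) h.
  by move=> u u01; apply: line_is_derive; exact: H.
by exists u => //; rewrite -e scale0r addr0.
Qed.

(** The left side is symmetric in [i] and [j] while the right side carries the mixed derivative in
    one order: this asymmetry is what yields Schwarz's theorem. *)
Lemma second_difference (f : E -> R) x i j (h : R) :
  (forall u v : R, 0 <= u <= 1 -> 0 <= v <= 1 ->
     let y := x + (u * h) *: ei i + (v * h) *: ei j in
     derivable f y (ei i) /\ derivable (partial_re i f) y (ei j)) ->
  exists u v, [/\ 0 <= u <= 1, 0 <= v <= 1 &
    f (x + h *: ei i + h *: ei j) - f (x + h *: ei i) - f (x + h *: ei j) + f x
    = h * (h * partial_re j (partial_re i f)
               (x + (u * h) *: ei i + (v * h) *: ei j))].
Proof.
move=> H.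
(* The second difference is [phi h - phi 0]; the mean value theorem is applied to [phi] along [i],
   and then to [partial_re i f] along [j]. *)
pose phi t := f (x + h *: ei j + t *: ei i) - f (x + t *: ei i).
have I0 : 0 <= (0 : R) <= 1 by rewrite lexx ler01.
have I1 : 0 <= (1 : R) <= 1 by rewrite lexx ler01.
have [|u u01 e] := @MVT01 R phi (fun t =>
    partial_re i f (x + h *: ei j + t *: ei i) - partial_re i f (x + t *: ei i)) h.
  move=> u u01; apply: is_deriveB; apply: line_is_derive.
    by have [] := H u 1 u01 I1; rewrite mul1r addrAC.
  by have [] := H u 0 u01 I0; rewrite mul0r scale0r addr0.
have [|v v01 e'] := @MVT_line (partial_re i f) (x + (u * h) *: ei i) j h.
  by move=> v v01; have [] := H u v u01 v01.
exists u, v; split=> //; rewrite -e' [in RHS]addrAC -e /phi !scale0r !addr0.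
rewrite [x + h *: ei i + h *: ei j]addrAC; ring.
Qed.

Lemma open_line U x : open U -> U x -> exists2 e : R, 0 < e &
  forall i j (s t : R), `|s| < e -> `|t| < e -> U (x + s *: ei i + t *: ei j).
Proof.
move=> oU Ux; have /nbhs_ballP[e /= e0 He] : nbhs x U by exact: open_nbhs_nbhs.
exists (e / 4) => [|i j s t se te]; first by rewrite divr_gt0.
apply: He; rewrite -ball_normE /ball_ /=.
have N (k : 'I_n) (r : R) : `|r *: ei k| <= `|r|.
  rewrite normrZ ler_piMr //; apply/rV_norm_leP => //= b.
  by rewrite mxE eqxx /=; case: eqP => _; rewrite ?normr1 ?normr0 ?ler01.
rewrite -addrA opprD addrA subrr add0r normrN.
apply: le_lt_trans (ler_normD _ _) _.
apply: le_lt_trans (lerD (N _ _) (N _ _)) _.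
apply: lt_le_trans (ltrD se te) _; lra.
Qed.

Lemma cont_near_lt (g : E -> R) x (e : R) : {for x, continuous g} -> 0 < e ->
  nbhs x [set y | `|g y - g x| < e].
Proof.
move=> /cvgrPdist_lt H /H; apply: filterS => y /=; by rewrite distrC.
Qed.

Lemma dist_quarter_eq (a b c : R) :
  `|c - a| < `|a - b| / 4 -> `|c - b| < `|a - b| / 4 -> False.
Proof.
move=> h1 h2; have : `|a - b| <= `|c - a| + `|c - b|.
  rewrite -(distrC a c); apply: le_trans (ler_normD _ _).
  by rewrite addrA subrK.
have := normr_ge0 (a - b); lra.
Qed.

(** If the mixed derivatives at [x] were at distance [e > 0], continuity would keep each within
    [e / 4] of its value nearby, while one and the same second difference is [h * h] times either of
    them at nearby points. *)
Lemma schwarz_re U (f : E -> R) x i j : open U -> real_smooth U f -> U x ->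
  partial_re i (partial_re j f) x = partial_re j (partial_re i f) x.
Proof.
move=> oU sf Ux; apply/eqP; rewrite -subr_eq0 -normr_eq0.
apply/negPn/negP => ne.
set e := `|_| in ne; have e0 : 0 < e / 4 by rewrite divr_gt0 // lt_def ne normr_ge0.
have na := cont_near_lt (proj1 (sf [:: i; j] x Ux)) e0.
have nb := cont_near_lt (proj1 (sf [:: j; i] x Ux)) e0.
have nU : nbhs x U by exact: open_nbhs_nbhs.
pose W := U `&` ([set y | `|foldr partial_re f [:: i; j] y -
    foldr partial_re f [:: i; j] x| < e / 4] `&`
  [set y | `|foldr partial_re f [:: j; i] y -
    foldr partial_re f [:: j; i] x| < e / 4]).
have Wx : nbhs x W by apply: filterI => //; exact: filterI.
have [r r0 Hr] := open_line (@open_interior _ _) (Wx : W^° x).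
have h0 : r / 2 != 0 by rewrite mulf_neq0 // gt_eqF // invr_gt0.
set h := r / 2 in h0.
have hr : `|h| < r by rewrite gtr0_norm /h; lra.
have ur u : 0 <= u <= 1 -> `|u * h| < r.
  move=> /andP[u0 u1]; rewrite normrM; apply: le_lt_trans hr.
  by rewrite ler_piMl // ger0_norm.
have dU k l u v : 0 <= u <= 1 -> 0 <= v <= 1 ->
    let y := x + (u * h) *: ei k + (v * h) *: ei l in
    derivable f y (ei k) /\ derivable (partial_re k f) y (ei l).
  move=> u01 v01 y.
  have [Uy _] := interior_subset (Hr k l _ _ (ur u u01) (ur v v01)).
  by split; [exact: (proj2 (sf [::] _ Uy) k)|exact: (proj2 (sf [:: k] _ Uy) l)].
have [u1 [v1 [u01 v01 e1]]] := second_difference (dU i j).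
have [_ [_ w1]] := interior_subset (Hr i j _ _ (ur _ u01) (ur _ v01)).
have [u2 [v2 [u02 v02 e2]]] := second_difference (dU j i).
have [_ [w2 _]] := interior_subset (Hr j i _ _ (ur _ u02) (ur _ v02)).
rewrite [x + h *: ei j + _]addrAC [X in X + _ = _]addrAC in e2.
have e12 (S d1 d2 : R) : S = h * (h * d1) -> S = h * (h * d2) -> d1 = d2.
  by move=> -> /(mulfI h0)/(mulfI h0).
move: w1; rewrite /= -/h (e12 _ _ _ e1 e2) => w1.
exact: dist_quarter_eq w2 w1.
Qed.

Lemma schwarz U f x i j : open U -> smooth U f -> U x ->
  partial i (partial j f) x = partial j (partial i f) x.
Proof.
move=> oU /smooth_re_im[sr si] Ux.
exact: (congr2 (@Complex R) (schwarz_re i j oU sr Ux) (schwarz_re i j oU si Ux)).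
Qed.

Lemma pw_swap U f i w1 w2 x : open U -> smooth U f -> U x ->
  pw (i :: w1 ++ w2) f x = pw (w1 ++ i :: w2) f x.
Proof.
move=> oU sf; elim: w1 x => //= j w1 IH x Ux.
rewrite (schwarz i j oU _ Ux); last exact: smooth_pw.
exact: (eq_partial oU j IH Ux).
Qed.

Lemma perm_pw U f w w' x : open U -> smooth U f -> perm_eq w w' -> U x ->
  pw w f x = pw w' f x.
Proof.
move=> oU sf; elim: w w' x => [|i w IH] w' x.
  by move/perm_size; case: w'.
move=> ww'; have iw' : i \in w' by rewrite -(perm_mem ww') mem_head.
case/splitPr: iw' ww' => w1 w2 ww' Ux.
rewrite -(pw_swap _ _ _ oU sf Ux) /=; apply: (eq_partial oU) => // y Uy.
apply: IH => //; rewrite -(perm_cons i); apply: (perm_trans ww').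
by rewrite -[i :: w2]cat1s perm_catCA.
Qed.

Definition word (a : multi_index n) : seq 'I_n :=
  flatten [seq nseq (a i) i | i <- enum 'I_n].

Definition wcount w : multi_index n := [ffun i => count_mem i w].

Lemma dpartE a f : dpart a f = pw (word a) f.
Proof.
rewrite /dpart /word; elim: (enum _) => //= i s IH.
rewrite pw_cat -IH; set g := foldr _ _ _.
by elim: (a i) => //= k ->.
Qed.

Lemma size_word a : size (word a) = mabs a.
Proof.
rewrite /word /mabs size_flatten /shape -map_comp sumnE big_map big_enum /=.
by apply: eq_bigr => i _; rewrite size_nseq.
Qed.

Lemma word_wcount w : perm_eq w (word (wcount w)).
Proof.
apply/permP => p; rewrite /word count_flatten -map_comp sumnE big_map big_enum /=.
under eq_bigr => i _ do rewrite /= count_nseq ffunE.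
elim: w => [|k w IH] /=; first by rewrite big1 // => i _; rewrite muln0.
under eq_bigr => i _ do rewrite mulnDr.
rewrite big_split /= -IH (bigD1 k) //= eqxx muln1 big1 ?addn0 // => i ik.
by rewrite eq_sym (negbTE ik) muln0.
Qed.

Lemma mabs_wcount w : mabs (wcount w) = size w.
Proof. by rewrite -size_word -(perm_size (word_wcount w)). Qed.

Lemma pw_dpart U f w x : open U -> smooth U f -> U x ->
  pw w f x = dpart (wcount w) f x.
Proof.
by move=> oU sf Ux; rewrite dpartE; apply: (perm_pw oU sf (word_wcount w) Ux).
Qed.

End Lines.

(** * Boxes, Lipschitz bounds, limits of smooth functions and Leibniz's rule *)

Section Boxes.
Context {R : realType} {n : nat}.
Local Notation E := 'rV[R]_n.
Local Notation C := R[i].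
Local Notation ei i := (delta_mx 0 i : E).
Implicit Types (U V : set E) (f g : E -> C) (w : seq 'I_n) (x y c : E) (i j : 'I_n).

Definition cbox c (r : R) : set E := [set x | forall i, `|x 0 i - c 0 i| <= r].
Definition obox c (r : R) : set E := [set x | forall i, `|x 0 i - c 0 i| < r].

Lemma cbox_ball c r x : 0 < r -> obox c r x <-> ball c r x.
Proof.
move=> r0; rewrite -ball_normE /ball_ /= distrC rV_norm_ltP //.
by split=> H i; have := H i; rewrite !mxE.
Qed.

Lemma obox_open c r : open (obox c r).
Proof.
have [r0|r0] := leP r 0.
  case: (pselect (exists x, obox c r x)) => [[x xr]|nx].
    suff -> : obox c r = setT by exact: openT.
    apply/seteqP; split=> // y _ i; have := xr i; move/(le_lt_trans (normr_ge0 _)).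
    by rewrite ltNge r0.
  suff -> : obox c r = set0 by exact: open0.
  by apply/seteqP; split=> // x xr; apply: nx; exists x.
suff -> : obox c r = ball c r by exact: ball_open.
by apply/seteqP; split=> x /cbox_ball; apply.
Qed.

Lemma cbox_compact c r : compact (cbox c r).
Proof.
have := @rV_compact R n (fun i => `[c 0 i - r, c 0 i + r]%classic)
  (fun i => @segment_compact _ _ _).
congr compact; apply/seteqP; split=> x H i; have := H i;
  by rewrite /= in_itv /= ler_distl.
Qed.

Lemma cbox_closed c r : closed (cbox c r).
Proof. apply: compact_closed; [exact: norm_hausdorff|exact: cbox_compact]. Qed.

Lemma subset_cbox c r1 r2 : r1 <= r2 -> cbox c r1 `<=` cbox c r2.
Proof. by move=> r12 x H i; exact: le_trans (H i) r12. Qed.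

Lemma obox_cbox c r : obox c r `<=` cbox c r.
Proof. by move=> x H i; exact: ltW. Qed.

Lemma cbox_obox c r1 r2 : r1 < r2 -> cbox c r1 `<=` obox c r2.
Proof. by move=> r12 x H i; exact: le_lt_trans (H i) r12. Qed.

Lemma cbox_center c r : 0 <= r -> cbox c r c.
Proof. by move=> r0 i; rewrite subrr normr0. Qed.

Lemma obox_center c r : 0 < r -> obox c r c.
Proof. by move=> r0 i; rewrite subrr normr0. Qed.

Lemma open_cbox U c : open U -> U c -> exists2 r : R, 0 < r & cbox c r `<=` U.
Proof.
move=> oU Uc; have /nbhs_ballP[e /= e0 He] : nbhs c U by exact: open_nbhs_nbhs.
exists (e / 2); first by rewrite divr_gt0.
move=> x xe; apply: He; apply/cbox_ball => //.
by apply: cbox_obox xe; rewrite ltr_pdivrMr // mulrDr mulr1 ltrDl.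
Qed.

(** A convex set [I] of numbers gives, through [rect], the open boxes as well as the whole space, so
    that the Lipschitz and limit lemmas below are proved once for both. *)
Definition conv1 (I : set R) :=
  forall a b t, I a -> I b -> 0 <= t <= 1 -> I (a + t * (b - a)).

Definition rect (I : set R) c : set E := [set x | forall i, I (x 0 i - c 0 i)].

Lemma conv1_le r : conv1 [set t | `|t| <= r].
Proof.
move=> a b t /= ar br /andP[t0 t1].
have -> : a + t * (b - a) = (1 - t) * a + t * b by ring.
apply: le_trans (ler_normD _ _) _; rewrite !normrM (ger0_norm t0).
rewrite (@ger0_norm _ (1 - t)) ?subr_ge0 //.
have h1 : (1 - t) * `|a| <= (1 - t) * r by rewrite ler_wpM2l // subr_ge0.
have h2 : t * `|b| <= t * r by rewrite ler_wpM2l.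
lra.
Qed.

Lemma conv1_lt r : conv1 [set t | `|t| < r].
Proof.
move=> a b t /= ar br t01.
have [ab|ab] := leP `|a| `|b|.
  exact: le_lt_trans (conv1_le ab (lexx _) t01) br.
exact: le_lt_trans (conv1_le (lexx _) (ltW ab) t01) ar.
Qed.

Section Lipschitz.
Variables (I : set R) (c : E).
Hypothesis cI : conv1 I.

Lemma rect_line x i (h : R) (u : R) : rect I c x -> rect I c (x + h *: ei i) ->
  0 <= u <= 1 -> rect I c (x + (u * h) *: ei i).
Proof.
move=> Vx Vxh u01 j; have := cI (Vx j) (Vxh j) u01.
rewrite !mxE; congr I; case: eqP => _; rewrite /= ?eqxx /=; ring.
Qed.

Lemma line_bound (g : E -> R) x i (h A : R) :
  rect I c x -> rect I c (x + h *: ei i) ->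
  (forall y, rect I c y -> derivable g y (ei i)) ->
  (forall y, rect I c y -> `|partial_re i g y| <= A) ->
  `|g (x + h *: ei i) - g x| <= `|h| * A.
Proof.
move=> Vx Vxh dg gA; have [u u01|u u01 ->] := @MVT_line R n g x i h.
  exact/dg/rect_line.
by rewrite normrM ler_wpM2l //; exact/gA/rect_line.
Qed.

Lemma quad_bound (g : E -> R) x i (h A : R) :
  rect I c x -> rect I c (x + h *: ei i) ->
  (forall y, rect I c y -> derivable g y (ei i)) ->
  (forall y, rect I c y -> derivable (partial_re i g) y (ei i)) ->
  (forall y, rect I c y -> `|partial_re i (partial_re i g) y| <= A) ->
  `|g (x + h *: ei i) - g x - h * partial_re i g x| <= A * h ^+ 2.
Proof.
move=> Vx Vxh dg dg2 gA; have [u u01|u u01 ->] := @MVT_line R n g x i h.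
  exact/dg/rect_line.
have Vu := rect_line Vx Vxh u01.
have uh : `|u * h| <= `|h|.
  by rewrite normrM ler_piMl //; case/andP: u01 => u0; rewrite ger0_norm.
rewrite -mulrBr normrM -[h ^+ 2]real_normK ?num_real // expr2 [leRHS]mulrC -mulrA.
rewrite ler_wpM2l //; apply: le_trans (line_bound Vx Vu dg2 gA) _.
by rewrite ler_wpM2r // (le_trans _ (gA _ Vx)).
Qed.

Lemma lipschitz_rect (U : set E) f (A : R) : rect I c `<=` U -> smooth U f ->
  (forall i y, rect I c y -> cmod (partial i f y) <= A) ->
  forall x y, rect I c x -> rect I c y ->
  cmod (f y - f x) <= \sum_i `|y 0 i - x 0 i| * (A + A).
Proof.
move=> VU sf fA x y Vx Vy.
(* The coordinates of [x] are changed into those of [y] one after the other; every intermediate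
   point stays in the product set [rect I c]. *)
pose z k : E := \row_i (if (i < k)%N then y 0 i else x 0 i).
have Vz k : rect I c (z k) by move=> i; rewrite mxE; case: ifP.
have zS (k : 'I_n) : z k.+1 = z k + (y 0 k - x 0 k) *: ei k.
  apply/rowP => i; rewrite !mxE eqxx /= ltnS leq_eqVlt.
  case: (eqVneq i k) => [->|ik]; first by rewrite eqxx ltnn mulr1 addrC subrK.
  by rewrite -val_eqE /= in ik; rewrite (negbTE ik) /= mulr0 addr0.
have -> : f y - f x = \sum_(k < n) (f (z k.+1) - f (z k)).
  rewrite -(big_mkord xpredT (fun k => f (z k.+1) - f (z k))) telescope_sumr //.
  congr (f _ - f _); apply/rowP => i; rewrite !mxE ?ltn_ord //.
apply: le_trans (cmod_sum _ _ _) _; apply: ler_sum => k _.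
have Vk : rect I c (z k + (y 0 k - x 0 k) *: ei k) by rewrite -zS; exact: Vz.
(* Real and imaginary parts have their own mean value points and are estimated separately, whence
   [A + A]. *)
rewrite mulrDr zS; apply: cmod_le2; rewrite raddfB.
  apply: (line_bound (g := re_part f) (Vz k) Vk) => v Vv.
    exact: (proj1 (smooth_cdiff k sf (VU _ Vv))).
  exact: le_trans (cmod_Re (partial k f v)) (fA k v Vv).
apply: (line_bound (g := im_part f) (Vz k) Vk) => v Vv.
  exact: (proj2 (smooth_cdiff k sf (VU _ Vv))).
exact: le_trans (cmod_Im (partial k f v)) (fA k v Vv).
Qed.

Lemma lipschitz_rect_norm (U : set E) f (A : R) : rect I c `<=` U -> smooth U f ->
  (forall i y, rect I c y -> cmod (partial i f y) <= A) -> 0 <= A ->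
  forall x y, rect I c x -> rect I c y ->
  cmod (f y - f x) <= n%:R * (A + A) * `|y - x|.
Proof.
move=> VU sf fA A0 x y Vx Vy; apply: le_trans (lipschitz_rect VU sf fA Vx Vy) _.
apply: le_trans (_ : \sum_(i < n) `|y - x| * (A + A) <= _).
  apply: ler_sum => i _; rewrite ler_wpM2r ?addr_ge0 //.
  by have /rV_norm_leP/(_ i) := lexx `|y - x|; rewrite !mxE; apply.
rewrite sumr_const card_ord -[leLHS]mulr_natl [`|_| * (A + A)]mulrC mulrA.
exact: lexx.
Qed.

End Lipschitz.

Lemma near_le_cont (g : E -> R) x :
  (forall e : R, 0 < e -> nbhs x [set y | `|g y - g x| <= e]) ->
  {for x, continuous g}.
Proof.
move=> H; have /cvgrPdist_le : forall e : R, 0 < e ->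
    \forall y \near nbhs x, `|g x - g y| <= e.
  by move=> e e0; move: (H e e0); apply: filterS => y /=; rewrite distrC.
exact.
Qed.

(** Transfers a Taylor estimate from approximations [a'], [b'], [d'] to their limits; the error is
    [(2 + |h|) * r], small with [r] for fixed [h]. *)
Lemma quotient_approx (a b d a' b' d' h B r e : R) :
  `|a' - b' - h * d'| <= B -> `|a' - a| <= r -> `|b' - b| <= r ->
  `|d' - d| <= r -> (2 + `|h|) * r = e -> `|a - b - h * d| <= B + e.
Proof.
move=> HB ha hb hd <-.
have -> : a - b - h * d = (a' - b' - h * d') + ((b' - b) + (- (a' - a) +
   h * (d' - d))) by ring.
apply: le_trans (ler_normD _ _) (lerD HB _); apply: le_trans (ler_normD _ _) _.
have h1 := ler_normD (- (a' - a)) (h * (d' - d)).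
have h2 : `|h * (d' - d)| <= `|h| * r by rewrite normrM ler_wpM2l.
rewrite normrN in h1; rewrite mulrDl; lra.
Qed.

Section SmoothLimit.
Variables (I : set R) (c : E).
Hypotheses (cI : conv1 I) (oV : open (rect I c)).
Let V := rect I c.
Variables (T : Type) (FF : set_system T).
Hypothesis (PF : ProperFilter FF).
Variables (F : T -> E -> C) (G : seq 'I_n -> E -> C).
Hypothesis sF : forall k, smooth V (F k).
Hypothesis bF : forall w, exists2 A : R, 0 <= A &
  forall k x, V x -> cmod (pw w (F k) x) <= A.
Hypothesis cF : forall w x, V x -> forall e : R, 0 < e ->
  \forall k \near FF, cmod (pw w (F k) x - G w x) <= e.

Let G_lip w : exists2 A : R, 0 <= A & forall x y, V x -> V y ->
  cmod (G w y - G w x) <= A * `|y - x|.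
Proof.
have [A A0 HA] : exists2 A : R, 0 <= A & forall k i x, V x ->
    cmod (partial i (pw w (F k)) x) <= A.
  have /(_ _)/cid2 B i := bF (i :: w).
  exists (\sum_i projT1 (B i)) => [|k i x Vx].
    by apply: sumr_ge0 => i _; case: (B i).
  rewrite (bigD1 i) //=; case: (B i) => b b0 Hb /=.
  apply: le_trans (Hb k x Vx) _; rewrite lerDl; apply: sumr_ge0 => j _.
  by case: (B j).
exists (n%:R * (A + A)); first by rewrite mulr_ge0 // addr_ge0.
move=> x y Vx Vy; apply/ler_addgt0Pr => e e0.
have e20 : 0 < e / 2 by rewrite divr_gt0.
have [k [kx ky]] := filter_ex (filterI (cF w Vx e20) (cF w Vy e20)).
have L := lipschitz_rect_norm (U := V) cI (fun _ Vz => Vz) (smooth_pw w (sF k)) (HA k) A0 Vx Vy.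
have -> : G w y - G w x = (pw w (F k) y - pw w (F k) x)
   + ((G w y - pw w (F k) y) + (pw w (F k) x - G w x)) by ring.
apply: le_trans (cmodD _ _) _; apply: (lerD L); apply: le_trans (cmodD _ _) _.
rewrite cmod_distC; lra.
Qed.

Let G_cont w x : V x -> ccont (G w) x.
Proof.
move=> Vx; have [A A0 HA] := G_lip w.
have nV : nbhs x V by exact: open_nbhs_nbhs.
have K (p : C -> R) : (forall z, `|p z| <= cmod z) ->
    (forall z1 z2, p (z1 - z2) = p z1 - p z2) ->
    {for x, continuous (fun y => p (G w y))}.
  move=> pc pB; apply: near_le_cont => e e0.
  have A1 : 0 < A + 1 by rewrite ltr_wpDl.
  have nb : nbhs x (ball x (e / (A + 1))) by apply: nbhsx_ballx; exact: divr_gt0.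
  apply: filterS (filterI nV nb) => y [Vy xy] /=.
  rewrite -pB; apply: le_trans (pc _) (le_trans (HA x y Vx Vy) _).
  move: xy; rewrite -ball_normE /ball_ /= distrC ltr_pdivlMr // mulrDr mulr1 mulrC.
  have := normr_ge0 (y - x); lra.
split; apply: K => [z|z1 z2]; rewrite ?raddfB //;
  [exact: cmod_Re|exact: cmod_Im].
Qed.

Let G_deriv w i x : V x ->
  is_derive x (ei i) (re_part (G w)) (complex.Re (G (i :: w) x)) /\
  is_derive x (ei i) (im_part (G w)) (complex.Im (G (i :: w) x)).
Proof.
move=> Vx; have [A A0 HA] := bF [:: i, i & w].
have [e e0 He] := open_line oV Vx.
have Vh h : `|h| < e -> V (x + h *: ei i).
  by move=> he; have := He i i h 0 he; rewrite normr0 scale0r addr0; apply.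
have K (p : C -> R) : (forall z, `|p z| <= cmod z) ->
    (forall z1 z2, p (z1 - z2) = p z1 - p z2) ->
    (forall k h, `|h| < e -> `|p (pw w (F k) (x + h *: ei i)) - p (pw w (F k) x)
      - h * p (pw (i :: w) (F k) x)| <= A * h ^+ 2) ->
    is_derive x (ei i) (fun y => p (G w y)) (p (G (i :: w) x)).
  move=> pc pB H; apply: (@quad_is_derive _ _ _ _ _ _ A e) => // h he.
  rewrite [h *: _ + x]addrC /=; apply/ler_addgt0Pr => d d0.
  have d3 : 0 < d / (2 + `|h|) by rewrite divr_gt0 // ltr_wpDr.
  have [k [[kx kh] ki]] := filter_ex (filterI (filterI (cF w Vx d3)
    (cF w (Vh h he) d3)) (cF (i :: w) Vx d3)).
  have {}kx := le_trans (pc _) kx; have {}kh := le_trans (pc _) kh.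
  have {}ki := le_trans (pc _) ki; rewrite pB in kx; rewrite pB in kh; rewrite pB in ki.
  by apply: (quotient_approx (H k h he) kh kx ki); rewrite mulrC divfK // gt_eqF // ltr_wpDr.
have VV : rect I c `<=` V by [].
split; apply: K => [z|z1 z2|k h he]; rewrite ?raddfB //.
- exact: cmod_Re.
- apply: (quad_bound cI) => //; first exact: Vh.
  + by move=> y Vy; exact: (proj1 (smooth_cdiff i (smooth_pw w (sF k)) Vy)).
  + by move=> y Vy; exact: (proj1 (smooth_cdiff i (smooth_pw (i :: w) (sF k)) Vy)).
  + by move=> y Vy; exact: le_trans (cmod_Re _) (HA k y Vy).
- exact: cmod_Im.
- apply: (quad_bound cI) => //; first exact: Vh.
  + by move=> y Vy; exact: (proj2 (smooth_cdiff i (smooth_pw w (sF k)) Vy)).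
  + by move=> y Vy; exact: (proj2 (smooth_cdiff i (smooth_pw (i :: w) (sF k)) Vy)).
  + by move=> y Vy; exact: le_trans (cmod_Im _) (HA k y Vy).
Qed.

Let G_partial w i x : V x -> partial i (G w) x = G (i :: w) x.
Proof.
move=> Vx; have [[_ e1] [_ e2]] := G_deriv w i Vx.
rewrite /partial /partial_re e1 e2; by case: (G _ x).
Qed.

(** Convergence is only pointwise, along a filter. The uniform bounds on one further derivative make
    the limits Lipschitz, hence continuous; those on two further derivatives give a quadratic Taylor
    remainder that survives the limit and identifies the derivative of [G w] as [G (i :: w)]. *)
Lemma smooth_limit : smooth V (G [::]) /\
  forall w x, V x -> pw w (G [::]) x = G w x.
Proof.
split; last first.
  elim=> [//|i w IH] x Vx /=.
  by rewrite -G_partial //; apply: (eq_partial oV).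
apply: (smooth_coind oV (S := fun f => exists w, f = G w)); last by exists [::].
  move=> f [w ->] x Vx; split=> [|i]; first exact: G_cont.
  have [[d1 _] [d2 _]] := G_deriv w i Vx; exact: (conj d1 d2).
move=> f [w ->] i; exists (G (i :: w)); first by exists (i :: w).
by move=> x; exact: G_partial.
Qed.

End SmoothLimit.

(** Each derivative doubles the number of terms, whence the power of 2. The condition on [wt] holds
    for the constant weight 1 of the C^N seminorms and for the Gevrey weights, so both cases share
    this lemma. *)
Lemma leibniz_bound U f g x N (A B : R) (wt : nat -> R) :
  open U -> smooth U f -> smooth U g -> U x -> 0 <= A -> 0 <= B ->
  (forall k, 0 <= wt k) ->
  (forall k l : nat, (k + l <= N)%N -> wt k * wt l <= wt (k + l)%N) ->
  (forall w, (size w <= N)%N -> cmod (pw w f x) <= A * wt (size w)) ->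
  (forall w, (size w <= N)%N -> cmod (pw w g x) <= B * wt (size w)) ->
  forall w, (size w <= N)%N ->
    cmod (pw w (fun y => f y * g y) x) <= A * B * 2 ^+ size w * wt (size w).
Proof.
move=> oU sf sg Ux A0 B0 w0 wM fA gB w wN.
(* [w1] and [w2] record the derivatives already spent on each factor; the induction puts the next
   letter on one side or the other. *)
suff H w1 w2 : (size w + size w1 + size w2 <= N)%N ->
    cmod (pw w (fun y => pw w1 f y * pw w2 g y) x) <=
    A * B * 2 ^+ size w * wt (size w + size w1 + size w2)%N.
  by have := H [::] [::]; rewrite /= !addn0; apply.
elim/last_ind: w w1 w2 {wN} => [|w i IH] w1 w2 /=.
  rewrite add0n expr0 mulr1 cmodM => s12.
  apply: le_trans (_ : A * wt (size w1) * (B * wt (size w2)) <= _).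
    apply: ler_pM; rewrite ?cmod_ge0 //.
    - by apply: fA; exact: leq_trans (leq_addr _ _) s12.
    - by apply: gB; exact: leq_trans (leq_addl _ _) s12.
  rewrite mulrACA ler_wpM2l ?mulr_ge0 //. exact: wM.
rewrite size_rcons pw_rcons => sN.
have e y : U y -> partial i (fun y => pw w1 f y * pw w2 g y) y =
   pw (i :: w1) f y * pw w2 g y + pw w1 f y * pw (i :: w2) g y.
  by move=> Uy; rewrite (partialM (smooth_cdiff i (smooth_pw w1 sf) Uy)
     (smooth_cdiff i (smooth_pw w2 sg) Uy)).
rewrite (eq_pw oU w e Ux).
rewrite (pwD w oU (smoothM oU (smooth_pw (i :: w1) sf) (smooth_pw w2 sg))
  (smoothM oU (smooth_pw w1 sf) (smooth_pw (i :: w2) sg)) Ux).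
apply: le_trans (cmodD _ _) _.
have -> : A * B * 2 ^+ (size w).+1 = A * B * 2 ^+ size w + A * B * 2 ^+ size w.
  by rewrite exprS; ring.
rewrite mulrDl; apply: lerD.
  have := IH (i :: w1) w2; rewrite /= addnS addSn; apply.
  by move: sN; rewrite !addSn.
have := IH w1 (i :: w2); rewrite /= addnS -!addSn; apply.
exact: sN.
Qed.

End Boxes.

Section Coordinate.
Context {R : realType} {n : nat}.
Local Notation E := 'rV[R]_n.
Local Notation C := R[i].
Local Notation ei i := (delta_mx 0 i : E).
Implicit Types (w : seq 'I_n) (x : E) (i j : 'I_n).

(** A function of one variable carried together with all its derivatives, so that these can be given
    by formulas and bounded without iterating a derivation operator. *)
Definition chain (kap : nat -> R -> R) :=
  forall k (t : R), is_derive t 1 (kap k) (kap k.+1 t).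

Definition fcoord (phi : R -> R) i : E -> C := fun x => (phi (x 0 i))%:C.

Lemma coord_is_derive (phi : R -> R) (d : R) x i j : is_derive (x 0 i) 1 phi d ->
  is_derive x (ei j) (fun y : E => phi (y 0 i)) (if j == i then d else 0).
Proof.
move=> [dphi <-]; case: eqVneq => [->|ji].
  have e : (fun h : R => h^-1 *: (((fun y : E => phi (y 0 i)) \o shift x) (h *: ei i)
      - phi (x 0 i))) =
    (fun h => h^-1 *: ((phi \o shift (x 0 i)) (h *: 1) - phi (x 0 i))).
    by apply/funext => h /=; rewrite !mxE !eqxx.
  by apply: DeriveDef; rewrite /derivable /derive e.
apply: (@quad_is_derive _ _ _ _ _ _ 0 1) => // h _.
by rewrite !mxE eqxx eq_sym (negbTE ji) /= !mulr0 add0r subrr subr0 normr0 mul0r.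
Qed.

Lemma coord_cont (phi : R -> R) x i : {for x 0 i, continuous phi} ->
  {for x, continuous (fun y : E => phi (y 0 i))}.
Proof. by move=> c; apply: continuous_comp c; exact: coord_continuous. Qed.

Lemma pw_fcoord kap i w : chain kap -> pw w (fcoord (kap 0%N) i) =
  if all (pred1 i) w then fcoord (kap (size w)) i else (fun=> 0).
Proof.
move=> ck; elim: w => //= j w ->.
have [wi|_] := boolP (all _ w); last by rewrite partial_cst andbF.
apply/funext => x; rewrite andbT /partial /partial_re.
have [_ e1] := coord_is_derive j (ck (size w) (x 0 i)).
have -> : re_part (fcoord (kap (size w)) i) = fun y => kap (size w) (y 0 i) by [].
have -> : im_part (fcoord (kap (size w)) i) = fun=> 0 by [].
rewrite e1 (derive_cst _ x) /fcoord; by case: (j == i).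
Qed.

Lemma smooth_fcoord kap i : chain kap -> smooth setT (fcoord (kap 0%N) i).
Proof.
move=> ck; apply/smoothP => w x _; rewrite pw_fcoord //.
have H0 : ccont (fun _ : E => 0 : C) x /\ forall j, cdiff j (fun _ : E => 0 : C) x.
  have s0 := smooth_cst (setT : set E) (0 : C).
  by split=> [|j]; [exact: smooth_cont s0 I|exact: smooth_cdiff s0 I].
case: ifP => _; last exact: H0.
split=> [|j]; split.
- exact/(coord_cont (phi := kap (size w)))/(is_derive_continuous (ck _ _)).
- exact: cst_continuous.
- by have [] := coord_is_derive j (ck (size w) (x 0 i)).
- exact: derivable_cst.
Qed.

End Coordinate.

(** * Gevrey functions *)

Section Weights.
Context {R : realType}.
Implicit Types (s h : R) (j k : nat).

Lemma weight_gt0 s h k : 0 < h -> 0 < gevrey_weight s h k.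
Proof.
by move=> h0; rewrite mulr_gt0 ?exprn_gt0 // powR_gt0 // ltr0n fact_gt0.
Qed.

Lemma weight_ge0 s h k : 0 < h -> 0 <= gevrey_weight s h k.
Proof. by move=> h0; exact/ltW/weight_gt0. Qed.

Lemma leq_fact_mul j k : (j`! * k`! <= (j + k)`!)%N.
Proof.
have := @bin_fact (j + k) j (leq_addr _ _); rewrite addKn => <-.
by rewrite leq_pmull // bin_gt0 leq_addr.
Qed.

Lemma weightM s h j k : 0 <= s -> 0 < h ->
  gevrey_weight s h j * gevrey_weight s h k <= gevrey_weight s h (j + k).
Proof.
move=> s0 h0; rewrite /gevrey_weight mulrACA -exprD ler_wpM2l ?exprn_ge0 ?(ltW h0) //.
rewrite -powRM //; apply: ge0_ler_powR; rewrite ?nnegrE ?mulr_ge0 //.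
by rewrite -natrM ler_nat leq_fact_mul.
Qed.

Lemma weight_scale s h (a : R) k :
  gevrey_weight s (a * h) k = a ^+ k * gevrey_weight s h k.
Proof. by rewrite /gevrey_weight exprMn mulrA. Qed.

(** Since [k.+1 <= 2 ^ k], passing from the factorial of [k] to that of [k.+1] costs at most
    [(2 ^ k) ^ s], a geometric factor absorbed by shrinking [h]. Hence Gevrey classes are stable
    under differentiation. *)
Lemma weightS s h k : 0 <= s -> 0 < h ->
  gevrey_weight s (h / 2 `^ s) k.+1 <= h / 2 `^ s * gevrey_weight s h k.
Proof.
move=> s0 h0; set b := 2 `^ s.
have b0 : 0 < b by rewrite powR_gt0.
rewrite /gevrey_weight exprS -mulrA ler_wpM2l ?divr_ge0 ?(ltW h0) ?(ltW b0) //.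
rewrite expr_div_n -!mulrA ler_wpM2l ?exprn_ge0 ?(ltW h0) // mulrC.
rewrite ler_pdivrMr ?exprn_gt0 // /b -powR_mulrn ?powR_ge0 // -powRrM.
rewrite [s * _]mulrC powRrM powR_mulrn // -powRM ?exprn_ge0 //.
apply: ge0_ler_powR; rewrite ?nnegrE ?mulr_ge0 ?exprn_ge0 //.
by rewrite factS mulnC natrM -natrX ler_wpM2l // ler_nat ltn_expl.
Qed.

End Weights.

Section Gevrey.
Context {R : realType} {n : nat}.
Local Notation E := 'rV[R]_n.
Local Notation C := R[i].
Implicit Types (U V K : set E) (f g : E -> C) (w : seq 'I_n) (x y : E) (i : 'I_n).
Variable s : R.
Hypothesis s0 : 0 <= s.

Lemma gevreyP U f : open U -> gevrey s U f <-> smooth U f /\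
  forall K, compact K -> K `<=` U -> forall h : R, 0 < h ->
    exists2 c : R, 0 < c &
      forall w x, K x -> cmod (pw w f x) <= c * gevrey_weight s h (size w).
Proof.
move=> oU; split=> -[sf H]; split=> // K cK KU h h0; have [c c0 Hc] := H K cK KU h h0;
  exists c => // w x Kx.
  by rewrite (pw_dpart w oU sf (KU _ Kx)) -mabs_wcount; exact: Hc.
by rewrite dpartE -size_word; exact: Hc.
Qed.

Lemma gevrey_smooth U f : gevrey s U f -> smooth U f.
Proof. by case. Qed.

Lemma subset_gevrey U V f : V `<=` U -> gevrey s U f -> gevrey s V f.
Proof.
move=> VU [sf H]; split; first exact: subset_smooth sf.
by move=> K cK KV; apply: H => // x /KV/VU.
Qed.

Lemma eq_gevrey U f g : open U -> (forall x, U x -> f x = g x) ->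
  gevrey s U f -> gevrey s U g.
Proof.
move=> oU fg /(gevreyP _ oU)[sf H]; apply/(gevreyP _ oU); split.
  exact: (eq_smooth oU fg sf).
move=> K cK KU h h0; have [c c0 Hc] := H K cK KU h h0; exists c => // w x Kx.
by rewrite -(eq_pw oU w fg (KU _ Kx)); exact: Hc.
Qed.

Lemma gevreyM U f g : open U -> gevrey s U f -> gevrey s U g ->
  gevrey s U (fun x => f x * g x).
Proof.
move=> oU /(gevreyP _ oU)[sf Hf] /(gevreyP _ oU)[sg Hg]; apply/(gevreyP _ oU).
split; first exact: smoothM.
(* In the Beurling class every [h] is available, so the factor [2 ^+ k] of Leibniz's rule is
   absorbed by using both factors at [h / 2]. *)
move=> K cK KU h h0; have h20 : 0 < h / 2 by rewrite divr_gt0.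
have [c c0 Hc] := Hf K cK KU _ h20; have [d d0 Hd] := Hg K cK KU _ h20.
exists (c * d); first exact: mulr_gt0.
move=> w x Kx; have := leibniz_bound oU sf sg (KU _ Kx) (ltW c0) (ltW d0)
  (fun k => weight_ge0 s k h20) (fun k l _ => weightM k l s0 h20)
  (fun w _ => Hc w x Kx) (fun w _ => Hd w x Kx) (leqnn (size w)).
by rewrite -mulrA -weight_scale [2 * _]mulrC divfK.
Qed.

Lemma gevreyD U f g : open U -> gevrey s U f -> gevrey s U g ->
  gevrey s U (fun x => f x + g x).
Proof.
move=> oU /(gevreyP _ oU)[sf Hf] /(gevreyP _ oU)[sg Hg]; apply/(gevreyP _ oU).
split; first exact: smoothD.
move=> K cK KU h h0.
have [c c0 Hc] := Hf K cK KU _ h0; have [d d0 Hd] := Hg K cK KU _ h0.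
exists (c + d); first exact: addr_gt0.
move=> w x Kx; rewrite (pwD w oU sf sg (KU _ Kx)) mulrDl.
exact: le_trans (cmodD _ _) (lerD (Hc w x Kx) (Hd w x Kx)).
Qed.

Lemma gevrey_partial U i f : open U -> gevrey s U f -> gevrey s U (partial i f).
Proof.
move=> oU /(gevreyP _ oU)[sf Hf]; apply/(gevreyP _ oU).
split; first exact: smooth_partial.
move=> K cK KU h h0.
have b0 : 0 < h / 2 `^ s by rewrite divr_gt0 // powR_gt0.
have [c c0 Hc] := Hf K cK KU _ b0.
exists (c * (h / 2 `^ s)); first exact: mulr_gt0.
move=> w x Kx; rewrite -pw_rcons; apply: le_trans (Hc _ x Kx) _.
by rewrite size_rcons -mulrA ler_wpM2l ?weightS // ltW.
Qed.

Lemma gevrey_pw U w f : open U -> gevrey s U f -> gevrey s U (pw w f).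
Proof. by move=> oU gf; elim: w => //= i w; exact: gevrey_partial. Qed.

Lemma gevrey_cst U (c : C) : open U -> gevrey s U (fun=> c).
Proof.
move=> oU; apply/(gevreyP _ oU); split; first exact: smooth_cst.
move=> K cK KU h h0; exists (cmod c + 1); first by rewrite ltr_wpDl ?cmod_ge0.
move=> [|i w] x Kx.
  by rewrite /= /gevrey_weight expr0 mul1r fact0 powR1 mulr1 lerDl.
rewrite lastI pw_rcons partial_cst pw_cst0 cmod0 mulr_ge0 ?weight_ge0 //.
by rewrite addr_ge0 ?cmod_ge0.
Qed.

Lemma gevreyZ U c f : open U -> gevrey s U f -> gevrey s U (fun x => c * f x).
Proof. by move=> oU; apply: gevreyM => //; exact: gevrey_cst. Qed.

Lemma gevrey_prod U (I : Type) (r : seq I) (P : pred I) (F : I -> E -> C) :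
  open U -> (forall k, P k -> gevrey s U (F k)) ->
  gevrey s U (fun x => \prod_(k <- r | P k) F k x).
Proof.
move=> oU sF; elim: r => [|j r IH].
  by apply: (eq_gevrey oU _ (gevrey_cst 1 oU)) => y _; rewrite big_nil.
have [Pj|/negbTE Pj] := boolP (P j).
  by apply: (eq_gevrey oU _ (gevreyM oU (sF j Pj) IH)) => y _; rewrite big_cons Pj.
by apply: (eq_gevrey oU _ IH) => y _; rewrite big_cons Pj.
Qed.

Definition gchain (kap : nat -> R -> R) := chain kap /\
  forall A h : R, 0 < h -> exists2 c : R, 0 < c &
    forall k t, `|t| <= A -> `|kap k t| <= c * gevrey_weight s h k.

Lemma gevrey_fcoord kap i : gchain kap -> gevrey s setT (fcoord (kap 0%N) i : E -> C).
Proof.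
move=> [ck bk]; apply/(gevreyP _ openT); split; first exact: smooth_fcoord.
move=> K cK _ h h0; have /ex_strict_bound_gt0[A A0 HA] := compact_bounded cK.
have [c c0 Hc] := bk A h h0; exists c => // w x Kx; rewrite pw_fcoord //.
case: ifP => _; last by rewrite cmod0 mulr_ge0 ?weight_ge0 // ltW.
rewrite cmod_real; apply: Hc.
have /rV_norm_leP := lexx `|x|; move=> /(_ (normr_ge0 _) i) h1.
exact/(le_trans h1)/ltW/HA.
Qed.

End Gevrey.

(** * Gevrey cutoff functions *)

Section OneVariableChains.
Context {R : realType}.
Implicit Types (f g kap : nat -> R -> R) (s h c t : R) (j k p : nat).

Lemma is_derive_comp1 (f g : R -> R) (x df dg : R) : is_derive x 1 g dg ->
  is_derive (g x) 1 f df -> is_derive x 1 (fun t => f (g t)) (df * dg).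
Proof.
move=> Hg Hf; exact: (is_derive1_comp Hf Hg).
Qed.

Lemma is_derive_scale (f : R -> R) (x c df : R) : is_derive x 1 f df ->
  is_derive x 1 (fun t => c * f t) (c * df).
Proof. exact: is_deriveZ. Qed.

Lemma is_derive_add (f g : R -> R) (x df dg : R) : is_derive x 1 f df ->
  is_derive x 1 g dg -> is_derive x 1 (fun t => f t + g t) (df + dg).
Proof. exact: is_deriveD. Qed.

Lemma is_derive_mul (f g : R -> R) (x df dg : R) : is_derive x 1 f df ->
  is_derive x 1 g dg ->
  is_derive x 1 (fun t => f t * g t) (df * g x + f x * dg).
Proof.
move=> Hf Hg; apply: (is_derive_eq (is_deriveM Hf Hg)).
by rewrite /GRing.scale /= addrC mulrC.
Qed.

Lemma is_derive_aff (a b x : R) : is_derive x 1 (fun t => a * t + b) a.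
Proof.
have H := is_derive_add (is_derive_scale a (is_derive_id x (1 : R)))
  (is_derive_cst b x (1 : R)).
by apply: (is_derive_eq H); rewrite mulr1 addr0.
Qed.

(** The binomial sum of Leibniz's rule, left as a recursion with [2 ^ k] terms: both the derivative
    and the bound then follow by induction on [k]. *)
Fixpoint chain_mul k f g : R -> R :=
  match k with
  | 0 => fun t => f 0%N t * g 0%N t
  | k'.+1 => fun t => chain_mul k' (fun j => f j.+1) g t
                    + chain_mul k' f (fun j => g j.+1) t
  end.

Lemma chain_mulP f g : chain f -> chain g -> chain (fun k => chain_mul k f g).
Proof.
move=> cf cg k; elim: k f g cf cg => [|k IH] f g cf cg t.
  exact: is_derive_mul (cf _ _) (cg _ _).
have cf' : chain (fun j => f j.+1) by move=> j u; exact: cf.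
have cg' : chain (fun j => g j.+1) by move=> j u; exact: cg.
exact: (is_derive_add (IH _ _ cf' cg t) (IH _ _ cf cg' t)).
Qed.

Variable s : R.
Hypothesis s0 : 0 <= s.

Lemma chain_mul_bound f g (A B h t : R) k : 0 < h -> 0 <= A -> 0 <= B ->
  (forall k, `|f k t| <= A * gevrey_weight s h k) ->
  (forall k, `|g k t| <= B * gevrey_weight s h k) ->
  `|chain_mul k f g t| <= A * B * gevrey_weight s (2 * h) k.
Proof.
move=> h0 A0 B0 fA gB; rewrite weight_scale.
suff H a b : `|chain_mul k (fun j => f (j + a)%N) (fun j => g (j + b)%N) t| <=
    A * B * (2 ^+ k * gevrey_weight s h (k + a + b)).
  have := H 0%N 0%N; rewrite !addn0.
  by under [X in chain_mul k X]eq_fun do rewrite addn0;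
     under [X in chain_mul k _ X]eq_fun do rewrite addn0.
elim: k a b => [|k IH] a b /=.
  rewrite !add0n expr0 mul1r normrM.
  apply: le_trans (ler_pM (normr_ge0 _) (normr_ge0 _) (fA a) (gB b)) _.
  by rewrite mulrACA ler_wpM2l ?mulr_ge0 // weightM.
apply: le_trans (ler_normD _ _) _.
have -> : A * B * (2 ^+ k.+1 * gevrey_weight s h (k.+1 + a + b)) =
  A * B * (2 ^+ k * gevrey_weight s h (k + a.+1 + b)) +
  A * B * (2 ^+ k * gevrey_weight s h (k + a + b.+1)).
  by rewrite exprS !addnS !addSn; ring.
apply: lerD.
  have := IH a.+1 b; by under [X in chain_mul k X]eq_fun do rewrite addnS -addSn.
have := IH a b.+1; by under [X in chain_mul k _ X]eq_fun do rewrite addnS -addSn.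
Qed.

Lemma gchain_mul f g : gchain s f -> gchain s g ->
  gchain s (fun k => chain_mul k f g).
Proof.
move=> [cf bf] [cg bg]; split; first exact: chain_mulP.
move=> A h h0; have h20 : 0 < h / 2 by rewrite divr_gt0.
have [c c0 Hc] := bf A _ h20; have [d d0 Hd] := bg A _ h20.
exists (c * d); first exact: mulr_gt0.
move=> k t tA; have := @chain_mul_bound f g c d (h / 2) t k h20 (ltW c0) (ltW d0)
  (fun k => Hc k t tA) (fun k => Hd k t tA).
by rewrite [2 * _]mulrC divfK.
Qed.

Lemma gchain_scale c f : gchain s f -> gchain s (fun k t => c * f k t).
Proof.
move=> [cf bf]; split=> [k t|A h h0]; first exact: is_derive_scale.
have [d d0 Hd] := bf A h h0; exists ((`|c| + 1) * d).
  by rewrite mulr_gt0 // ltr_wpDl.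
move=> k t tA; rewrite normrM -mulrA.
apply: le_trans (ler_wpM2l (normr_ge0 _) (Hd k t tA)) _.
by rewrite ler_wpM2r ?lerDl // mulr_ge0 ?weight_ge0 // ltW.
Qed.

Lemma gchain_affine (a b : R) f : gchain s f ->
  gchain s (fun k t => a ^+ k * f k (a * t + b)).
Proof.
move=> [cf bf]; split=> [k t|A h h0].
  have H := is_derive_scale (a ^+ k) (is_derive_comp1 (is_derive_aff a b t) (cf k _)).
  by apply: (is_derive_eq H); rewrite exprS; ring.
have a1 : 0 < `|a| + 1 by rewrite ltr_wpDl.
have h20 : 0 < h / (`|a| + 1) by rewrite divr_gt0.
have [c c0 Hc] := bf (`|a| * A + `|b|) _ h20.
exists c => // k t tA; rewrite normrM normrX.
have tA' : `|a * t + b| <= `|a| * A + `|b|.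
  apply: le_trans (ler_normD _ _) _.
  by rewrite lerD2r normrM ler_wpM2l.
apply: le_trans (_ : (`|a| + 1) ^+ k * (c * gevrey_weight s (h / (`|a| + 1)) k) <= _).
  by apply: ler_pM; rewrite ?exprn_ge0 ?Hc // lerXn2r ?nnegrE ?addr_ge0 // lerDl.
by rewrite mulrCA -weight_scale [_ * (h / _)]mulrC divfK // gt_eqF.
Qed.

Lemma gchain_cst c : gchain s (fun k _ => if k is 0 then c else 0).
Proof.
split=> [k t|A h h0]; first by case: k => [|k]; exact: is_derive_cst.
exists (`|c| + 1); first by rewrite ltr_wpDl.
move=> [|k] t tA.
  by rewrite /gevrey_weight expr0 mul1r fact0 powR1 mulr1 lerDl.
by rewrite normr0 mulr_ge0 ?weight_ge0 // addr_ge0.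
Qed.

Lemma primitive_exists (f : R -> R) : continuous f ->
  exists F : R -> R, forall t : R, is_derive t 1 F (f t).
Proof.
move=> cf; pose mu := @lebesgue_measure R.
have itg a b : mu.-integrable `[a, b] (EFin \o f).
  apply: continuous_compact_integrable; first exact: segment_compact.
  exact: continuous_subspaceT.
pose P (M x : R) := (\int[mu]_(t in [set` `[- M, x]]) f t)%R.
have dP (M x : R) : - M < x -> is_derive x 1 (P M) (f x).
  move=> Mx; have [|d1 d2] := @continuous_FTC1_closed R f (- M) x (x + 1) _ (itg _ _) Mx (cf x).
    by rewrite ltrDl.
  exact: (DeriveDef d1 (etrans (esym (derive1E (P M) x)) d2)).
(* [P M x - P M 0] is the integral from 0 to [x], whatever the left end [- M] as long as it lies
   below both points. *)
have Peq (M M' x : R) : 0 <= x + M -> 0 <= M -> M <= M' -> P M' x - P M' 0 = P M x - P M 0.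
  move=> Mx M0 MM'.
  have K (N u v : R) : - N <= u -> u <= v ->
      P N v - P N u = (\int[mu]_(t in [set` `]u, v]]) f t)%R.
    by move=> Nu uv; apply: Rintegral_itvB; rewrite ?bnd_simp //; exact: itg.
  have [x0|x0] := leP 0 x.
    rewrite !K //; lra.
  rewrite -[LHS]opprB -[RHS]opprB !K //; lra.
exists (fun x => P (`|x| + 1) x - P (`|x| + 1) 0) => t.
have e : \forall x \near t, P (`|t| + 2) x - P (`|t| + 2) 0 =
    P (`|x| + 1) x - P (`|x| + 1) 0.
  near=> x; apply: Peq.
  - have := ler_norm (- x); rewrite normrN; lra.
  - by rewrite addr_ge0.
  - have : `|x| < `|t| + 1.
      have : `|x - t| < 1 by rewrite distrC; near: x; apply: cvgr_dist_lt.
      have := ler_normD (x - t) t; rewrite subrK; lra.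
    lra.
apply: (near_eq_is_derive e).
have := is_derive_add (dP (`|t| + 2) t _) (is_derive_cst (- P (`|t| + 2) 0) t (1 : R)).
rewrite addr0; apply.
have := ler_norm (- t); rewrite normrN; lra.
Unshelve. all: by end_near. Qed.

Lemma MVT_point (F f : R -> R) (a t : R) : (forall u : R, is_derive u 1 F (f u)) ->
  exists2 u, 0 <= u <= 1 & F t - F a = (t - a) * f (a + u * (t - a)).
Proof.
move=> dF.
have [|u u01 e] := @MVT01 R (fun v => F (1 * v + a)) (fun v => f (1 * v + a)) (t - a).
  move=> u _; have H := is_derive_comp1 (is_derive_aff 1 a (u * (t - a))) (dF _).
  by apply: (is_derive_eq H); rewrite mulr1.
exists u => //; move: e; rewrite !mul1r subrK add0r => ->.
by rewrite [u * _ + a]addrC.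
Qed.

Lemma gchain_primitive f a : gchain s f ->
  exists kap, [/\ gchain s kap, kap 0%N a = 0 & forall k, kap k.+1 = f k].
Proof.
move=> [cf bf].
have [F dF] := primitive_exists (fun t => is_derive_continuous (cf 0%N t)).
pose kap k t := if k is j.+1 then f j t else F t - F a.
exists kap; split=> //; last by rewrite /kap subrr.
have dk : chain kap.
  move=> [|k] t /=; last exact: cf.
  have := is_derive_add (dF t) (is_derive_cst (- F a) t (1 : R)).
  by rewrite addr0.
split=> // A h h0.
(* The interval is enlarged to contain the base point [a], since the mean value point lies between
   [a] and [t]. *)
have [c c0 Hc] := bf (Num.max A (`|a|)) h h0.
have A1 : 0 <= `|A| + `|a| by rewrite addr_ge0.
(* The first two summands bound [t - a] in order 0; [h^-1] pays for the shift by one between the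
   orders of [f] and of its primitive. *)
exists ((`|A| + `|a| + h^-1) * c).
  by rewrite mulr_gt0 // ltr_wpDl // invr_gt0.
have h10 : 0 < h^-1 by rewrite invr_gt0.
move=> [|k] t tA; last first.
  have tA' : `|t| <= Num.max A `|a| by rewrite le_max tA.
  apply: le_trans (Hc k t tA') _.
  apply: le_trans (_ : h^-1 * c * gevrey_weight s h k.+1 <= _); last first.
    by rewrite !mulrDl lerDr; apply: addr_ge0; apply: mulr_ge0;
      rewrite ?weight_ge0 // mulr_ge0 // ltW.
  rewrite [leRHS](_ : _ = c * (h^-1 * gevrey_weight s h k.+1)); last by ring.
  rewrite ler_wpM2l ?(ltW c0) // ler_pdivlMl // /gevrey_weight exprS -!mulrA ler_wpM2l ?(ltW h0) //.
  rewrite ler_wpM2l ?exprn_ge0 ?(ltW h0) //.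
  apply: ge0_ler_powR; rewrite ?nnegrE //.
  by rewrite ler_nat factS leq_pmull.
have [u u01 /= ->] := MVT_point a t dF.
have w01 : gevrey_weight s h 0 = 1.
  by rewrite /gevrey_weight expr0 mul1r fact0 powR1.
rewrite w01 mulr1 normrM.
have tA' : `|a + u * (t - a)| <= Num.max A `|a|.
  by apply: conv1_le => //; rewrite /= le_max ?tA ?lexx ?orbT.
apply: ler_pM => //.
  apply: le_trans (ler_normB _ _) _; rewrite -addrA; apply: lerD.
    exact: le_trans tA (ler_norm _).
  by rewrite lerDl ltW.
by have := Hc 0%N _ tA'; rewrite w01 mulr1.
Qed.

End OneVariableChains.

Section SmoothStep.
Context {R : realType}.
Implicit Types (s h c t y : R) (j k p q : nat).

Lemma expr_le_fact_exp y k : 0 <= y -> y ^+ k <= k`!%:R * expR y.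
Proof.
move=> y0; case: k => [|k].
  by rewrite expr0 fact0 mul1r -expR0 ler_expR.
rewrite mulrC -ler_pdivrMr ?ltr0n ?fact_gt0 //.
by apply: le_trans (expR_ge1Dxn k y0); rewrite lerDr.
Qed.

Lemma is_derive_expn y k : is_derive y 1 (fun z => z ^+ k) (k%:R * y ^+ k.-1).
Proof.
elim: k => [|k IH].
  by rewrite mul0r; exact: (is_derive_cst (1 : R) y (1 : R)).
have -> : (fun z => z ^+ k.+1) = fun z : R => z * z ^+ k.
  by apply/funext => z; rewrite exprS.
apply: (is_derive_eq (is_derive_mul (is_derive_id y (1 : R)) IH)).
rewrite mul1r /= mulrCA; case: k {IH} => [|k]; first by rewrite !mul0r addr0 mul1r.
by rewrite /= -exprS -[X in X + _]mul1r -mulrDl nat1r.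
Qed.

Section Fixed.
Variable p : nat.
Hypothesis p0 : (0 < p)%N.

(** For [j = 0] this is the classical flat function, of Gevrey order [1 + 1 / p]. The factors
    [t^-1 ^+ j] make the family closed under differentiation up to linear combinations. *)
Definition flat j t := if 0 < t then t^-1 ^+ j * expR (- t^-1 ^+ p) else 0.

(** With [y = t^-1] and [q = (j %/ p).+1]: if [y > 1] then [y ^+ j <= (y ^+ p) ^+ q], which is at
    most the factorial of [q] times [expR (y ^+ p)]; if [y <= 1] both factors are at most 1. *)
Lemma flat_le j t : 0 <= flat j t <= ((j %/ p).+1)`!%:R.
Proof.
rewrite /flat; case: ifP => [t0|_]; last by rewrite lexx ler0n.
have : 0 < t^-1 by rewrite invr_gt0.
move: (t^-1) => y y0; apply/andP; split.
  by rewrite mulr_ge0 ?exprn_ge0 ?expR_ge0 // ltW.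
set q := (j %/ p).+1; have q1 : 1 <= q`!%:R :> R by rewrite ler1n fact_gt0.
have [y1|y1] := leP y 1.
  apply: le_trans q1; rewrite -[leRHS]mulr1 ler_pM ?exprn_ge0 ?expR_ge0 ?(ltW y0) //.
    by rewrite exprn_ile1 // ltW.
  by rewrite -expR0 ler_expR oppr_le0 exprn_ge0 // ltW.
rewrite expRN ler_pdivrMr ?expR_gt0 //.
apply: le_trans (_ : (y ^+ p) ^+ q <= _); last first.
  by apply: expr_le_fact_exp; rewrite exprn_ge0 // ltW.
rewrite -exprM; apply: ler_weXn2l; first exact: ltW.
by rewrite mulnC ltnW // -ltn_divLR // /q.
Qed.

Lemma is_derive_flat j t :
  is_derive t 1 (flat j) (- j%:R * flat j.+1 t + p%:R * flat (j + p.+1) t).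
Proof.
have [t0|t0|tE] := ltgtP 0 t.
- have tn : t != 0 by rewrite gt_eqF.
  have e : \forall u \near t, u^-1 ^+ j * expR (- u^-1 ^+ p) = flat j u.
    near=> u; rewrite /flat; have -> // : 0 < u.
    by near: u; exact: lt_nbhsr.
  apply: (near_eq_is_derive e).
  pose G y := y ^+ j * expR (- y ^+ p); pose y := t^-1.
  have dI : is_derive t 1 (fun u => u^-1) (- t ^- 2).
    apply: (is_derive_eq (is_deriveV tn (is_derive_id t (1 : R)))).
    by rewrite /GRing.scale /= mulr1.
  have dN : is_derive y 1 (fun z => - z ^+ p) (- (p%:R * y ^+ p.-1)).
    exact: is_deriveN (is_derive_expn y p).
  have dE := is_derive_comp1 dN (is_derive_expR (- y ^+ p)).
  have dG := is_derive_mul (is_derive_expn y j) dE.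
  apply: (is_derive_eq (is_derive_comp1 dI dG)).
  rewrite /flat t0 -/y -exprVn -/y; set e' := expR _.
  have -> : (j + p.+1 = (j + p.-1).+2)%N by rewrite -[in LHS](prednK p0) !addnS.
  rewrite !exprS exprD.
  case: (j) => [|j'] /=; first by rewrite expr0; ring.
  by rewrite exprS; ring.
- have e : \forall u \near t, 0 = flat j u.
    near=> u; rewrite /flat; have /ltW : u < 0.
      by near: u; exact: lt_nbhsl.
    by rewrite leNgt => /negbTE ->.
  apply: (near_eq_is_derive e).
  have t0' : (0 < t) = false by apply/negbTE; rewrite -leNgt ltW.
  apply: (is_derive_eq (is_derive_cst (0 : R) t (1 : R))).
  by rewrite /flat t0' !mulr0 addr0.
- rewrite -tE; have e : - j%:R * flat j.+1 0 + p%:R * flat (j + p.+1) 0 = 0.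
    by rewrite /flat ltxx !mulr0 addr0.
  rewrite e; apply: (@quad_is_derive _ _ _ _ _ _ ((j.+2 %/ p).+1)`!%:R 1) => // h _.
  rewrite addr0 mulr0 subr0 [_%:A]mulr1.
  have -> : flat j 0 = 0 by rewrite /flat ltxx.
  rewrite subr0; have /andP[f0 _] := flat_le j h; rewrite ger0_norm //.
  have [h0|h0] := leP h 0.
    by rewrite /flat ltNge h0 /= mulr_ge0 ?sqr_ge0.
  (* As [flat j.+2] is bounded too, two powers of [h] are to spare: a quadratic remainder, which
     gives derivative 0 at the origin. *)
  have -> : flat j h = flat j.+2 h * h ^+ 2.
    rewrite /flat h0 !exprS expr0; field.
    by rewrite gt_eqF.
  by rewrite ler_wpM2r ?sqr_ge0 //; case/andP: (flat_le j.+2 h).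
Unshelve. all: by end_near. Qed.

Fixpoint dflat k j : R -> R :=
  match k with
  | 0 => flat j
  | k'.+1 => fun t => - j%:R * dflat k' j.+1 t + p%:R * dflat k' (j + p.+1) t
  end.

Lemma chain_dflat j : chain (fun k => dflat k j).
Proof.
move=> k; elim: k j => [|k IH] j t; first exact: is_derive_flat.
exact: is_derive_add (is_derive_scale _ (IH _ _)) (is_derive_scale _ (IH _ _)).
Qed.

(* Differentiating [flat j] either costs a factor [j] and raises the exponent
   by one, or costs only [p] but raises the exponent by [p + 1], hence the
   bound [(j %/ p).+1`!] of [flat_le] by one unit: both trade evenly. *)
Lemma dflat_bound k j t : `|dflat k j t| <=
  2 ^+ k * (j + k * p.+1 + 2 * p)%:R ^+ k * (((j + k) %/ p).+1)`!%:R.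
Proof.
elim: k j => [|k IH] j.
  rewrite /= !expr0 !mul1r addn0; have /andP[f0 f1] := flat_le j t.
  by rewrite ger0_norm.
set X : R := (j + k.+1 * p.+1 + 2 * p)%:R; set J := ((j + k.+1) %/ p).+1.
have X0 : 0 <= X by rewrite ler0n.
have b1 : j%:R * `|dflat k j.+1 t| <= X * (2 ^+ k * X ^+ k * J`!%:R).
  apply: ler_pM => //; first by rewrite ler_nat -addnA leq_addr.
  apply: le_trans (IH _) _; rewrite [(j.+1 + k)%N]addSnnS -/J ler_wpM2r //.
  rewrite ler_wpM2l ?exprn_ge0 // lerXn2r ?nnegrE // ler_nat.
  lia.
have b2 : p%:R * `|dflat k (j + p.+1) t| <= X * (2 ^+ k * X ^+ k * J`!%:R).
  have Jp : ((j + p.+1 + k) %/ p).+1 = J.+1.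
    rewrite /J (_ : (j + p.+1 + k = j + k.+1 + p)%N); last first.
      by rewrite !addnS !addSn addnAC.
    by rewrite divnDr ?dvdnn // divnn p0 addn1.
  apply: le_trans (ler_wpM2l (ler0n _ _) (IH _)) _.
  rewrite Jp factS natrM.
  have pJ : p%:R * J.+1%:R <= X.
    rewrite -natrM ler_nat /J mulnS mulnS.
    have := leq_trunc_div (j + k.+1) p; rewrite mulnC => le1.
    nia.
  have -> : (j + p.+1 + k * p.+1 + 2 * p)%:R = X by rewrite /X; congr _%:R; lia.
  rewrite [leLHS](_ : _ = (p%:R * J.+1%:R) * (2 ^+ k * X ^+ k * J`!%:R)); last by ring.
  by rewrite ler_wpM2r // !mulr_ge0 ?exprn_ge0.
rewrite /=; apply: le_trans (ler_normD _ _) _; rewrite !normrM normrN !normr_nat.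
apply: le_trans (lerD b1 b2) _.
by rewrite !exprS le_eqVlt; apply/orP; left; apply/eqP; ring.
Qed.

End Fixed.

Lemma geom_le_fact (a : R) k : 0 <= a -> a ^+ k <= expR a * k`!%:R.
Proof. by move=> a0; rewrite mulrC; exact: expr_le_fact_exp. Qed.

Lemma fact_exp_le q p : (q`! ^ p <= (p * q)`!)%N.
Proof.
elim: p => [|p IH]; first by rewrite expn0.
by rewrite expnS mulSn; apply: leq_trans (leq_fact_mul _ _); rewrite leq_mul2l IH orbT.
Qed.

Lemma fact_add_le k p : ((k + p)`! <= 2 ^ (k + p) * (k`! * p`!))%N.
Proof.
have := @bin_fact (k + p) p (leq_addl _ _); rewrite addnK => <-.
rewrite [(p`! * _)%N]mulnC leq_mul2r; apply/orP; right.
have -> : (2 ^ (k + p) = \sum_(i < (k + p).+1) 'C(k + p, i))%N.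
  rewrite -[2%N]/(1 + 1)%N expnDn; apply: eq_bigr => i _.
  by rewrite !exp1n !muln1.
have pl : (p < (k + p).+1)%N by rewrite ltnS leq_addl.
by rewrite (bigD1 (Ordinal pl)) //= leq_addr.
Qed.

(** Up to geometric factors [dflat_bound] is the factorial of [k] to the power [1 + 1 / p]. Taking
    [1 / p] at most half of [s - 1] leaves a positive power of the factorial, which beats every
    geometric factor, as the Beurling class requires. *)
Lemma gchain_flat s : 1 < s -> exists p, (0 < p)%N /\
  gchain s (fun k => dflat p k 0).
Proof.
move=> s1; have sg : 0 < s - 1 by rewrite subr_gt0.
(* The 2 provides two factorials of [k] after raising to the power [p]: one for the factorial of
   [k %/ p], one for the geometric growth [G ^+ k]. *)
pose p := (Num.truncn (2 / (s - 1))).+1.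
have ps : 2 <= (s - 1) * p%:R.
  by rewrite mulrC -ler_pdivrMr // ltW // truncnS_gt.
exists p; split=> //; split; first exact: chain_dflat.
move=> A h h0.
(* [D ^+ k] collects the geometric factors of [dflat_bound]: [2 ^+ k] itself, and the exponential
   left when a [k]-th power [X ^+ k] is replaced by the factorial of [k] times [expR X]. *)
pose D : R := 2 * expR p.+1%:R; have D0 : 0 <= D by rewrite mulr_ge0 ?expR_ge0.
pose G : R := 2 * (D / h) ^+ p.
have Dh : 0 <= D / h by rewrite divr_ge0 // ltW.
have G0 : 0 <= G by rewrite mulr_ge0 ?exprn_ge0.
pose c0 : R := 2 ^+ p * p`!%:R * expR G.
have c00 : 0 <= c0 by rewrite !mulr_ge0 ?exprn_ge0 ?expR_ge0.
exists (expR (2 * p)%:R * (c0 + 1)).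
  by rewrite mulr_gt0 ?expR_gt0 // ltr_wpDl.
move=> k t _; apply: le_trans (dflat_bound _ k 0 t) _ => //.
rewrite !add0n; set q := (k %/ p).+1.
have kf : (0 : R) < k`!%:R by rewrite ltr0n fact_gt0.
have e1 : (k * p.+1 + 2 * p)%:R ^+ k <= k`!%:R * expR (k * p.+1 + 2 * p)%:R :> R.
  exact: expr_le_fact_exp.
have e2 : expR (k * p.+1 + 2 * p)%:R = expR p.+1%:R ^+ k * expR (2 * p)%:R :> R.
  by rewrite natrD expRD natrM expRM_natl.
have X1 : (D / h) ^+ k * q`!%:R <= (c0 + 1) * k`!%:R `^ (s - 1).
  (* Compared after raising to the power [p]: the [p]-th power of the factorial of [q] is at most
     the factorial of [p * q], and [p * q <= k + p]. *)
  rewrite -(@ler_pXn2r _ p) ?nnegrE ?mulr_ge0 ?exprn_ge0 ?powR_ge0 ?addr_ge0 //.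
  rewrite [leLHS]exprMn [leRHS]exprMn.
  have f1 : q`!%:R ^+ p <= 2 ^+ k * 2 ^+ p * k`!%:R * p`!%:R :> R.
    rewrite -exprD -natrX -mulrA -natrM -natrX -natrM ler_nat.
    apply: leq_trans (fact_exp_le _ _) _; apply: leq_trans (fact_add_le _ _).
    by apply: leq_fact; rewrite /q mulnS addnC leq_add2r mulnC leq_trunc_div.
  have f2 : ((D / h) ^+ k) ^+ p * q`!%:R ^+ p <= c0 * k`!%:R ^+ 2.
    apply: le_trans (ler_wpM2l (exprn_ge0 _ (exprn_ge0 _ Dh)) f1) _.
    have -> : ((D / h) ^+ k) ^+ p * (2 ^+ k * 2 ^+ p * k`!%:R * p`!%:R) =
       2 ^+ p * p`!%:R * k`!%:R * G ^+ k.
      by rewrite [((D / h) ^+ k) ^+ p]exprAC /G [(2 * _) ^+ k]exprMn; ring.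
    apply: le_trans (ler_wpM2l _ (geom_le_fact k G0)) _.
      by rewrite !mulr_ge0 ?exprn_ge0.
    by rewrite /c0 expr2 le_eqVlt; apply/orP; left; apply/eqP; ring.
  apply: le_trans f2 _; apply: ler_pM; rewrite ?exprn_ge0 //.
    apply: le_trans (_ : c0 + 1 <= _); first by rewrite lerDl.
    by rewrite -[leLHS]expr1 ler_weXn2l // lerDr.
  rewrite -powR_mulrn // -powR_mulrn ?powR_ge0 // -powRrM.
  by apply: ler_powR => //; rewrite ler1n fact_gt0.
have pw : gevrey_weight s h k = h ^+ k * (k`!%:R * k`!%:R `^ (s - 1)).
  by rewrite /gevrey_weight mulr_powRB1 // (lt_trans _ s1).
rewrite pw; apply: le_trans (_ : 2 ^+ k * (k`!%:R * (expR p.+1%:R ^+ k *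
    expR (2 * p)%:R)) * q`!%:R <= _).
  by rewrite -e2 ler_wpM2r // ler_wpM2l // exprn_ge0.
have -> : 2 ^+ k * (k`!%:R * (expR p.+1%:R ^+ k * expR (2 * p)%:R)) * q`!%:R =
   expR (2 * p)%:R * h ^+ k * k`!%:R * ((D / h) ^+ k * q`!%:R).
  rewrite /D !exprMn exprVn; field.
  by rewrite expf_neq0 // gt_eqF.
have -> : expR (2 * p)%:R * (c0 + 1) * (h ^+ k * (k`!%:R * k`!%:R `^ (s - 1))) =
   expR (2 * p)%:R * h ^+ k * k`!%:R * ((c0 + 1) * k`!%:R `^ (s - 1)) by ring.
by rewrite ler_wpM2l // !mulr_ge0 ?expR_ge0 ?exprn_ge0 // ltW.
Qed.

(** The normalized primitive of the bump [th 0 t * th 0 (1 - t)], which vanishes outside the unit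
    interval. *)
Lemma gevrey_step s : 1 < s -> exists H : nat -> R -> R,
  [/\ gchain s H, forall t, t <= 0 -> H 0%N t = 0,
      forall t, 1 <= t -> H 0%N t = 1 & forall t, 0 <= H 0%N t <= 1].
Proof.
move=> s1; have s0 : 0 <= s by rewrite (le_trans _ (ltW s1)).
have [p [p0 gf]] := gchain_flat s1.
pose th k := dflat p k 0.
have th0 t : 0 < t -> 0 < th 0%N t.
  by move=> t0; rewrite /th /= /flat t0 expr0 mul1r expR_gt0.
have th1 t : t <= 0 -> th 0%N t = 0.
  by move=> t0; rewrite /th /= /flat ltNge t0.
have thge t : 0 <= th 0%N t by have [/th1 ->|/th0/ltW] := leP t 0.
pose ps := fun k => chain_mul k th (fun k t => (-1) ^+ k * th k (-1 * t + 1)).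
have gps : gchain s ps := gchain_mul s0 gf (gchain_affine (-1) 1 gf).
have psE t : ps 0%N t = th 0%N t * th 0%N (1 - t).
  by rewrite /ps /chain_mul /= expr0 mul1r mulN1r addrC.
have [F [gF F0 FS]] := gchain_primitive s0 0 gps.
have dF t : is_derive t 1 (F 0%N) (ps 0%N t) by rewrite -FS; case: gF.
have Fcst a b : (forall u, 0 <= u <= 1 -> ps 0%N (a + u * (b - a)) = 0) ->
    F 0%N b = F 0%N a.
  move=> H; apply/eqP; rewrite -subr_eq0.
  by have [u /H u0 ->] := MVT_point a b dF; rewrite u0 mulr0.
have Fmono a b : a <= b -> F 0%N a <= F 0%N b.
  move=> ab; rewrite -subr_ge0; have [u _ ->] := MVT_point a b dF.
  by rewrite mulr_ge0 ?subr_ge0 // psE mulr_ge0.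
have Fneg t : t <= 0 -> F 0%N t = 0.
  move=> t0; rewrite -F0; apply: Fcst => u /andP[u0 u1].
  by rewrite psE th1 ?mul0r // add0r subr0 mulr_ge0_le0.
have Fpos t : 1 <= t -> F 0%N t = F 0%N 1.
  move=> t1; apply: Fcst => u /andP[u0 u1].
  rewrite psE (th1 (1 - _)) ?mulr0 // opprD addrA subrr add0r oppr_le0.
  by rewrite mulr_ge0 // subr_ge0.
have F1 : 0 < F 0%N 1.
  (* Any subinterval inside the open unit interval would do: the bump is positive there, so the
     normalizing constant is not 0. *)
  have F12 : F 0%N (1/2) - F 0%N (1/4) > 0.
    have [u /andP[u0 u1] ->] := MVT_point (1/4) (1/2) dF.
    rewrite mulr_gt0 // ?psE ?mulr_gt0 ?th0 //; lra.
  have a : F 0%N (1/2) <= F 0%N 1 by apply: Fmono; lra.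
  have b : F 0%N 0 <= F 0%N (1/4) by apply: Fmono; lra.
  rewrite F0 in b; lra.
exists (fun k t => (F 0%N 1)^-1 * F k t); split.
- exact: gchain_scale.
- by move=> t /Fneg ->; rewrite mulr0.
- by move=> t /Fpos ->; rewrite mulVf // gt_eqF.
- move=> t; rewrite mulrC; apply/andP; split.
    rewrite divr_ge0 ?(ltW F1) // -(Fneg (Num.min t 0)) ?ge_min ?lexx ?orbT //.
    by apply: Fmono; rewrite ge_min lexx.
  rewrite ler_pdivrMr // mul1r -(Fpos (Num.max t 1)) ?le_max ?lexx ?orbT //.
  by apply: Fmono; rewrite le_max lexx.
Qed.

End SmoothStep.

Section Cutoff.
Context {R : realType} {n : nat}.
Local Notation E := 'rV[R]_n.
Local Notation C := R[i].

Lemma gevrey_cutoff (s : R) (c : E) (r r1 : R) : 1 < s -> r < r1 ->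
  exists (chi : E -> C) (a b : R), [/\ r < a, b < r1, gevrey s setT chi,
    (forall x, cbox c a x -> chi x = 1) &
    (forall x, ~ cbox c b x -> chi x = 0)].
Proof.
move=> s1 rr1; have s0 : 0 <= s by rewrite (le_trans _ (ltW s1)).
have [H [gH H0 H1 _]] := gevrey_step s1.
(* [a] and [b] cut the gap from [r] to [r1] into thirds; each coordinate contributes two steps, one
   for either side of the box, rising over the middle third. *)
pose a := (2 * r + r1) / 3; pose b := (r + 2 * r1) / 3.
have ab : 0 < b - a by rewrite /a /b; lra.
pose al := (b - a)^-1.
pose phi1 i := fcoord (fun t => H 0%N (al * t + al * (b - c 0 i))) i : E -> C.
pose phi2 i := fcoord (fun t => H 0%N (- al * t + al * (b + c 0 i))) i : E -> C.
have g1 i : gevrey s setT (phi1 i).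
  have := gevrey_fcoord (n := n) i (gchain_affine al (al * (b - c 0 i)) gH).
  by under [X in fcoord X]eq_fun do rewrite expr0 mul1r.
have g2 i : gevrey s setT (phi2 i).
  have := gevrey_fcoord (n := n) i (gchain_affine (- al) (al * (b + c 0 i)) gH).
  by under [X in fcoord X]eq_fun do rewrite expr0 mul1r.
exists (fun x => (\prod_i phi1 i x) * (\prod_i phi2 i x)), a, b; split.
- rewrite /a; lra.
- rewrite /b; lra.
- have p1 := gevrey_prod s0 (index_enum 'I_n) openT (fun i (_ : true) => g1 i).
  have p2 := gevrey_prod s0 (index_enum 'I_n) openT (fun i (_ : true) => g2 i).
  exact: (gevreyM s0 openT p1 p2).
- move=> x xa; rewrite !big1 ?mulr1 // => i _; rewrite /phi1 /phi2 /fcoord H1 //.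
  + have := xa i; rewrite ler_distl => /andP[h1 h2].
    rewrite mulNr addrC -mulrBr mulrC ler_pdivlMr // mul1r; lra.
  + have := xa i; rewrite ler_distl => /andP[h1 h2].
    rewrite -mulrDr mulrC ler_pdivlMr // mul1r; lra.
- move=> x /existsNP[i /negP]; rewrite -ltNge lter_normr => /orP[h|h].
  + rewrite [X in _ * X](bigD1 i) //= /phi2 /fcoord H0 ?mul0r ?mulr0 //.
    by rewrite mulNr addrC -mulrBr mulrC pmulr_lle0 ?invr_gt0 //; lra.
  + rewrite [X in X * _](bigD1 i) //= /phi1 /fcoord H0 ?mul0r //.
    by rewrite -mulrDr mulrC pmulr_lle0 ?invr_gt0 //; lra.
Qed.

End Cutoff.

(** * Density of Gevrey functions in smooth functions *)

Section OneVariableApproximation.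
Context {R : realType}.
Variable s : R.
Hypothesis s1 : 1 < s.
Let s0 : 0 <= s. Proof. by rewrite (le_trans _ (ltW s1)). Qed.
Implicit Types (eta kap : nat -> R -> R) (a b c t A e : R) (k l : nat).

(* Only finitely many numbers [eta l c] enter, so that the result is Gevrey for
   every chain [eta]. *)
Inductive interp_op : ((nat -> R -> R) -> nat -> R -> R) -> Prop :=
| interp_term kap l c : gchain s kap ->
    interp_op (fun eta k t => kap k t * eta l c)
| interp_add Phi Psi : interp_op Phi -> interp_op Psi ->
    interp_op (fun eta k t => Phi eta k t + Psi eta k t).

(** A staircase with Gevrey steps, lagging one cell behind: over each new cell it moves from the
    value of [eta 0] at the node before to that at the left end of the cell. The second conclusion,
    that it then stays constant, is what the induction needs to attach the next step. *)
Lemma interp_uniform_grid a (d : R) m : 0 < d -> exists2 Phi, interp_op Phi &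
  forall eta A, chain eta ->
    (forall t, a <= t <= a + m.+1%:R * d -> `|eta 1%N t| <= A) ->
    (forall t, a <= t <= a + m.+1%:R * d -> `|eta 0%N t - Phi eta 0%N t| <= 3 * d * A)
    /\ (forall t, a + m.+1%:R * d <= t -> Phi eta 0%N t = eta 0%N (a + m%:R * d)).
Proof.
move=> d0; have [H [gH H0 H1 H01]] := gevrey_step s1.
have lip eta A u v : chain eta -> u <= v -> v - u <= d ->
    (forall t, u <= t <= v -> `|eta 1%N t| <= A) -> `|eta 0%N v - eta 0%N u| <= d * A.
  move=> ce uv vud eA; have [w /andP[w0 w1] ->] := MVT_point u v (ce 0%N).
  rewrite normrM (ger0_norm (_ : 0 <= v - u)) ?subr_ge0 //; apply: ler_pM => //.
    by rewrite subr_ge0.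
  apply: eA; have uv0 : 0 <= v - u by rewrite subr_ge0.
  have m1 : 0 <= w * (v - u) by rewrite mulr_ge0.
  have m2 : w * (v - u) <= v - u by rewrite ler_piMl.
  by apply/andP; split; lra.
elim: m => [|m [Phi iP HP]].
  exists (fun eta k t => (fun k (_ : R) => if k is 0 then 1 else 0) k t * eta 0%N a).
    by apply: interp_term; exact: gchain_cst.
  move=> eta A ce eA; rewrite !mul1r in eA *.
  split=> t; rewrite ?mul0r ?addr0 ?mul1r // => /andP[at_ ta].
  have ea : forall u, a <= u <= t -> `|eta 1%N u| <= A.
    by move=> u /andP[au ut]; apply: eA; rewrite au (le_trans ut).
  have A0 : 0 <= A by apply: le_trans (eA a _); rewrite // lexx lerDl ltW.
  apply: le_trans (lip _ _ _ _ ce at_ _ ea) _; first by rewrite lerBlDl.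
  by rewrite -mulrA ler_peMl ?mulr_ge0 // ?(ltW d0) //; lra.
set c0 := a + m%:R * d; set c1 := a + m.+1%:R * d; set c2 := a + m.+2%:R * d.
have c01 : c1 = c0 + d by rewrite /c1 /c0 mulrSr; ring.
have c12 : c2 = c1 + d by rewrite /c2 /c1 (mulrSr _ m.+1); ring.
have ac0 : a <= c0 by rewrite /c0 lerDl mulr_ge0 // ltW.
pose K k t := d^-1 ^+ k * H k (d^-1 * t + - (d^-1 * c1)).
have gK : gchain s K by exact: gchain_affine.
exists (fun eta k t => Phi eta k t +
    (K k t * eta 0%N c1 + (fun k t => -1 * K k t) k t * eta 0%N c0)).
  exact: (interp_add iP (interp_add (interp_term 0 c1 gK)
    (interp_term 0 c0 (gchain_scale (-1) gK)))).
move=> eta A ce eA.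
have [|IH1 IH2] := HP eta A ce.
  by move=> t /andP[h1 h2]; apply: eA; rewrite h1 (le_trans h2) // -/c1 -/c2 c12 lerDl ltW.
have KE t : K 0%N t = H 0%N (d^-1 * (t - c1)).
  by rewrite /K expr0 mul1r mulrBr.
split=> t.
  move=> /andP[at_ tc2]; have [tc1|tc1] := leP t c1.
    rewrite !KE H0 ?pmulr_rle0 ?invr_gt0 ?subr_le0 // !(mul0r, mulr0, addr0).
    by apply: IH1; rewrite at_.
  rewrite IH2 ?(ltW tc1) // -/c0 KE.
  have /andP[u0 u1] := H01 (d^-1 * (t - c1)); set u := H _ _ in u0 u1 *.
  have A0 : 0 <= A by apply: le_trans (eA c1 _); rewrite // c12 c01; apply/andP; split; lra.
  have l1 : `|eta 0%N c1 - eta 0%N c0| <= d * A.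
    apply: lip => //; rewrite ?c01; [lra|lra|] => v /andP[h1 h2].
    by apply: eA; rewrite -/c2; apply/andP; split; lra.
  have l2 : `|eta 0%N t - eta 0%N c1| <= d * A.
    apply: lip => //; [lra|lra|] => v /andP[h1 h2].
    by apply: eA; rewrite -/c2; apply/andP; split; lra.
  have -> : eta 0%N t - (eta 0%N c0 + (u * eta 0%N c1 + -1 * u * eta 0%N c0)) =
    (eta 0%N t - eta 0%N c1) + (1 - u) * (eta 0%N c1 - eta 0%N c0) by ring.
  apply: le_trans (ler_normD _ _) _; rewrite normrM (ger0_norm (_ : 0 <= 1 - u)) ?subr_ge0 //.
  have l3 : (1 - u) * `|eta 0%N c1 - eta 0%N c0| <= `|eta 0%N c1 - eta 0%N c0|.
    by rewrite ler_piMl //; lra.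
  have dA : 0 <= d * A by rewrite mulr_ge0 // ltW.
  rewrite -mulrA; lra.
move=> c2t; rewrite -/c2 in c2t; rewrite IH2 -/c0 -/c1; last by lra.
rewrite KE H1; first by ring.
by rewrite mulrC ler_pdivlMr // mul1r; lra.
Qed.

Lemma interp_uniform a b e : a < b -> 0 < e -> exists2 Phi, interp_op Phi &
  forall eta A, chain eta -> (forall t, a <= t <= b -> `|eta 1%N t| <= A) ->
    forall t, a <= t <= b -> `|eta 0%N t - Phi eta 0%N t| <= e * A.
Proof.
move=> ab e0; pose m := Num.truncn (3 * (b - a) / e); pose d := (b - a) / m.+1%:R.
have m0 : 0 < m.+1%:R :> R by rewrite ltr0n.
have d0 : 0 < d by rewrite divr_gt0 // subr_gt0.
have de : 3 * d <= e.
  by rewrite /d mulrA ler_pdivrMr // [e * _]mulrC -ler_pdivrMr // ltW // truncnS_gt.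
have be : a + m.+1%:R * d = b by rewrite /d mulrC divfK ?gt_eqF // addrC subrK.
have [Phi iP HP] := interp_uniform_grid a m d0; exists Phi => // eta A ce eA t tab.
rewrite be in HP; have [H _] := HP eta A ce eA.
apply: le_trans (H t tab) _; rewrite ler_wpM2r //.
by apply: le_trans (eA a _) => //; rewrite lexx ltW.
Qed.

(** Applied to the chain of the derivative, [Phi] uses the numbers [eta l.+1 c], still finitely many
    values of [eta]; integrating only the Gevrey factors therefore stays in the class. *)
Lemma interp_primitive a Phi : interp_op Phi -> exists2 Psi, interp_op Psi &
  forall eta, (forall k t, Psi eta k.+1 t = Phi (fun j => eta j.+1) k t) /\
              Psi eta 0%N a = 0.
Proof.
elim=> {Phi}[kap l c gk|Phi1 Phi2 _ [Psi1 i1 H1] _ [Psi2 i2 H2]].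
  have [kap' [gk' k0 kS]] := gchain_primitive s0 a gk.
  exists (fun eta k t => kap' k t * eta l.+1 c); first exact: interp_term.
  by move=> eta; rewrite k0 mul0r; split=> // k t; rewrite kS.
exists (fun eta k t => Psi1 eta k t + Psi2 eta k t); first exact: interp_add.
move=> eta; have [a1 b1] := H1 eta; have [a2 b2] := H2 eta.
by rewrite b1 b2 addr0; split=> // k t; rewrite a1 a2.
Qed.

Lemma interp_chain Phi eta : interp_op Phi -> chain (Phi eta).
Proof.
elim=> {Phi}[kap l c [ck _] k t|Phi1 Phi2 _ H1 _ H2 k t].
  have := is_derive_scale (eta l c) (ck k t); rewrite mulrC.
  by under [X in is_derive _ _ X]eq_fun do rewrite mulrC.
exact: is_derive_add (H1 k t) (H2 k t).
Qed.

(** The derivative is approximated to order [M], then integrated from [a] and corrected by the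
    constant [eta 0 a]. The integration multiplies the error by at most [b - a], whence the
    tolerance [e / (b - a + 1)]. *)
Lemma interp_approx a b M e : a < b -> 0 < e -> exists2 Phi, interp_op Phi &
  forall eta A, chain eta -> (forall t, a <= t <= b -> `|eta M.+1 t| <= A) ->
    forall k t, (k <= M)%N -> a <= t <= b -> `|eta k t - Phi eta k t| <= e * A.
Proof.
move=> ab; elim: M e => [|M IH] e e0.
  have [Phi iP HP] := interp_uniform ab e0; exists Phi => // eta A ce eA [|//] t _.
  exact: HP.
have ba1 : 0 < b - a + 1 by rewrite ltr_wpDl // subr_ge0 ltW.
have e'0 : 0 < e / (b - a + 1) by rewrite divr_gt0.
have e'e : e / (b - a + 1) <= e.
  by rewrite ler_pdivrMr // ler_peMr ?ltW //; lra.
have [Phi iP HP] := IH _ e'0; have [Psi iPsi HPsi] := interp_primitive a iP.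
exists (fun eta k t => Psi eta k t +
   (fun k (_ : R) => if k is 0 then 1 else 0) k t * eta 0%N a).
  apply: interp_add => //; apply: interp_term; exact: gchain_cst.
move=> eta A ce eA.
have cs : chain (fun j => eta j.+1) by move=> j u; exact: ce.
have K := HP (fun j => eta j.+1) A cs eA; have [HS H0] := HPsi eta.
have A0 : 0 <= A by apply: le_trans (eA a _); rewrite // lexx ltW.
move=> [|k] t kM tab; last first.
  rewrite mul0r addr0 HS; apply: le_trans (K k t kM tab) _.
  by rewrite ler_wpM2r.
rewrite mul1r.
have dD (u : R) : is_derive u 1 (fun t => eta 0%N t + -1 * Psi eta 0%N t)
    (eta 1%N u + -1 * Psi eta 1%N u).
  exact: is_derive_add (ce 0%N u) (is_derive_scale (-1) (interp_chain eta iPsi 0%N u)).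
have [w /andP[w0 w1]] := MVT_point a t dD.
rewrite H0 mulr0 addr0 !mulN1r HS => e1.
have -> : eta 0%N t - (Psi eta 0%N t + eta 0%N a) =
   eta 0%N t - Psi eta 0%N t - eta 0%N a by ring.
rewrite e1 normrM; case/andP: tab => at_ tb.
rewrite ger0_norm ?subr_ge0 //.
have wt0 : 0 <= w * (t - a) by rewrite mulr_ge0 // subr_ge0.
have wt1 : w * (t - a) <= t - a by rewrite ler_piMl // subr_ge0.
have := K 0%N (a + w * (t - a)) (leq0n _); move=> /(_ _)H.
apply: le_trans (_ : (b - a + 1) * (e / (b - a + 1) * A) <= _).
  apply: ler_pM => //; [by rewrite subr_ge0|lra|].
  by apply: H; apply/andP; split; lra.
by rewrite mulrA [(_ + 1) * _]mulrC divfK // gt_eqF.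
Qed.

End OneVariableApproximation.

Section Density.
Context {R : realType} {n : nat}.
Local Notation E := 'rV[R]_n.
Local Notation C := R[i].
Local Notation ei i := (delta_mx 0 i : E).
Implicit Types (U K : set E) (f g h : E -> C) (w v l : seq 'I_n) (x y : E) (i j : 'I_n).

Lemma smoothB U f g : open U -> smooth U f -> smooth U g ->
  smooth U (fun x => f x - g x).
Proof.
move=> oU sf sg; apply: (eq_smooth oU _ (smoothD oU (smoothZ (-1) oU sg) sf)).
by move=> y _; rewrite mulN1r addrC.
Qed.

Lemma pwB U w f g x : open U -> smooth U f -> smooth U g -> U x ->
  pw w (fun x => f x - g x) x = pw w f x - pw w g x.
Proof.
move=> oU sf sg Ux; rewrite addrC -mulN1r -(pwZD w (-1) oU sg sf Ux).
by apply: (eq_pw oU w _ Ux) => y _; rewrite mulN1r addrC.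
Qed.

Lemma ccont_bounded U f K : smooth U f -> compact K -> K `<=` U ->
  exists2 A : R, 0 <= A & forall x, K x -> cmod (f x) <= A.
Proof.
move=> sf cK KU.
have B (g : E -> R) : (forall x, K x -> {for x, continuous g}) ->
    exists2 A : R, 0 <= A & forall x, K x -> `|g x| <= A.
  move=> cg; have : compact (g @` K).
    apply: continuous_compact => //; apply: continuous_in_subspaceT => x.
    by rewrite inE; exact: cg.
  move=> /compact_bounded/ex_strict_bound_gt0[A A0 HA].
  by exists A; [exact: ltW|move=> x Kx; apply/ltW/HA; exists x].
have [|A A0 HA] := B (re_part f).
  by move=> x Kx; exact: (proj1 (smooth_cont sf (KU x Kx))).
have [|A' A'0 HA'] := B (im_part f).
  by move=> x Kx; exact: (proj2 (smooth_cont sf (KU x Kx))).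
exists (A + A'); first exact: addr_ge0.
by move=> x Kx; apply: cmod_le2; [exact: HA|exact: HA'].
Qed.

Lemma smooth_bounded U f K N : smooth U f -> compact K -> K `<=` U ->
  exists2 A : R, 0 <= A & forall w x, (size w <= N)%N -> K x -> cmod (pw w f x) <= A.
Proof.
move=> sf cK KU; elim: N f sf => [|N IH] f sf.
  have [A A0 HA] := ccont_bounded sf cK KU.
  by exists A => // -[|//] x _; exact: HA.
have /(_ _)/cid2 B i := IH _ (smooth_partial i sf).
have [A A0 HA] := ccont_bounded sf cK KU.
have S0 : 0 <= \sum_i projT1 (B i) by apply: sumr_ge0 => i _; case: (B i).
exists (A + \sum_i projT1 (B i)) => [|w x]; first exact: addr_ge0.
case/lastP: w => [_ Kx|w i]; first by rewrite (le_trans (HA x Kx)) // lerDl.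
rewrite size_rcons ltnS pw_rcons => wN Kx.
apply: le_trans (_ : projT1 (B i) <= _); first by case: (B i) => b b0 /= ->.
rewrite (bigD1 i) //= addrCA lerDl addr_ge0 //.
by apply: sumr_ge0 => j _; case: (B j).
Qed.

Definition setc x i (t : R) : E := x + (t - x 0 i) *: ei i.

Lemma setcE x i t j : setc x i t 0 j = if j == i then t else x 0 j.
Proof.
rewrite !mxE eqxx /=; case: eqVneq => [->|_] /=; last by rewrite mulr0 addr0.
by rewrite mulr1 addrC subrK.
Qed.

Lemma setc_id x i : setc x i (x 0 i) = x.
Proof. by rewrite /setc subrr scale0r addr0. Qed.

Lemma setc_cont x i t : {for x, continuous (fun y => setc y i t)}.
Proof.
move=> A /nbhs_ballP[e /= e0 eA]; apply/nbhs_ballP; exists e => //= y xy.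
apply/eA/(cbox_ball _ _ e0) => j; have /(cbox_ball _ _ e0)/(_ j) := xy.
by rewrite !setcE; case: eqP => // _; rewrite subrr normr0.
Qed.

Lemma setc_shift x i t j (a : R) : j != i ->
  setc (a *: ei j + x) i t = a *: ei j + setc x i t.
Proof.
move=> ji; apply/rowP => k; rewrite setcE [RHS]mxE setcE !mxE eqxx /=.
by case: (eqVneq k i) => // ->; rewrite eq_sym (negbTE ji) mulr0 add0r.
Qed.

Lemma setc_shift_same x i t (a : R) : setc (a *: ei i + x) i t = setc x i t.
Proof.
apply/rowP => k; rewrite !setcE !mxE eqxx /=.
by case: (eqVneq k i) => // _; rewrite mulr0 add0r.
Qed.

Lemma setc_is_derive (g : E -> R) i t j x (d : R) :
  (j != i -> is_derive (setc x i t) (ei j) g d) ->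
  is_derive x (ei j) (fun y => g (setc y i t)) (if j == i then 0 else d).
Proof.
case: eqVneq => [->|ji] H.
  apply: (@quad_is_derive _ _ _ _ _ _ 0 1) => // h _.
  by rewrite setc_shift_same mulr0 subrr subr0 normr0 mul0r.
have [dg <-] := H isT.
have e : (fun a : R => a^-1 *: (((fun y => g (setc y i t)) \o shift x) (a *: ei j)
     - g (setc x i t))) =
   (fun a : R => a^-1 *: ((g \o shift (setc x i t)) (a *: ei j) - g (setc x i t))).
  by apply/funext => a /=; rewrite setc_shift.
by apply: DeriveDef; rewrite /derivable /derive e.
Qed.

Lemma smooth_setc f i t : smooth setT f -> smooth setT (fun x => f (setc x i t)).
Proof.
move=> sf; apply: (smooth_coind openT (S := fun h => h = (fun=> 0) \/
    exists2 g, smooth setT g & h = fun x => g (setc x i t))); last first.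
  by right; exists f.
  move=> h [->|[g sg ->]] j.
    by exists (fun=> 0); [left|rewrite partial_cst].
  have D x := conj (setc_is_derive (j := j) (x := x) (t := t) (i := i) (g := re_part g)
      (fun _ => derivableP (proj1 (smooth_cdiff j sg I))))
    (setc_is_derive (j := j) (x := x) (t := t) (i := i) (g := im_part g)
      (fun _ => derivableP (proj2 (smooth_cdiff j sg I)))).
  exists (if j == i then fun=> 0 else fun x => partial j g (setc x i t)).
    case: eqP => _; first by left.
    by right; exists (partial j g); first exact: (smooth_partial j sg).
  move=> x _; have [[_ e1] [_ e2]] := D x.
  rewrite /partial /partial_re [X in X +i* _]e1 [X in _ +i* X]e2.
  by case: eqP.
move=> h [->|[g sg ->]] x _.
  have s0 := smooth_cst (setT : set E) (0 : C).
  by split=> [|j]; [exact: smooth_cont s0 I|exact: smooth_cdiff s0 I].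
have [c1 c2] := smooth_cont sg (I : setT (setc x i t)).
split=> [|j]; split.
- exact: (continuous_comp (setc_cont (t := t)) c1).
- exact: (continuous_comp (setc_cont (t := t)) c2).
- by have [] := setc_is_derive (i := i)
    (fun _ => derivableP (proj1 (smooth_cdiff j sg (I : setT (setc x i t))))).
- by have [] := setc_is_derive (i := i)
    (fun _ => derivableP (proj2 (smooth_cdiff j sg (I : setT (setc x i t))))).
Qed.

Lemma partial_setc f i t j x : smooth setT f ->
  partial j (fun y => f (setc y i t)) x =
  if j == i then 0 else partial j f (setc x i t).
Proof.
move=> sf.
have [_ e1] := setc_is_derive (i := i)
  (fun _ => derivableP (proj1 (smooth_cdiff j sf (I : setT (setc x i t))))).
have [_ e2] := setc_is_derive (i := i)
  (fun _ => derivableP (proj2 (smooth_cdiff j sf (I : setT (setc x i t))))).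
rewrite /partial /partial_re [X in X +i* _]e1 [X in _ +i* X]e2.
by case: eqP.
Qed.

Lemma pw_setc f i t w x : smooth setT f -> i \notin w ->
  pw w (fun y => f (setc y i t)) x = pw w f (setc x i t).
Proof.
move=> sf; elim: w x => //= j w IH x; rewrite inE negb_or => /andP[ij iw].
have -> : pw w (fun y => f (setc y i t)) = fun x => pw w f (setc x i t).
  by apply/funext => y; exact: IH.
by rewrite (partial_setc _ _ _ _ (smooth_pw w sf)) eq_sym (negbTE ij).
Qed.

Lemma setc_chain f i v x : smooth setT f ->
  chain (fun k t => complex.Re (pw (nseq k i ++ v) f (setc x i t))) /\
  chain (fun k t => complex.Im (pw (nseq k i ++ v) f (setc x i t))).
Proof.
move=> sf; have e t : setc x i t = (x - x 0 i *: ei i) + t *: ei i.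
  by rewrite /setc scalerBl addrAC addrA.
split=> k t.
  under [X in is_derive _ _ X]eq_fun do rewrite e; rewrite e.
  exact: (line_is_derive (proj1 (smooth_cdiff i (smooth_pw (nseq k i ++ v) sf) I))).
under [X in is_derive _ _ X]eq_fun do rewrite e; rewrite e.
exact: (line_is_derive (proj2 (smooth_cdiff i (smooth_pw (nseq k i ++ v) sf) I))).
Qed.

(** The density proof is an induction on the list of coordinates that a function may depend on, with
    all functions kept on the same space. *)
Definition depends_on l f := forall x y, (forall i, i \in l -> x 0 i = y 0 i) ->
  f x = f y.

Lemma depends_partial l f j : depends_on l f -> depends_on l (partial j f).
Proof.
move=> df x y xy; have e a : f (a *: ei j + x) = f (a *: ei j + y).
  by apply: df => i /xy; rewrite !mxE => ->.
have D (g : E -> R) : (forall a, g (a *: ei j + x) = g (a *: ei j + y)) ->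
    'D_(ei j) g x = 'D_(ei j) g y.
  move=> eg; rewrite /derive.
  have -> : (fun a => a^-1 *: ((g \o shift x) (a *: ei j) - g x)) =
      (fun a => a^-1 *: ((g \o shift y) (a *: ei j) - g y)).
    have := eg 0; rewrite scale0r !add0r => ->.
    by apply/funext => a /=; rewrite eg.
  by [].
rewrite /partial /partial_re; congr (_ +i* _); apply: D => a.
  by rewrite /re_part e.
by rewrite /im_part e.
Qed.

Lemma depends_pw l f w : depends_on l f -> depends_on l (pw w f).
Proof. by move=> df; elim: w => //= j w; exact: depends_partial. Qed.

Lemma depends_setc l f i t : depends_on (i :: l) f ->
  depends_on l (fun x => f (setc x i t)).
Proof.
move=> df x y xy; apply: df => j; rewrite !setcE inE.
by case: eqP => //= _; exact: xy.
Qed.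

Lemma perm_split w i : perm_eq w (nseq (count_mem i w) i ++ seq.filter (predC1 i) w).
Proof.
have e : seq.filter (pred1 i) w = nseq (count_mem i w) i.
  by rewrite -size_filter; apply/all_pred1P; exact: seq.filter_all.
by rewrite -e perm_sym perm_filterC.
Qed.

Variable s : R.
Hypothesis s1 : 1 < s.
Let s0 : 0 <= s. Proof. by rewrite (le_trans _ (ltW s1)). Qed.

Definition gevrey_approximable f := forall (c : E) (r : R) M (e : R), 0 < e ->
  exists2 g, gevrey s setT g & forall w x, (size w <= M)%N -> cbox c r x ->
    cmod (pw w f x - pw w g x) <= e.

Lemma gevrey_approximableD f g : smooth setT f -> smooth setT g ->
  gevrey_approximable f -> gevrey_approximable g ->
  gevrey_approximable (fun x => f x + g x).
Proof.
move=> sf sg af ag c r M e e0; have e20 : 0 < e / 2 by rewrite divr_gt0.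
have [f' gf' Hf] := af c r M _ e20; have [g' gg' Hg] := ag c r M _ e20.
exists (fun x => f' x + g' x); first exact: (gevreyD openT gf' gg').
move=> w x wM xr; rewrite (pwD w openT sf sg I).
rewrite (pwD w openT (gevrey_smooth gf') (gevrey_smooth gg') I).
rewrite opprD addrACA; apply: le_trans (cmodD _ _) _.
apply: le_trans (lerD (Hf w x wM xr) (Hg w x wM xr)) _; lra.
Qed.

Lemma gevrey_approximableM f g : gevrey s setT f -> smooth setT g ->
  gevrey_approximable g -> gevrey_approximable (fun x => f x * g x).
Proof.
move=> gf sg ag c r M e e0.
have [A A0 HA] := smooth_bounded M (gevrey_smooth gf) (@cbox_compact _ _ c r) (fun _ _ => I).
have A1 : 0 < A + 1 by rewrite ltr_wpDl.
have e'0 : 0 < e / ((A + 1) * 2 ^+ M) by rewrite divr_gt0 // mulr_gt0 // exprn_gt0.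
have [g' gg' Hg] := ag c r M _ e'0.
exists (fun x => f x * g' x); first exact: (gevreyM s0 openT gf gg').
move=> w x wM xr.
have sf := gevrey_smooth gf; have sg' := gevrey_smooth gg'.
rewrite -(pwB w openT (smoothM openT sf sg) (smoothM openT sf sg') I).
rewrite (eq_pw openT w (g := fun x => f x * (g x - g' x)) _ I); last first.
  by move=> y _; rewrite mulrBr.
have := @leibniz_bound R n setT f (fun x => g x - g' x) x M (A + 1)
  (e / ((A + 1) * 2 ^+ M)) (fun=> 1) openT sf (smoothB openT sg sg') I (ltW A1) (ltW e'0)
  (fun=> ler01).
move=> /(_ _ _ _ w wM)H; apply: le_trans (H _ _ _) _.
- by move=> *; rewrite mulr1.
- by move=> u uM; rewrite mulr1 (le_trans (HA u x uM xr)) // lerDl.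
- move=> u uM; rewrite mulr1 (pwB u openT sg sg' I); exact: Hg.
rewrite mulr1.
have -> : (A + 1) * (e / ((A + 1) * 2 ^+ M)) * 2 ^+ size w = e * (2 ^+ size w / 2 ^+ M).
  by field; rewrite expf_neq0 // gt_eqF.
rewrite ler_piMr ?(ltW e0) // ler_pdivrMr ?exprn_gt0 // mul1r.
by rewrite ler_weXn2l // ler1n.
Qed.

Lemma pw_fcoord_mul kap i k v h x : chain kap -> smooth setT h -> i \notin v ->
  (forall y, partial i h y = 0) ->
  pw (nseq k i ++ v) (fun y => fcoord (kap 0%N) i y * h y) x =
  fcoord (kap k) i x * pw v h x.
Proof.
move=> ck sh iv h0.
have sk (m : nat) : smooth setT (fcoord (kap m) i : E -> C).
  by apply: (smooth_fcoord (kap := fun k => kap (k + m)%N)) => k' t; exact: ck.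
have pk (m : nat) j y : partial j (fcoord (kap m) i : E -> C) y =
    if j == i then fcoord (kap m.+1) i y else 0.
  have := @pw_fcoord R n (fun k => kap (k + m)%N) i [:: j] (fun k' t => ck _ t).
  by rewrite /= andbT add0n add1n => ->; case: ifP.
have pv0 y : partial i (pw v h) y = 0.
  rewrite -[LHS]/(pw (i :: v) h y) (perm_pw openT sh (w' := rcons v i)) //; last first.
    by rewrite perm_sym perm_rcons.
  rewrite pw_rcons (_ : partial i h = fun=> 0) ?pw_cst0 //.
  by apply/funext => z; exact: h0.
elim: k x => [|k IH] x /=.
  elim: v iv {pv0} x => [//|j v IHv]; rewrite inE negb_or => /andP[ij iv] x /=.
  rewrite (eq_partial openT j (fun y _ => IHv iv y) I).
  rewrite (partialM (smooth_cdiff j (sk 0%N) I) (smooth_cdiff j (smooth_pw v sh) I)).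
  by rewrite pk eq_sym (negbTE ij) mul0r add0r.
rewrite (eq_partial openT i (fun y _ => IH y) I).
rewrite (partialM (smooth_cdiff i (sk k) I) (smooth_cdiff i (smooth_pw v sh) I)).
by rewrite pk eqxx pv0 mulr0 addr0.
Qed.

Lemma interp_coordinate Phi i l f : interp_op s Phi -> smooth setT f ->
  depends_on (i :: l) f ->
  (forall h, smooth setT h -> depends_on l h -> gevrey_approximable h) ->
  exists P : E -> C, [/\ smooth setT P, gevrey_approximable P &
    forall k v x, i \notin v ->
      complex.Re (pw (nseq k i ++ v) P x) =
        Phi (fun k t => complex.Re (pw (nseq k i ++ v) f (setc x i t))) k (x 0 i) /\
      complex.Im (pw (nseq k i ++ v) P x) =
        Phi (fun k t => complex.Im (pw (nseq k i ++ v) f (setc x i t))) k (x 0 i)].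
Proof.
move=> iP sf df Hl; elim: iP => {Phi}[kap m c gk|Phi1 Phi2 _ [P1 [sP1 aP1 H1]] _ [P2 [sP2 aP2 H2]]].
  pose h x := pw (nseq m i) f (setc x i c).
  have sfm := smooth_pw (nseq m i) sf.
  have sh : smooth setT h := smooth_setc i c sfm.
  have dh : depends_on l h by apply: depends_setc; exact: depends_pw.
  have ck : chain kap by case: gk.
  exists (fun x => fcoord (kap 0%N) i x * h x); split.
  - exact: (smoothM openT (smooth_fcoord i ck) sh).
  - exact: (gevrey_approximableM (gevrey_fcoord i gk) sh (Hl h sh dh)).
  move=> k v x iv.
  have -> : pw (nseq k i ++ v) (fun y => fcoord (kap 0%N) i y * h y) x =
      (kap k (x 0 i))%:C * pw (nseq m i ++ v) f (setc x i c).
    rewrite pw_fcoord_mul //; last by move=> y; rewrite /h partial_setc // eqxx.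
    congr (_ * _); rewrite /h (pw_setc c x sfm iv) -pw_cat.
    by apply: (perm_pw openT sf) => //; rewrite perm_catC.
  by case: (pw _ f _) => a b; split; rewrite /= mul0r ?subr0 ?addr0.
exists (fun x => P1 x + P2 x); split.
- exact: (smoothD openT sP1 sP2).
- exact: gevrey_approximableD.
move=> k v x iv; have [a1 b1] := H1 k v x iv; have [a2 b2] := H2 k v x iv.
rewrite (pwD _ openT sP1 sP2 I).
move: a1 a2 b1 b2; case: (pw _ P1 x) => ? ?; case: (pw _ P2 x) => ? ? /=.
by move=> <- <- <- <-.
Qed.

(** One coordinate is treated at a time: interpolation in it leaves an approximable function [P],
    because its coefficients depend on fewer coordinates. *)
Lemma smooth_gevrey_approximable f : smooth setT f -> gevrey_approximable f.
Proof.
suff H l g : smooth setT g -> depends_on l g -> gevrey_approximable g.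
  move=> sf; apply: (H (enum 'I_n)) => // x y xy; congr (f _); apply/rowP => i.
  by apply: xy; rewrite mem_enum.
elim: l g => [|i l IH] {}f sf df c r M e e0.
  exists f; last by move=> w x _ _; rewrite subrr cmod0 ltW.
  apply: (eq_gevrey openT _ (gevrey_cst s (f 0) openT)) => x _.
  exact: df.
(* [r] may be zero or negative, whereas the interpolation needs a nondegenerate interval. *)
pose r' := Num.max r 1.
have r'0 : 0 < r' by rewrite lt_max ltr01 orbT.
(* Up to [M] derivatives in the other coordinates meet [M.+1] derivatives in coordinate [i], the
   order that [interp_approx] consumes. *)
have [A A0 HA] := smooth_bounded (M + M.+1) sf (@cbox_compact _ _ c r') (fun _ _ => I).
have A1 : 0 < A + 1 by rewrite ltr_wpDl.
(* A quarter of [e] for each of the real and imaginary parts; the other half of [e] goes to the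
   approximation of [P]. *)
have e'0 : 0 < e / (4 * (A + 1)) by rewrite divr_gt0 // mulr_gt0.
have ab : c 0 i - r' < c 0 i + r' by lra.
have [Phi iP HP] := interp_approx s1 M ab e'0.
have [P [sP aP PP]] := interp_coordinate iP sf df IH.
have e20 : 0 < e / 2 by rewrite divr_gt0.
have [g gg Hg] := aP c r M _ e20; exists g => // w x wM xr.
have -> : pw w f x - pw w g x = (pw w f x - pw w P x) + (pw w P x - pw w g x).
  by rewrite addrA subrK.
apply: le_trans (cmodD _ _) _; apply: le_trans (lerD _ (Hg w x wM xr)) (_ : e / 2 + e / 2 <= _);
  last by lra.
set k := count_mem i w; set v := seq.filter (predC1 i) w.
have pe := perm_split w i; rewrite -/k -/v in pe.
have iv : i \notin v by rewrite mem_filter /= eqxx.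
have kv : (k + size v <= M)%N.
  by move: (perm_size pe); rewrite size_cat size_nseq => <-.
rewrite (perm_pw openT sf pe I) (perm_pw openT sP pe I).
have xr' : cbox c r' x by apply: subset_cbox xr; rewrite le_max lexx.
have xi : c 0 i - r' <= x 0 i <= c 0 i + r' by rewrite -ler_distl.
have [cR cI] := setc_chain i v x sf.
have bnd t : c 0 i - r' <= t <= c 0 i + r' ->
    cmod (pw (nseq M.+1 i ++ v) f (setc x i t)) <= A.
  move=> tb; apply: HA.
    rewrite size_cat size_nseq addnC leq_add // (leq_trans _ kv) //.
    exact: leq_addl.
  by move=> j; rewrite setcE; case: eqP => [->|_] //; rewrite ler_distl.
have kM : (k <= M)%N by rewrite (leq_trans _ kv) // leq_addr.
have b1 := HP _ A cR (fun t tb => le_trans (cmod_Re _) (bnd t tb)) k (x 0 i) kM xi.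
have b2 := HP _ A cI (fun t tb => le_trans (cmod_Im _) (bnd t tb)) k (x 0 i) kM xi.
have [p1 p2] := PP k v x iv.
rewrite -p1 setc_id -raddfB in b1; rewrite -p2 setc_id -raddfB in b2.
apply: le_trans (cmod_le2 b1 b2) _.
have eA : e / (4 * (A + 1)) * A <= e / 4.
  rewrite invfM mulrA -[X in _ <= X]mulr1 -mulrA ler_wpM2l ?divr_ge0 ?(ltW e0) //.
  by rewrite mulrC ler_pdivrMr // mul1r lerDl.
lra.
Qed.

End Density.

(** * Iterated integrals and the formal transpose *)

Section Integral1.
Context {R : realType}.

Lemma Rintegral_primitive (f F : R -> R) (A : R) : 0 < A ->
  (forall t : R, {for t, continuous f}) -> (forall t, A < `|t| -> f t = 0) ->
  (forall t : R, is_derive t 1 F (f t)) ->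
  Rintegral (@lebesgue_measure R) setT f = F A - F (- A).
Proof.
move=> A0 cf f0 dF; have AA : - A < A by lra.
have -> : Rintegral (@lebesgue_measure R) setT f =
    (\int[@lebesgue_measure R]_(t in `[- A, A]) f t)%R.
  rewrite [RHS]Rintegral_mkcond; apply: eq_Rintegral => t _.
  rewrite patchE; case: ifPn => // /negP tA; apply: f0; rewrite ltNge.
  by apply/negP; rewrite ler_norml => tb; apply: tA; rewrite inE /= in_itv.
have cF t : {for t, continuous F} := is_derive_continuous (dF t).
rewrite /Rintegral (@continuous_FTC2 R f F (- A) A AA) //.
- exact: continuous_subspaceT.
- split.
  + by move=> x _; have [] := dF x.
  + exact: cvg_at_right_filter (cF _).
  + exact: cvg_at_left_filter (cF _).
- by move=> x _; rewrite derive1E; have [_ ->] := dF x.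
Qed.

End Integral1.

Section IteratedIntegral.
Context {R : realType}.
Implicit Types (A L e t : R).

(** Lipschitz functions supported in a box are stable under slicing and under partial integration,
    so every inner integral is a continuous function of one variable and has a primitive. *)
Definition lip_supp n A L (f : 'rV[R]_n -> R) :=
  (forall x y, `|f x - f y| <= L * `|x - y|) /\
  (forall x, ~ cbox 0 A x -> f x = 0).

Definition slice n (f : 'rV[R]_n.+1 -> R) (t : R) : 'rV[R]_n -> R :=
  fun y => f (row_mx (t%:M : 'rV[R]_1) y).

Lemma integral_slice n (f : 'rV[R]_n.+1 -> R) : integral_rV f =
  Rintegral (@lebesgue_measure R) setT (fun t => integral_rV (slice f t)).
Proof. by []. Qed.

Lemma slice_norm n (t t' : R) (y y' : 'rV[R]_n) (e : R) : 0 <= e ->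
  `|t - t'| <= e -> `|y - y'| <= e ->
  `|(row_mx (t%:M : 'rV[R]_1) y : 'rV[R]_n.+1) - row_mx (t'%:M : 'rV[R]_1) y'| <= e.
Proof.
move=> e0 te /(rV_norm_leP _ e0) ye; apply/rV_norm_leP => // i.
rewrite !mxE; case: (@splitP 1 n i) => [j _|j _].
  by rewrite !mxE (ord1 j) eqxx !mulr1n.
by have := ye j; rewrite !mxE.
Qed.

Lemma slice_lip_supp n A L (f : 'rV[R]_n.+1 -> R) t : 0 <= L -> lip_supp A L f ->
  lip_supp A L (slice f t).
Proof.
move=> L0 [Lf sf]; split=> [x y|y yA].
  apply: le_trans (Lf _ _) _; rewrite ler_wpM2l // slice_norm // subrr normr0.
  exact: normr_ge0.
apply: sf => H; apply: yA => i.
by have := H (rshift 1 i); rewrite (@row_mxEr _ 1 1 n) !mxE.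
Qed.

Lemma slice_out n A L (f : 'rV[R]_n.+1 -> R) t : lip_supp A L f -> A < `|t| ->
  slice f t = fun=> 0.
Proof.
move=> [_ sf] tA; apply/funext => y; apply: sf => /(_ (@lshift 1 n ord0)).
by rewrite (@row_mxEl _ 1 1 n) !mxE subr0 eqxx mulr1n leNgt tA.
Qed.

Lemma lip_supp_lin n A L L' c (f g : 'rV[R]_n -> R) : lip_supp A L f ->
  lip_supp A L' g -> lip_supp A (L + `|c| * L') (fun x => f x + c * g x).
Proof.
move=> [Lf sf] [Lg sg]; split=> [x y|x xA]; last by rewrite sf ?sg // mulr0 addr0.
have -> : f x + c * g x - (f y + c * g y) = (f x - f y) + c * (g x - g y) by ring.
apply: le_trans (ler_normD _ _) _; rewrite mulrDl normrM -mulrA.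
by apply: lerD => //; exact: ler_wpM2l.
Qed.

Lemma lip_continuous (f : R -> R) L : (forall x y, `|f x - f y| <= L * `|x - y|) ->
  forall t, {for t, continuous f}.
Proof.
move=> Lf t; have /cvgrPdist_le : forall e : R, 0 < e ->
    \forall y \near nbhs t, `|f t - f y| <= e.
  move=> e e0; have L1 : 0 < `|L| + 1 by rewrite ltr_wpDl.
  have nb : nbhs t (ball t (e / (`|L| + 1))) by apply: nbhsx_ballx; exact: divr_gt0.
  apply: filterS nb => y; rewrite /ball /= ltr_pdivlMr // => ty.
  apply: le_trans (Lf _ _) _; apply: le_trans (_ : `|t - y| * (`|L| + 1) <= _); last exact: ltW.
  by rewrite mulrC ler_wpM2l // (le_trans (ler_norm _)) // lerDl.
exact.
Qed.

Section FixedSupport.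
Variable A : R.
Hypothesis A0 : 0 < A.
Let A2 : 0 <= 2 * A. Proof. by rewrite mulr_ge0 // ltW. Qed.
Let AA : - A <= A. Proof. by rewrite (@le_trans _ _ 0) ?oppr_le0 // ltW. Qed.

(** Linearity and the bound are proved together, since continuity of the inner integral in the next
    dimension uses both: its increments are integrals of differences of slices. One-dimensional
    integrals are then handled through primitives. *)
Lemma integral_base n :
  (forall L L' c (f g : 'rV[R]_n -> R), 0 <= L -> 0 <= L' ->
     lip_supp A L f -> lip_supp A L' g ->
     integral_rV (fun x => f x + c * g x) = integral_rV f + c * integral_rV g) /\
  (forall L e (f : 'rV[R]_n -> R), 0 <= L -> 0 <= e -> lip_supp A L f ->
     (forall x, `|f x| <= e) -> `|integral_rV f| <= e * (2 * A) ^+ n).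
Proof.
elim: n => [|n [IHl IHb]].
  by split=> [//|L e f _ _ _ fe]; rewrite expr0 mulr1; exact: fe.
have I0 : integral_rV (fun _ : 'rV[R]_n => 0) = 0.
  apply/eqP; rewrite -normr_le0; have := IHb 0 0 (fun=> 0) (lexx _) (lexx _).
  rewrite mul0r; apply; last by move=> x; rewrite normr0.
  by split=> // x y; rewrite subrr normr0 mul0r.
have Gc L (f : 'rV[R]_n.+1 -> R) : 0 <= L -> lip_supp A L f ->
    (forall t, {for t, continuous (fun t => integral_rV (slice f t))}) /\
    (forall t, A < `|t| -> integral_rV (slice f t) = 0).
  move=> L0 Lf; split; last by move=> t tA; rewrite (slice_out Lf tA).
  apply: (@lip_continuous _ (L * (2 * A) ^+ n)) => t t'.
  have -> : integral_rV (slice f t) - integral_rV (slice f t') =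
     integral_rV (fun x => slice f t x + -1 * slice f t' x).
    by rewrite (IHl L L) ?mulN1r //; exact: slice_lip_supp.
  rewrite -mulrA [_ * `|_|]mulrC mulrA.
  apply: (IHb (L + `|-1| * L)); rewrite ?addr_ge0 ?mulr_ge0 //.
    by apply: lip_supp_lin; exact: slice_lip_supp.
  move=> x; rewrite mulN1r; apply: le_trans (proj1 Lf _ _) _.
  by rewrite ler_wpM2l // slice_norm // subrr normr0.
have Gp L (f : 'rV[R]_n.+1 -> R) : 0 <= L -> lip_supp A L f -> exists F : R -> R,
    (forall t : R, is_derive t 1 F (integral_rV (slice f t))) /\
    integral_rV f = F A - F (- A).
  move=> L0 Lf; have [cG sG] := Gc L f L0 Lf; have [F dF] := primitive_exists cG.
  exists F; split=> //; rewrite integral_slice.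
  exact: (Rintegral_primitive A0 cG sG dF).
split.
  move=> L L' c f g L0 L'0 Lf Lg.
  have [F [dF ->]] := Gp L f L0 Lf; have [F' [dF' ->]] := Gp L' g L'0 Lg.
  rewrite integral_slice.
  have LL0 : 0 <= L + `|c| * L' by rewrite addr_ge0 // mulr_ge0.
  have [cG sG] := Gc _ _ LL0 (lip_supp_lin c Lf Lg).
  have dS (t : R) : is_derive t 1 (fun t => F t + c * F' t)
      (integral_rV (slice (fun x => f x + c * g x) t)).
    apply: (is_derive_eq (is_derive_add (dF t) (is_derive_scale c (dF' t)))).
    by rewrite -(IHl L L' c _ _ L0 L'0 (slice_lip_supp t L0 Lf) (slice_lip_supp t L'0 Lg)).
  by rewrite (Rintegral_primitive A0 cG sG dS); ring.
move=> L e f L0 e0 Lf fe; have [F [dF ->]] := Gp L f L0 Lf.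
have [u u01 ->] := MVT_point (- A) A dF.
have -> : A - - A = 2 * A by ring.
rewrite normrM (ger0_norm A2) exprS [leRHS]mulrCA ler_wpM2l //.
apply: (IHb L) => //; first exact: slice_lip_supp.
by move=> x; exact: fe.
Qed.

Lemma integral_lin n L L' c (f g : 'rV[R]_n -> R) : 0 <= L -> 0 <= L' ->
  lip_supp A L f -> lip_supp A L' g ->
  integral_rV (fun x => f x + c * g x) = integral_rV f + c * integral_rV g.
Proof. exact: (proj1 (integral_base n)). Qed.

Lemma integral_bound n L e (f : 'rV[R]_n -> R) : 0 <= L -> 0 <= e ->
  lip_supp A L f -> (forall x, `|f x| <= e) ->
  `|integral_rV f| <= e * (2 * A) ^+ n.
Proof. exact: (proj2 (integral_base n)). Qed.

Lemma lip_supp0 n : lip_supp A 0 (fun _ : 'rV[R]_n => 0).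
Proof. by split=> // x y; rewrite subrr normr0 mul0r. Qed.

Lemma integral0 n : integral_rV (fun _ : 'rV[R]_n => 0 : R) = 0.
Proof.
apply/eqP; rewrite -normr_le0.
have := integral_bound (lexx _) (lexx _) (@lip_supp0 n).
by rewrite mul0r; apply=> x; rewrite normr0.
Qed.

Lemma slice_integral_lip n L (f : 'rV[R]_n.+1 -> R) : 0 <= L -> lip_supp A L f ->
  forall t t', `|integral_rV (slice f t) - integral_rV (slice f t')| <=
    L * (2 * A) ^+ n * `|t - t'|.
Proof.
move=> L0 Lf t t'; have Lt := slice_lip_supp t L0 Lf; have Lt' := slice_lip_supp t' L0 Lf.
rewrite -[_ - _](_ : integral_rV (fun x => slice f t x + -1 * slice f t' x) = _); last first.
  by rewrite (integral_lin (-1) L0 L0 Lt Lt') mulN1r.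
rewrite mulrAC; apply: (integral_bound _ _ (lip_supp_lin (-1) Lt Lt')).
- by rewrite addr_ge0 // mulr_ge0.
- by rewrite mulr_ge0.
move=> x; rewrite mulN1r; apply: le_trans (proj1 Lf _ _) _.
by rewrite ler_wpM2l // slice_norm // subrr normr0.
Qed.

Lemma slice_integral_primitive n L (f : 'rV[R]_n.+1 -> R) : 0 <= L ->
  lip_supp A L f -> exists F : R -> R,
    (forall t : R, is_derive t 1 F (integral_rV (slice f t))) /\
    integral_rV f = F A - F (- A).
Proof.
move=> L0 Lf; have cG := lip_continuous (slice_integral_lip L0 Lf).
have sG t : A < `|t| -> integral_rV (slice f t) = 0.
  by move=> tA; rewrite (slice_out Lf tA) integral0.
have [F dF] := primitive_exists cG.
by exists F; split=> //; exact: (Rintegral_primitive A0 cG sG dF).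
Qed.

(** The primitive [F] of the inner integral is monotone; if it has equal values at [- A] and [A] it
    is constant in between, so its derivative, the inner integral, vanishes, and induction applies
    to the slices. *)
Lemma integral_ge0_eq0 n L (f : 'rV[R]_n -> R) : 0 <= L -> lip_supp A L f ->
  (forall x, 0 <= f x) -> 0 <= integral_rV f /\
  (integral_rV f = 0 -> forall x, f x = 0).
Proof.
elim: n L f => [|n IH] L f L0 Lf f0.
  split=> [|e x]; first exact: f0.
  by rewrite -[RHS]e /=; congr f; apply/rowP => -[].
have [F [dF ->]] := slice_integral_primitive L0 Lf.
have G0 t : 0 <= integral_rV (slice f t).
  by apply: (proj1 (IH L _ L0 (slice_lip_supp t L0 Lf) _)) => y; exact: f0.
have Fmono a b : a <= b -> F a <= F b.
  move=> ab; rewrite -subr_ge0; have [u _ ->] := MVT_point a b dF.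
  by rewrite mulr_ge0 ?subr_ge0.
split=> [|FA]; first by rewrite subr_ge0; exact: Fmono.
have Fc t : - A <= t <= A -> F t = F A.
  move=> /andP[t1 t2]; apply/eqP; rewrite eq_le (Fmono t A t2) /=.
  by have := Fmono _ _ t1; lra.
have Gin t : - A < t < A -> integral_rV (slice f t) = 0.
  move=> tA; have [_ <-] := dF t.
  rewrite (near_eq_derive (g := fun=> F A)) ?derive_cst //.
  near=> u; apply: Fc; apply/andP; split; apply: ltW; near: u;
    case/andP: tA => h1 h2; [exact: lt_nbhsr|exact: lt_nbhsl].
(* The end points [- A] and [A] escape the derivative argument; they are approached from inside at
   distance [d], with the Lipschitz bound for the inner integral. *)
have Gall t : integral_rV (slice f t) = 0.
  have [tA|tA] := ltP A `|t|; first by rewrite (slice_out Lf tA) integral0.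
  have [/Gin//|tA'] := boolP (- A < t < A).
  apply/eqP; rewrite -normr_le0; apply/ler_addgt0Pr => e e0; rewrite add0r.
  have L1 : 0 < L * (2 * A) ^+ n + 1 by rewrite ltr_wpDl // mulr_ge0 // exprn_ge0.
  pose d := Num.min (A / 2) (e / (L * (2 * A) ^+ n + 1)).
  have d0 : 0 < d by rewrite lt_min !divr_gt0.
  have dA : d <= A / 2 by rewrite ge_min lexx.
  have de : d * (L * (2 * A) ^+ n + 1) <= e.
    by rewrite -ler_pdivlMr // ge_min lexx orbT.
  pose t' := if 0 <= t then t - d else t + d.
  have tt' : `|t - t'| = d.
    rewrite /t'; case: ifP => _; first by rewrite opprB addrCA subrr addr0 gtr0_norm.
    by rewrite opprD addrA subrr add0r normrN gtr0_norm.
  have t'A : - A < t' < A.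
    move: tA; rewrite ler_norml /t' => /andP[h1 h2]; have A0' := A0.
    case: ifP => [h|/negbT]; last (rewrite -ltNge => h); apply/andP; split; lra.
  have := slice_integral_lip L0 Lf t t'; rewrite (Gin t' t'A) subr0 tt'.
  move=> /le_trans; apply; apply: le_trans de; rewrite mulrDr mulr1 mulrC.
  by rewrite lerDl ltW.
move=> x; have := proj2 (IH L (slice f (x 0 ord0)) L0 (slice_lip_supp _ L0 Lf) _) (Gall _)
  (\row_j x 0 (rshift 1 j)).
rewrite /slice => /(_ (fun y => f0 _)) <-; congr f; apply/rowP => i.
rewrite !mxE; case: (@splitP 1 n i) => [j ij|j ij].
  by rewrite mxE (ord1 j) eqxx mulr1n; congr (x _ _); apply: val_inj; rewrite /= ij (ord1 j).
by rewrite mxE; congr (x _ _); apply: val_inj; rewrite /= ij.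
Unshelve. all: by end_near. Qed.

End FixedSupport.
End IteratedIntegral.

Section IntegralPartial.
Context {R : realType}.
Implicit Types (A L e t h : R).

Definition vanishes_off n (K : set 'rV[R]_n) (V : zmodType) (f : 'rV[R]_n -> V) :=
  forall x, ~ K x -> f x = 0.

Lemma vanish_pw n (K : set 'rV[R]_n) (f : 'rV[R]_n -> R[i]) w : closed K ->
  vanishes_off K f -> vanishes_off K (pw w f).
Proof.
move=> cK f0 x Kx; have oK : open (~` K) by exact: closed_openC.
by rewrite (eq_pw oK w (g := fun=> 0) _ Kx) ?pw_cst0 // => y; exact: f0.
Qed.

Lemma csupp_lip n A (f : 'rV[R]_n -> R[i]) : smooth setT f ->
  vanishes_off (cbox 0 A) f -> exists2 L, 0 <= L &
  lip_supp A L (re_part f) /\ lip_supp A L (im_part f).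
Proof.
move=> sf f0.
have [B B0 HB] := smooth_bounded 1 sf (@cbox_compact _ _ 0 A) (fun _ _ => I).
have pB i x : cmod (partial i f x) <= B.
  have [xA|xA] := pselect (cbox 0 A x); first exact: (HB [:: i]).
  rewrite -[partial i f x]/(pw [:: i] f x) (vanish_pw _ (@cbox_closed _ _ _ _) f0) //.
  by rewrite cmod0.
have cT : conv1 (setT : set R) by [].
have rT (z : 'rV[R]_n) : rect setT 0 z by [].
have Lf x y := lipschitz_rect_norm cT (@subsetT _ (rect setT 0)) sf
  (fun i z _ => pB i z) B0 (rT y) (rT x).
exists (n%:R * (B + B)); first by rewrite mulr_ge0 // addr_ge0.
split; split=> [x y|x /f0 xE]; rewrite /re_part /im_part ?xE // -raddfB.
  exact: le_trans (cmod_Re _) (Lf x y).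
exact: le_trans (cmod_Im _) (Lf x y).
Qed.

Lemma real_complex_smooth n (U : set 'rV[R]_n) (f : 'rV[R]_n -> R) :
  real_smooth U f -> smooth U (fun x => (f x)%:C).
Proof.
move=> sf; apply/smooth_re_im; split; first exact: sf.
by have /smooth_re_im[] := smooth_cst U (0 : R[i]).
Qed.

Lemma real_smooth_partial n (U : set 'rV[R]_n) (f : 'rV[R]_n -> R) i :
  real_smooth U f -> real_smooth U (partial_re i f).
Proof. by move=> sf w x Ux; have := sf (rcons w i) x Ux; rewrite foldr_rcons. Qed.

Lemma vanish_partial_re n (K : set 'rV[R]_n) (f : 'rV[R]_n -> R) i : closed K ->
  vanishes_off K f -> vanishes_off K (partial_re i f).
Proof.
move=> cK f0 x Kx; have oK : open (~` K) by exact: closed_openC.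
have e : partial i (fun x => (f x)%:C) x = partial i (fun=> 0) x.
  by apply: (eq_partial oK i _ Kx) => y /f0 ->.
rewrite partial_cst in e; exact: (congr1 (@complex.Re R) e).
Qed.

Lemma real_lip n A (f : 'rV[R]_n -> R) : real_smooth setT f ->
  vanishes_off (cbox 0 A) f -> exists2 L, 0 <= L & lip_supp A L f.
Proof.
move=> sf f0; have [|L L0 [H _]] := csupp_lip (real_complex_smooth sf) (A := A).
  by move=> x /f0 ->.
by exists L.
Qed.

Lemma slice_shift n (t : R) (y : 'rV[R]_n) (a : R) (j : 'I_n) :
  (row_mx (t%:M : 'rV[R]_1) (a *: delta_mx 0 j + y) : 'rV[R]_n.+1) =
  a *: delta_mx 0 (rshift 1 j) + row_mx (t%:M : 'rV[R]_1) y.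
Proof.
apply/rowP => i; rewrite !mxE; case: (@splitP 1 n i) => [k ik|k ik].
  rewrite [X in _ * X](_ : _ = 0) ?mulr0 ?add0r //.
  by rewrite (_ : (i == _) = false) ?andbF //; apply/eqP => /(congr1 val) /=; rewrite ik (ord1 k).
rewrite !mxE; congr (_ * (_ && _)%:R + _).
by rewrite -!val_eqE /= ik eqn_add2l.
Qed.

Lemma slice_shift0 n (t : R) (y : 'rV[R]_n) (a : R) :
  (row_mx ((t + a)%:M : 'rV[R]_1) y : 'rV[R]_n.+1) =
  row_mx (t%:M : 'rV[R]_1) y + a *: delta_mx 0 (lshift n (ord0 : 'I_1)).
Proof.
apply/rowP => i; rewrite !mxE; case: (@splitP 1 n i) => [k ik|k ik].
  rewrite !mxE (ord1 k) eqxx !mulr1n (_ : (i == _) = true) ?mulr1 //.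
  by apply/eqP/val_inj; rewrite /= ik (ord1 k).
rewrite [X in _ * X](_ : _ = 0) ?mulr0 ?addr0 //.
by rewrite (_ : (i == _) = false) ?andbF //; apply/eqP => /(congr1 val) /=; rewrite ik.
Qed.

Lemma slice_real_smooth n (f : 'rV[R]_n.+1 -> R) t : real_smooth setT f ->
  real_smooth setT (slice f t) /\
  forall j, partial_re j (slice f t) = slice (partial_re (rshift 1 j) f) t.
Proof.
move=> sf.
have E (g : 'rV[R]_n.+1 -> R) (j : 'I_n) y :
    (fun a : R => a^-1 *: ((slice g t \o shift y) (a *: delta_mx 0 j) - slice g t y)) =
    (fun a : R => a^-1 *: ((g \o shift (row_mx (t%:M : 'rV[R]_1) y))
        (a *: delta_mx 0 (rshift 1 j)) - g (row_mx (t%:M : 'rV[R]_1) y))).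
  by apply/funext => a /=; rewrite /slice slice_shift.
have D (g : 'rV[R]_n.+1 -> R) j : partial_re j (slice g t) = slice (partial_re (rshift 1 j) g) t.
  by apply/funext => y; rewrite /partial_re /slice /derive E.
split=> [w y _|j]; last exact: D.
have -> : foldr partial_re (slice f t) w =
    slice (foldr partial_re f [seq rshift 1 j | j <- w]) t.
  by elim: w => //= j w ->; exact: D.
have [c d] := sf [seq rshift 1 j | j <- w] (row_mx (t%:M : 'rV[R]_1) y) I.
split=> [|j]; last by have := d (rshift 1 j); rewrite /derivable E.
apply: (continuous_comp (f := fun y => row_mx (t%:M : 'rV[R]_1) y : 'rV[R]_n.+1)) c.
move=> B /nbhs_ballP[e /= e0 eB]; apply/nbhs_ballP; exists e => //= z yz.
apply/eB/(cbox_ball _ _ e0) => i; rewrite !mxE; case: (@splitP 1 n i) => [k ik|k ik].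
  by rewrite subrr normr0.
by have /(cbox_ball _ _ e0)/(_ k) := yz.
Qed.

(** Differentiation under the integral sign: the Taylor remainder of the slices is at most
    [B * h ^+ 2], with [B] a bound for second derivatives, and it is integrated over a box of volume
    [(2 * A) ^+ n]. *)
Lemma slice_integral_deriv n A (f : 'rV[R]_n.+1 -> R) : 0 < A ->
  real_smooth setT f -> vanishes_off (cbox 0 A) f ->
  let D := partial_re (lshift n (ord0 : 'I_1)) f in
  forall t, is_derive t 1 (fun t => integral_rV (slice f t)) (integral_rV (slice D t)).
Proof.
move=> A0 sf f0 D t.
have cB := @cbox_closed R n.+1 0 A.
have sD : real_smooth setT D := real_smooth_partial _ sf.
have D0 := vanish_partial_re (lshift n (ord0 : 'I_1)) cB f0.
have [L L0 Lf] := real_lip sf f0; have [L' L'0 LD] := real_lip sD D0.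
have [B B0 HB] := smooth_bounded 2 (real_complex_smooth sf)
  (@cbox_compact _ _ 0 A) (fun _ _ => I).
have D2 x : `|partial_re (lshift n (ord0 : 'I_1)) D x| <= B.
  have [xA|xA] := pselect (cbox 0 A x); last first.
    by rewrite (vanish_partial_re (lshift n (ord0 : 'I_1)) cB D0) // normr0.
  pose w0 := [:: lshift n (ord0 : 'I_1); lshift n (ord0 : 'I_1)].
  have e : foldr partial_re f w0 x = complex.Re (pw w0 (fun x => (f x)%:C) x).
    exact: esym (congr1 (@^~ x) (re_pw w0 (fun x => (f x)%:C))).
  rewrite -[partial_re _ D x]/(foldr partial_re f w0 x) e.
  exact: le_trans (cmod_Re _) (HB w0 x isT xA).
apply: (@quad_is_derive _ _ _ _ _ _ (B * (2 * A) ^+ n) 1) => // h _.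
rewrite [h *: 1](_ : _ = h) ?[_%:A]mulr1 // [h + t]addrC.
have S1 := slice_lip_supp (t + h) L0 Lf; have S2 := slice_lip_supp t L0 Lf.
have S3 := slice_lip_supp t L'0 LD.
have L10 : 0 <= L + `|h| * L' by rewrite addr_ge0 // mulr_ge0.
have S4 := lip_supp_lin h S2 S3; have S5 := lip_supp_lin (-1) S1 S4.
have -> : integral_rV (slice f (t + h)) - integral_rV (slice f t) -
    h * integral_rV (slice D t) = integral_rV (fun y => slice f (t + h) y + -1 *
      (slice f t y + h * slice D t y)).
  rewrite (integral_lin A0 (-1) L0 L10 S1 S4) (integral_lin A0 h L0 L'0 S2 S3).
  by rewrite mulN1r opprD addrA.
rewrite mulrAC; apply: (integral_bound A0 _ _ S5).
- by rewrite addr_ge0 // mulr_ge0.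
- by rewrite mulr_ge0 // sqr_ge0.
move=> y; rewrite mulN1r opprD addrA /slice slice_shift0.
have cT : conv1 (setT : set R) by [].
apply: (quad_bound (c := 0 : 'rV[R]_n.+1) cT) => // z _.
- by have [_] := sf [::] z I; exact.
- by have [_] := sD [::] z I; exact.
Qed.

(** In the first coordinate the outer integrand is the derivative of a compactly supported function;
    in another coordinate the inner integral vanishes by induction. *)
Lemma integral_partial_re n A (f : 'rV[R]_n -> R) i : 0 < A ->
  real_smooth setT f -> vanishes_off (cbox 0 A) f ->
  integral_rV (partial_re i f) = 0.
Proof.
move=> A0; elim: n f i => [|n IH] f i sf f0; first by case: i.
have cB := @cbox_closed R n.+1 0 A.
rewrite integral_slice; have := @fintype.splitK 1 n i.
case: (fintype.split _) => j /= <-.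
  rewrite (ord1 j); set D := partial_re _ f.
  have sD : real_smooth setT D := real_smooth_partial _ sf.
  have D0 := vanish_partial_re (lshift n (ord0 : 'I_1)) cB f0.
  have [L L0 Lf] := real_lip sf f0; have [L' L'0 LD] := real_lip sD D0.
  (* The primitive is evaluated at [A + 1], because vanishing of the slices is known only strictly
     beyond [A]. *)
  have A1 : 0 < A + 1 by rewrite addr_gt0.
  have cG := lip_continuous (slice_integral_lip A0 L'0 LD).
  have Z t : A < `|t| -> integral_rV (slice f t) = 0.
    by move=> tA; rewrite (slice_out Lf tA) (integral0 A0).
  have ZD t : A + 1 < `|t| -> integral_rV (slice D t) = 0.
    move=> tA; rewrite (slice_out LD) ?(integral0 A0) //.
    by apply: lt_trans tA; rewrite ltrDl.
  rewrite (Rintegral_primitive A1 cG ZD (slice_integral_deriv A0 sf f0)) !Z ?subrr //.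
    by rewrite normrN gtr0_norm // ltrDl.
  by rewrite gtr0_norm // ltrDl.
have -> : (fun t => integral_rV (slice (partial_re (rshift 1 j) f) t)) = fun=> 0.
  apply/funext => t; have [st <-] := slice_real_smooth t sf.
  apply: IH => // y yA; apply: f0 => H; apply: yA => k.
  by have := H (rshift 1 k); rewrite (@row_mxEr _ 1 1 n) !mxE.
have d0 (t : R) : is_derive t 1 (fun _ : R => 0 : R) 0 := is_derive_cst _ _ _.
by rewrite (Rintegral_primitive A0 (fun t => is_derive_continuous (d0 t)) _ d0) ?subrr.
Qed.

End IntegralPartial.

Section Transpose.
Context {R : realType} {n : nat}.
Local Notation E := 'rV[R]_n.
Local Notation C := R[i].
Implicit Types (U K : set E) (f g phi psi : E -> C) (w : seq 'I_n) (A : R).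

Lemma supp_out phi : vanishes_off (supp phi) phi.
Proof.
move=> x nx; apply/eqP/negPn/negP => px; apply: nx; exact: subset_closure.
Qed.

Lemma supp_sub phi K : closed K -> vanishes_off K phi -> supp phi `<=` K.
Proof.
move=> cK p0; rewrite /supp (proj1 (closure_id K) cK).
by apply: closure_subset => x /= /eqP px; apply: contrapT => /p0.
Qed.

Lemma compact_closedE K : compact K -> closed K.
Proof. by apply: compact_closed; exact: norm_hausdorff. Qed.

Lemma test_funP U phi : test_fun U phi <-> smooth setT phi /\
  exists K, [/\ compact K, K `<=` U & vanishes_off K phi].
Proof.
split=> [[sp cs sU]|[sp [K [cK KU p0]]]].
  by split=> //; exists (supp phi); split=> //; exact: supp_out.
have sK := supp_sub (compact_closedE cK) p0.
split=> //; last exact: subset_trans KU.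
by apply: subclosed_compact cK sK; exact: closed_closure.
Qed.

Lemma test_fun_smooth U phi : test_fun U phi -> smooth setT phi.
Proof. by case. Qed.

(** Outside [U] the values of [f] are arbitrary, but the product is identically 0 on the open
    complement of [K], and [U] with this complement covers the space. *)
Lemma smooth_mul_vanish U f phi K : open U -> smooth U f -> smooth setT phi ->
  closed K -> K `<=` U -> vanishes_off K phi -> smooth setT (fun x => f x * phi x).
Proof.
move=> oU sf sp cK KU p0; apply: smooth_locally => x _.
have [Kx|nKx] := pselect (K x).
  exists U; split; first exact: KU.
  exact: (smoothM oU sf (subset_smooth (@subsetT _ U) sp)).
have oK : open (~` K) by exact: closed_openC.
exists (~` K); split=> //; apply: (eq_smooth oK _ (smooth_cst _ 0)) => y Ky.
by rewrite p0 ?mulr0.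
Qed.

Lemma test_funM U f phi : open U -> smooth U f -> test_fun U phi ->
  test_fun U (fun x => f x * phi x).
Proof.
move=> oU sf /test_funP[sp [K [cK KU p0]]]; apply/test_funP; split.
  exact: (smooth_mul_vanish oU sf sp (compact_closedE cK) KU p0).
by exists K; split=> // x /p0 ->; rewrite mulr0.
Qed.

Lemma test_fun_pw U w phi : test_fun U phi -> test_fun U (pw w phi).
Proof.
move=> /test_funP[sp [K [cK KU p0]]]; apply/test_funP; split.
  exact: smooth_pw.
by exists K; split=> //; apply: vanish_pw p0; exact: compact_closedE.
Qed.

Lemma test_funD U f g : test_fun U f -> test_fun U g ->
  test_fun U (fun x => f x + g x).
Proof.
move=> /test_funP[sf [K [cK KU f0]]] /test_funP[sg [K' [cK' KU' g0]]].
apply/test_funP; split; first exact: (smoothD openT sf sg).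
exists (K `|` K'); split; first exact: compactU.
  by move=> x [/KU|/KU'].
by move=> x /not_orP[/f0 -> /g0 ->]; rewrite addr0.
Qed.

Lemma test_fun0 U : test_fun U (fun=> 0).
Proof.
apply/test_funP; split; first exact: smooth_cst.
by exists set0; split=> //; exact: compact0.
Qed.

Lemma test_funZ U c f : test_fun U f -> test_fun U (fun x => c * f x).
Proof.
move=> /test_funP[sf [K [cK KU f0]]]; apply/test_funP.
split; first exact: (smoothZ c openT sf).
by exists K; split=> // x /f0 ->; rewrite mulr0.
Qed.

Lemma test_fun_sum U (J : Type) (r : seq J) (P : pred J) (F : J -> E -> C) :
  (forall j, P j -> test_fun U (F j)) ->
  test_fun U (fun x => \sum_(j <- r | P j) F j x).
Proof.
move=> sF; elim: r => [|j r IH].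
  rewrite (_ : (fun x => _) = fun=> 0); first exact: test_fun0.
  by apply/funext => x; rewrite big_nil.
have [Pj|/negbTE Pj] := boolP (P j).
  rewrite (_ : (fun x => _) = fun x => F j x + \sum_(j <- r | P j) F j x).
    exact: (test_funD (sF j Pj) IH).
  by apply/funext => x; rewrite big_cons Pj.
rewrite (_ : (fun x => _) = fun x => \sum_(j <- r | P j) F j x) //.
by apply/funext => x; rewrite big_cons Pj.
Qed.

Definition csmooth f := smooth setT f /\ exists2 A : R, 0 < A & vanishes_off (cbox 0 A) f.

Lemma test_fun_csmooth U phi : test_fun U phi -> csmooth phi.
Proof.
move=> /test_funP[sp [K [cK KU p0]]]; split=> //.
have /ex_strict_bound_gt0[A A0 HA] := compact_bounded cK.
exists A => // x xA; apply: p0 => /HA/ltW/(rV_norm_leP _ (ltW A0)) xA'.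
by apply: xA => i; rewrite mxE subr0.
Qed.

Lemma vanish_mono A B f : A <= B -> vanishes_off (cbox 0 A) f -> vanishes_off (cbox 0 B) f.
Proof. by move=> AB f0 x xB; apply: f0 => xA; apply: xB; apply: subset_cbox xA. Qed.

Lemma csmoothM f g : csmooth f -> smooth setT g -> csmooth (fun x => f x * g x).
Proof.
move=> [sf [A A0 f0]] sg; split; first exact: (smoothM openT sf sg).
by exists A => // x /f0 ->; rewrite mul0r.
Qed.

Lemma csmooth_pw w f : csmooth f -> csmooth (pw w f).
Proof.
move=> [sf [A A0 f0]]; split; first exact: smooth_pw.
by exists A => //; apply: vanish_pw f0; exact: cbox_closed.
Qed.

Lemma cintegralD f g : csmooth f -> csmooth g ->
  cintegral (fun x => f x + g x) = cintegral f + cintegral g.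
Proof.
move=> [sf [A A0 f0]] [sg [B B0 g0]]; pose M := Num.max A B.
have M0 : 0 < M by rewrite lt_max A0.
have AM : A <= M by rewrite le_max lexx.
have BM : B <= M by rewrite le_max lexx orbT.
have [L L0 [f1 f2]] := csupp_lip sf (vanish_mono AM f0).
have [L' L'0 [g1 g2]] := csupp_lip sg (vanish_mono BM g0).
have i1 := integral_lin M0 1 L0 L'0 f1 g1; have i2 := integral_lin M0 1 L0 L'0 f2 g2.
rewrite /cintegral re_partD im_partD.
rewrite (_ : re_part f + re_part g = fun x => re_part f x + 1 * re_part g x); last first.
  by apply/funext => x; rewrite mul1r.
rewrite (_ : im_part f + im_part g = fun x => im_part f x + 1 * im_part g x); last first.
  by apply/funext => x; rewrite mul1r.
by rewrite i1 i2 !mul1r.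
Qed.

Lemma cintegral0 : cintegral (fun _ : E => 0 : C) = 0.
Proof.
rewrite /cintegral (_ : re_part _ = fun=> 0) // (_ : im_part _ = fun=> 0) //.
by rewrite (integral0 (@ltr01 R)).
Qed.

Lemma csmooth_add f g : csmooth f -> csmooth g -> csmooth (fun x => f x + g x).
Proof.
move=> [sf [A A0 f0]] [sg [B B0 g0]]; split; first exact: (smoothD openT sf sg).
exists (Num.max A B); first by rewrite lt_max A0.
move=> x xM; have AM : A <= Num.max A B by rewrite le_max lexx.
have BM : B <= Num.max A B by rewrite le_max lexx orbT.
by rewrite (vanish_mono AM f0) // (vanish_mono BM g0) // addr0.
Qed.

Lemma cintegralN f : csmooth f -> cintegral (fun x => - f x) = - cintegral f.
Proof.
move=> cf; apply/eqP; rewrite -addr_eq0.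
have cN : csmooth (fun x => - f x).
  have := csmoothM cf (smooth_cst setT (-1 : C)).
  by under eq_fun do rewrite mulrN1.
rewrite -cintegralD // (_ : (fun x => _) = fun=> 0) ?cintegral0 //.
by apply/funext => x; rewrite addNr.
Qed.

Lemma cintegral_sum (J : Type) (r : seq J) (P : pred J) (F : J -> E -> C) :
  (forall j, P j -> csmooth (F j)) ->
  csmooth (fun x => \sum_(j <- r | P j) F j x) /\
  cintegral (fun x => \sum_(j <- r | P j) F j x) = \sum_(j <- r | P j) cintegral (F j).
Proof.
move=> sF; elim: r => [|j r [IH1 IH2]].
  rewrite big_nil (_ : (fun x => _) = fun=> 0); last first.
    by apply/funext => x; rewrite big_nil.
  split; last exact: cintegral0.
  by split; [exact: smooth_cst|exists 1].
rewrite big_cons; have [Pj|/negbTE Pj] := boolP (P j).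
  rewrite (_ : (fun x => _) = fun x => F j x + \sum_(j <- r | P j) F j x); last first.
    by apply/funext => x; rewrite big_cons Pj.
  by rewrite cintegralD ?IH2 //; [split=> //; apply: csmooth_add => //; exact: sF|exact: sF].
rewrite (_ : (fun x => _) = fun x => \sum_(j <- r | P j) F j x) //.
by apply/funext => x; rewrite big_cons Pj.
Qed.

Lemma cintegral_partial f i : csmooth f -> cintegral (partial i f) = 0.
Proof.
move=> [sf [A A0 f0]]; have /smooth_re_im[sr si] := sf.
rewrite /cintegral (_ : re_part _ = partial_re i (re_part f)) //.
rewrite (_ : im_part _ = partial_re i (im_part f)) //.
rewrite !(integral_partial_re _ A0) // => x /f0; rewrite /re_part /im_part => -> //.
Qed.

Lemma cintegral_parts1 f g i : csmooth f -> smooth setT g ->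
  cintegral (fun x => partial i f x * g x) = - cintegral (fun x => f x * partial i g x).
Proof.
move=> cf sg; have sf := proj1 cf.
have c1 : csmooth (fun x => partial i f x * g x) := csmoothM (csmooth_pw [:: i] cf) sg.
have c2 : csmooth (fun x => f x * partial i g x) := csmoothM cf (smooth_partial i sg).
apply/eqP; rewrite -addr_eq0 -cintegralD //; apply/eqP.
rewrite -(cintegral_partial i (csmoothM cf sg)); congr cintegral; apply/funext => x.
by rewrite (partialM (smooth_cdiff i sf I) (smooth_cdiff i sg I)).
Qed.

Lemma cintegral_parts f g w : csmooth f -> smooth setT g ->
  cintegral (fun x => pw w f x * g x) =
  (-1) ^+ size w * cintegral (fun x => f x * pw w g x).
Proof.
move=> cf sg.
(* Letters cross to [g] one at a time and arrive in reverse order, which the equality of mixed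
   derivatives undoes. *)
suff -> : cintegral (fun x => pw w f x * g x) =
    (-1) ^+ size w * cintegral (fun x => f x * pw (rev w) g x).
  congr (_ * cintegral _); apply/funext => x; congr (_ * _).
  by apply: (perm_pw openT sg) => //; rewrite perm_rev.
elim: w g sg => [|i w IH] g sg; first by rewrite expr0 mul1r.
rewrite [LHS](cintegral_parts1 i (csmooth_pw w cf) sg) (IH _ (smooth_partial i sg)).
by rewrite rev_cons pw_rcons exprS mulN1r mulNr.
Qed.

(** The explicit transpose on functions. Applying [P] to a form amounts to composing the form with
    this operator, see [pdo_form_transpose]. *)
Definition transpose (P : pdo R n) phi : E -> C := fun x =>
  pdo_sum P (fun a => (-1) ^+ mabs a * dpart a (fun y => pdo_coef P a y * phi y) x).

Variables (Om : set E) (P : pdo R n).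
Hypothesis oOm : open Om.

Lemma test_fun_transpose phi : coefs_in (smooth Om) P -> test_fun Om phi ->
  test_fun Om (transpose P phi).
Proof.
move=> cP tp; apply: test_fun_sum => b bP; apply: test_funZ.
by rewrite dpartE; apply/test_fun_pw/(test_funM oOm) => //; exact: cP.
Qed.

Lemma cintegral_transpose phi psi : coefs_in (smooth Om) P ->
  test_fun Om phi -> test_fun Om psi ->
  cintegral (fun x => pdo_fun P phi x * psi x) =
  cintegral (fun x => phi x * transpose P psi x).
Proof.
move=> cP tp ts; have cp := test_fun_csmooth tp; have sp := test_fun_smooth tp.
have ss := test_fun_smooth ts.
pose ix (b : {ffun 'I_n -> 'I_(pdo_order P).+1}) : multi_index n := [ffun i => b i : nat].
pose F b x := dpart (ix b) phi x * (pdo_coef P (ix b) x * psi x).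
pose G b x := phi x * ((-1) ^+ mabs (ix b) * dpart (ix b) (fun y => pdo_coef P (ix b) y * psi y) x).
have sPb b : (mabs (ix b) <= pdo_order P)%N ->
    smooth setT (fun x => pdo_coef P (ix b) x * psi x).
  by move=> bP; exact: (test_fun_smooth (test_funM oOm (cP _ bP) ts)).
rewrite (_ : (fun x => pdo_fun P phi x * psi x) =
    fun x => \sum_(b | (mabs (ix b) <= pdo_order P)%N) F b x); last first.
  apply/funext => x; rewrite /pdo_fun /pdo_sum mulr_suml; apply: eq_bigr => b _.
  by rewrite /F mulrAC mulrC mulrA mulrAC -mulrA.
rewrite (_ : (fun x => phi x * transpose P psi x) =
    fun x => \sum_(b | (mabs (ix b) <= pdo_order P)%N) G b x); last first.
  by apply/funext => x; rewrite /transpose /pdo_sum mulr_sumr.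
have sdp b : (mabs (ix b) <= pdo_order P)%N -> smooth setT (fun x =>
    (-1) ^+ mabs (ix b) * dpart (ix b) (fun y => pdo_coef P (ix b) y * psi y) x).
  by move=> bP; apply: (smoothZ _ openT); rewrite dpartE; exact: (smooth_pw _ (sPb b bP)).
rewrite (proj2 (cintegral_sum _ _)); last first.
  move=> b bP; apply: csmoothM (sPb b bP); rewrite dpartE; exact: csmooth_pw.
rewrite (proj2 (cintegral_sum _ _)); last first.
  by move=> b bP; exact: (csmoothM cp (sdp b bP)).
apply: eq_bigr => b bP; rewrite /F dpartE (cintegral_parts _ cp (sPb b bP)) size_word.
have sg : cintegral (fun x => phi x * pw (word (ix b)) (fun y => pdo_coef P (ix b) y * psi y) x)
    *+ 1 = cintegral (fun x => phi x * dpart (ix b) (fun y => pdo_coef P (ix b) y * psi y) x).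
  by rewrite dpartE.
rewrite mulr1n in sg; rewrite sg /G; set h := dpart _ _.
have ch : csmooth (fun x => phi x * h x).
  by apply: (csmoothM cp); rewrite /h dpartE; exact: (smooth_pw _ (sPb b bP)).
rewrite -signr_odd; case: odd; rewrite ?expr1 ?expr0.
  rewrite mulN1r -cintegralN //; congr cintegral; apply/funext => x.
  by rewrite mulN1r mulrN.
by rewrite mul1r; congr cintegral; apply/funext => x; rewrite mul1r.
Qed.

Lemma csmooth_sq_eq0 f : csmooth f ->
  cintegral (fun x => (f x)^* * f x) = 0 -> forall x, f x = 0.
Proof.
move=> cf; have [sf [A A0 f0]] := cf.
have sc : smooth setT (fun x => (f x)^*).
  move/smooth_re_im: (sf) => [sr si]; apply/smooth_re_im; split.
    by rewrite (_ : re_part _ = re_part f) //; apply/funext => x; rewrite /re_part; case: (f x).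
  move/smooth_re_im: (smoothZ (-1) openT sf) => [_].
  rewrite (_ : im_part _ = im_part (fun x => (f x)^*)) //.
  by apply/funext => x; rewrite /im_part mulN1r; case: (f x).
have [sm [B B0 m0]] := csmoothM cf sc.
have [L L0 [Lr _]] := csupp_lip sm m0.
have rE x : re_part (fun x => f x * (f x)^*) x = complex.Re (f x) ^+ 2 + complex.Im (f x) ^+ 2.
  by rewrite /re_part; case: (f x) => a b /=; rewrite !expr2; ring.
have [_ Z] := integral_ge0_eq0 B0 L0 Lr
  (fun x => ltac:(rewrite rE; exact: addr_ge0 (sqr_ge0 _) (sqr_ge0 _))).
move=> cz x; have {}Z := Z _ x.
have : complex.Re (f x) ^+ 2 + complex.Im (f x) ^+ 2 = 0.
  rewrite -rE; apply: Z.
  rewrite (_ : (fun x => f x * (f x)^*) = fun x => (f x)^* * f x); last first.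
    by apply/funext => y; rewrite mulrC.
  exact: (congr1 (@complex.Re R) cz).
move/eqP; rewrite paddr_eq0 ?sqr_ge0 // !sqrf_eq0 => /andP[/eqP a /eqP b].
by rewrite [f x]complexE a b mulr0 addr0.
Qed.

(** The difference [w] of the two sides is a test function whose product with every test function
    has integral 0. Choosing the conjugate of [w] makes the integral of its squared modulus 0. *)
Lemma transpose_unique (tP : pdo R n) phi : coefs_in (smooth Om) P ->
  formal_transpose Om P tP -> test_fun Om phi ->
  forall x, pdo_fun tP phi x = transpose P phi x.
Proof.
move=> cP [ctP Hf] tp x; apply/eqP; rewrite -subr_eq0; apply/eqP; move: x.
have t1 : test_fun Om (pdo_fun tP phi).
  apply: test_fun_sum => b bP; apply: (test_funM oOm); first exact: ctP.
  by rewrite dpartE; exact: test_fun_pw.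
have t2 := test_fun_transpose cP tp.
have tw : test_fun Om (fun x => pdo_fun tP phi x - transpose P phi x).
  have := test_funD t1 (test_funZ (-1) t2).
  by under eq_fun do rewrite mulN1r.
set w := fun x => _ in tw.
have tc : test_fun Om (fun x => (w x)^*).
  move: tw => /test_funP[sw [K [cK KU w0]]]; apply/test_funP; split; last first.
    by exists K; split=> // y /w0 ->; rewrite rmorph0.
  move/smooth_re_im: (sw) => [sr si]; apply/smooth_re_im; split.
    by rewrite (_ : re_part _ = re_part w) //; apply/funext => y; rewrite /re_part; case: (w y).
  move/smooth_re_im: (smoothZ (-1) openT sw) => [_].
  rewrite (_ : im_part _ = im_part (fun x => (w x)^*)) //.
  by apply/funext => y; rewrite /im_part mulN1r; case: (w y).
apply: csmooth_sq_eq0; first exact: (test_fun_csmooth tw).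
have cc := test_fun_csmooth tc.
have e := Hf _ _ tc tp; rewrite (cintegral_transpose cP tc tp) in e.
have c1 := csmoothM cc (test_fun_smooth t1); have c2 := csmoothM cc (test_fun_smooth t2).
have c2N : csmooth (fun x => - ((w x)^* * transpose P phi x)).
  have := csmoothM c2 (smooth_cst setT (-1 : C)).
  by under eq_fun do rewrite mulrN1.
rewrite (_ : (fun x => (w x)^* * w x) = fun x => (w x)^* * pdo_fun tP phi x +
    - ((w x)^* * transpose P phi x)); last by apply/funext => y; rewrite /w mulrBr.
by rewrite (cintegralD c1 c2N) (cintegralN c2) e subrr.
Qed.

End Transpose.

(** * Functional analysis *)

Section HahnBanach.
Context {R : realType} {V : lmodType R}.
Implicit Types (D W : set V) (u v : V -> R) (p : V -> R) (f g h : V) (a r : R).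

Definition subsp D := D 0 /\ forall a f g, D f -> D g -> D (a *: f + g).

Definition rlinear D u := forall a f g, D f -> D g -> u (a *: f + g) = a * u f + u g.

Definition sublinear D p := [/\ forall f g, D f -> D g -> p (f + g) <= p f + p g,
  forall a f, 0 < a -> D f -> p (a *: f) = a * p f & p 0 = 0].

Lemma subspZ D a f : subsp D -> D f -> D (a *: f).
Proof. by move=> [D0 DD] Df; rewrite -[_ *: _]addr0; exact: DD. Qed.

Lemma subspD D f g : subsp D -> D f -> D g -> D (f + g).
Proof. by move=> [_ DD] Df Dg; rewrite -[f]scale1r; exact: DD. Qed.

Lemma subspB D f g : subsp D -> D f -> D g -> D (f - g).
Proof. by move=> [_ DD] Df Dg; rewrite addrC -scaleN1r; exact: DD. Qed.

Lemma rlinear0 D u : subsp D -> rlinear D u -> u 0 = 0.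
Proof.
move=> [D0 _] lu; have := lu 1 0 0 D0 D0; rewrite scale1r addr0 mul1r.
by move/eqP; rewrite -subr_eq subrr => /eqP <-.
Qed.

Lemma rlinearZ D u a f : subsp D -> rlinear D u -> D f -> u (a *: f) = a * u f.
Proof.
by move=> sD lu Df; rewrite -[_ *: _]addr0 lu ?(rlinear0 sD lu) ?addr0 //; case: sD.
Qed.

Lemma rlinearB D u f g : subsp D -> rlinear D u -> D f -> D g -> u (f - g) = u f - u g.
Proof. by move=> sD lu Df Dg; rewrite addrC -scaleN1r lu // mulN1r addrC. Qed.

Section Extension.
Variables (D W : set V) (p : V -> R) (u : V -> R).
Hypotheses (sD : subsp D) (sW : subsp W) (WD : W `<=` D).
Hypotheses (sp : sublinear D p) (lu : rlinear W u) (up : forall f, W f -> u f <= p f).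

(* Graphs of linear extensions of [u] dominated by [p]: such a set is
   automatically single valued since [(0, r)] forces [r = 0]. *)
Let good (G : set (V * R)) := [/\ forall f, W f -> G (f, u f),
  forall a x y, G x -> G y -> G (a *: x.1 + y.1, a * x.2 + y.2) &
  forall x, G x -> D x.1 /\ x.2 <= p x.1].

Let good_fun G f r r' : good G -> G (f, r) -> G (f, r') -> r = r'.
Proof.
move=> [GW GL Gp] Gr Gr'; have [_ _ p0] := sp.
have K t t' : G (f, t) -> G (f, t') -> t <= t'.
  move=> Gt Gt'; have := GL (-1) _ _ Gt' Gt; rewrite /= scaleN1r addNr mulN1r.
  by move=> /Gp[_] /=; rewrite p0 addrC subr_le0.
by apply/eqP; rewrite eq_le !K.
Qed.

Let good_extend G g : good G -> D g -> (forall r, ~ G (g, r)) ->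
  exists2 G', good G' & G `<` G'.
Proof.
move=> gG Dg ng; have [GW GL Gp] := gG; have [pD pZ p0] := sp.
have G0 : G (0, 0).
  by have := GW 0 (proj1 sW); rewrite (rlinear0 sW lu).
have GZ a f r : G (f, r) -> G (a *: f, a * r).
  by move=> Gf; have := GL a _ _ Gf G0; rewrite /= !addr0.
have key f r f' r' : G (f, r) -> G (f', r') -> r - p (f - g) <= p (f' + g) - r'.
  move=> Gf Gf'; have := GL 1 _ _ Gf Gf'; rewrite /= scale1r mul1r => /Gp[_ /= H].
  have [Df _] := Gp _ Gf; have [Df' _] := Gp _ Gf'.
  have := pD _ _ (subspD sD Df' Dg) (subspB sD Df Dg).
  by rewrite addrACA subrr addr0 [f' + f]addrC; lra.
(* A value at [g] is admissible when it lies above all [r - p (f - g)] and below all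
   [p (f' + g) - r']; [key] says that such values exist, and the supremum of the former is taken. *)
pose S := [set t | exists f r, G (f, r) /\ t = r - p (f - g)].
have S0 : S !=set0 by exists (0 - p (0 - g)); exists 0, 0.
have Sub f' r' : G (f', r') -> ubound S (p (f' + g) - r').
  by move=> Gf' _ [f [r [Gf ->]]]; exact: key.
have hS : has_ubound S by exists (p (0 + g) - 0); exact: Sub.
pose al := sup S.
have al1 f r : G (f, r) -> r + al <= p (f + g).
  by move=> Gf; rewrite addrC -lerBrDr; apply: ge_sup => //; exact: Sub.
have al2 f r : G (f, r) -> r - al <= p (f - g).
  by move=> Gf; rewrite lerBlDr addrC -lerBlDr; apply: ub_le_sup => //; exists f, r.
pose G' := [set x | exists f r t, [/\ G (f, r), x.1 = f + t *: g & x.2 = r + t * al]].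
have GG' : G `<=` G'.
  by move=> [f r] Gf; exists f, r, 0; split=> //=; rewrite ?scale0r ?mul0r addr0.
exists G'; last first.
  split=> // /(_ (g, al)) H; apply: (ng al); apply: H.
  by exists 0, 0, 1; split=> //=; rewrite ?scale1r ?mul1r add0r.
split=> [f Wf|a x y [f [r [t [Gf x1 x2]]]] [f' [r' [t' [Gf' y1 y2]]]]|x].
- exact/GG'/GW.
- exists (a *: f + f'), (a * r + r'), (a * t + t'); split.
  + exact: (GL a _ _ Gf Gf').
  + by rewrite /= x1 y1 scalerDr scalerDl scalerA addrACA.
  + by rewrite /= x2 y2; ring.
move=> [f [r [t [Gf -> ->]]]]; have [/= Df fp] := Gp _ Gf.
split; first by rewrite addrC; case: sD => _; exact.
have [t0|t0|->] := ltgtP t 0; last by rewrite mul0r scale0r !addr0.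
- have tn : 0 < - t by rewrite oppr_gt0.
  have tn0 : - t != 0 by rewrite gt_eqF.
  have := al2 _ _ (GZ (- t)^-1 _ _ Gf); rewrite -(ler_pM2l tn) -pZ //; last first.
    by apply: subspB => //; exact: subspZ.
  rewrite mulrBr mulrA divff // mul1r scalerBr scalerA divff // scale1r.
  by rewrite mulNr opprK scaleNr opprK.
- have tn0 : t != 0 by rewrite gt_eqF.
  have := al1 _ _ (GZ t^-1 _ _ Gf); rewrite -(ler_pM2l t0) -pZ //; last first.
    by apply: subspD => //; exact: subspZ.
  by rewrite mulrDr mulrA divff // mul1r scalerDr scalerA divff // scale1r.
Qed.

Lemma hahn_banach_extension : exists v, [/\ rlinear D v, forall f, W f -> v f = u f &
  forall f, D f -> v f <= p f].
Proof.
pose base : set (V * R) := [set x | W x.1 /\ x.2 = u x.1].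
have gb : good base.
  split=> [f Wf|a x y [Wx x2] [Wy y2]|x [Wx x2]].
  - by split.
  - by split; [case: sW => _; exact|rewrite /= x2 y2 lu].
  - by rewrite x2; split; [exact: WD|exact: up].
have [|G [[G0|gG] Gmax]] := @Zorn_bigcup (V * R) (fun G => G = set0 \/ good G).
- move=> F FP Ft.
  have [[G [FG gG]]|nF] := pselect (exists G, F G /\ good G); last first.
    left; apply/seteqP; split=> // x [G FG Gx].
    case: (FP G FG) => [G0|gG]; first by rewrite G0 in Gx.
    by apply: nF; exists G.
  have Fg G' x : F G' -> G' x -> good G'.
    by move=> /FP[-> //|].
  right; split=> [f Wf|a x y [G1 F1 x1] [G2 F2 y2]|x [G1 F1 x1]].
  - by exists G => //; case: gG => H _ _; exact: H.
  - have [s|s] := Ft _ _ F1 F2.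
      exists G2 => //; have [_ H _] := Fg _ _ F2 y2; apply: H => //; exact: s.
    by exists G1 => //; have [_ H _] := Fg _ _ F1 x1; apply: H => //; exact: s.
  - by have [_ _ H] := Fg _ _ F1 x1; exact: H.
- exfalso; apply: (Gmax base); last by right.
  rewrite G0; split=> // H; have := H (0, u 0); apply.
  by split=> //; exact: (proj1 sW).
have [GW GL Gp] := gG.
have Gdom f : D f -> exists r, G (f, r).
  move=> Df; apply: contrapT => /forallNP nf.
  have [G' gG' GG'] := good_extend gG Df nf.
  by apply: (Gmax G' GG'); right.
pose v f := xget 0 [set r | G (f, r)].
have Gv f : D f -> G (f, v f).
  by move=> /Gdom[r Gr]; rewrite /v; case: xgetP => [r' -> //|/(_ r)].
exists v; split=> [a f g Df Dg|f Wf|f Df].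
- apply: (good_fun gG) (GL a _ _ (Gv f Df) (Gv g Dg)).
  by apply: Gv; case: sD => _; exact.
- by apply: (good_fun gG) (GW f Wf); apply/Gv/WD.
- by case: (Gp _ (Gv f Df)).
Qed.

End Extension.

Lemma hahn_banach_point D p g : subsp D -> sublinear D p ->
  (forall f, D f -> p (- f) = p f) -> D g ->
  exists v, [/\ rlinear D v, v g = p g & forall f, D f -> `|v f| <= p f].
Proof.
move=> sD sp pN Dg; have [pD pZ p0] := sp.
have abs v : rlinear D v -> (forall f, D f -> v f <= p f) ->
    forall f, D f -> `|v f| <= p f.
  move=> lv vp f Df; rewrite ler_norml vp // andbT lerNl.
  have DN : D (- f) by rewrite -scaleN1r; exact: subspZ.
  by rewrite -(mulN1r (v f)) -(rlinearZ (-1) sD lv Df) scaleN1r -pN //; exact: vp.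
have pge0 f : D f -> 0 <= p f.
  move=> Df; have DN : D (- f) by rewrite -scaleN1r; exact: subspZ.
  have := pD f (- f) Df DN; rewrite subrr p0 pN //; lra.
have [g0|g0] := eqVneq g 0.
  have sW : subsp [set 0 : V] by split=> // a f h -> ->; rewrite scaler0 addr0.
  have [||||v [lv _ vp]] := @hahn_banach_extension D [set 0] p (fun=> 0) sD sW.
  - by move=> f ->; exact: (proj1 sD).
  - exact: sp.
  - by move=> a f h _ _; rewrite mulr0 addr0.
  - by move=> f ->; rewrite p0.
  exists v; split=> //; last exact: abs.
  by rewrite g0 p0 (rlinear0 sD lv).
pose W := [set f | exists a, f = a *: g].
have sW : subsp W.
  split=> [|a _ _ [b ->] [c ->]]; first by exists 0; rewrite scale0r.
  by exists (a * b + c); rewrite scalerDl scalerA.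
pose u f := xget 0 [set a | f = a *: g] * p g.
have uE a : u (a *: g) = a * p g.
  rewrite /u; case: xgetP => [b _ /= /eqP|/(_ a) []//].
  by rewrite -subr_eq0 -scalerBl scaler_eq0 (negbTE g0) orbF subr_eq0 => /eqP ->.
have [||||v [lv vu vp]] := @hahn_banach_extension D W p u sD sW.
- by move=> _ [b ->]; exact: subspZ.
- exact: sp.
- move=> x _ _ [b ->] [c ->]; rewrite scalerA -scalerDl !uE; ring.
- move=> _ [x ->]; rewrite uE.
  have [a0|a0|->] := ltgtP x 0; last by rewrite mul0r scale0r p0.
    apply: le_trans (_ : 0 <= _); first by rewrite mulr_le0_ge0 ?pge0 // ltW.
    by apply: pge0; exact: subspZ.
  by rewrite pZ.
exists v; split=> //; last exact: abs.
have Wg : W g by exists 1; rewrite scale1r.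
by rewrite vu // -[X in u X]scale1r uE mul1r.
Qed.

Lemma hahn_banach_norm D W p u : subsp D -> subsp W -> W `<=` D ->
  sublinear D p -> (forall f, D f -> p (- f) = p f) -> rlinear W u ->
  (forall f, W f -> `|u f| <= p f) ->
  exists v, [/\ rlinear D v, forall f, W f -> v f = u f &
    forall f, D f -> `|v f| <= p f].
Proof.
move=> sD sW WD sp pN lu up.
have [v [lv vu vp]] := hahn_banach_extension sD sW WD sp lu
  (fun f Wf => le_trans (ler_norm _) (up f Wf)).
exists v; split=> // f Df; rewrite ler_norml vp // andbT lerNl.
have DN : D (- f) by rewrite -scaleN1r; exact: subspZ.
by rewrite -(mulN1r (v f)) -(rlinearZ (-1) sD lv Df) scaleN1r -pN //; exact: vp.
Qed.

End HahnBanach.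

Section Ultralimit.
Context {R : realType}.
Variable FF : set_system nat.
Hypothesis UF : UltraFilter FF.

Lemma bounded_ulim (x : nat -> R) A : (forall j, `|x j| <= A) ->
  exists l, forall e, 0 < e -> \forall j \near FF, `|x j - l| <= e.
Proof.
move=> xA; have cI : compact (`[- A, A]%classic : set R) by exact: segment_compact.
have FI : (x @ FF) `[- A, A]%classic.
  have : FF (x @^-1` `[- A, A]%classic); last exact.
  by apply: filterE => j /=; rewrite in_itv /= -ler_norml; exact: xA.
have [l [_ xl]] := cI _ _ FI.
exists l => e e0; have [//|nF] := in_ultra_setVsetC [set j | `|x j - l| <= e] UF.
have nb : nbhs l (ball l e) by exact: nbhsx_ballx.
have Fn : (x @ FF) [set t | ~ (`|t - l| <= e)] by exact: nF.
have [t [/= nt]] := xl _ _ Fn nb.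
by rewrite /ball /= distrC => /ltW.
Qed.

Context {V : lmodType R}.
Implicit Types (D : set V).

(** One ultrafilter gives the limit at all vectors simultaneously, as a weak-star compactness
    theorem would, with no diagonal extraction. *)
Lemma ulim_functional D (u : nat -> V -> R) : subsp D ->
  (forall j, rlinear D (u j)) -> (forall f, D f -> exists A, forall j, `|u j f| <= A) ->
  exists2 v, rlinear D v & forall f, D f -> forall e, 0 < e ->
    \forall j \near FF, `|u j f - v f| <= e.
Proof.
move=> sD lu bu.
have L f : exists l, D f -> forall e, 0 < e -> \forall j \near FF, `|u j f - l| <= e.
  have [Df|nDf] := pselect (D f); last by exists 0.
  by have [A /bounded_ulim[l Hl]] := bu f Df; exists l.
have [v Hv] := choice L; exists v; last by move=> f Df; exact: Hv.
move=> a f g Df Dg; apply/eqP; rewrite -subr_eq0 -normr_le0.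
apply/ler_addgt0Pr => e e0; rewrite add0r.
have d0 : 0 < e / (`|a| + 2) by rewrite divr_gt0 // ltr_wpDl.
have Dfg : D (a *: f + g) by case: sD => _; exact.
have [j [[h1 h2] h3]] := filter_ex (filterI (filterI (Hv f Df _ d0) (Hv g Dg _ d0))
  (Hv _ Dfg _ d0)).
have := lu j a f g Df Dg => E.
have -> : v (a *: f + g) - (a * v f + v g) = a * (u j f - v f) + ((u j g - v g)
   + - (u j (a *: f + g) - v (a *: f + g))) by rewrite E; ring.
apply: le_trans (ler_normD _ _) _; rewrite normrM.
apply: le_trans (lerD (ler_wpM2l (normr_ge0 a) h1)
  (le_trans (ler_normD _ _) (lerD h2 _))) _; first by rewrite normrN; exact: h3.
rewrite le_eqVlt; apply/orP; left; apply/eqP; field.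
by rewrite gt_eqF // ltr_wpDl.
Qed.

Lemma ulim_le (x : nat -> R) l c : (forall e, 0 < e -> \forall j \near FF, `|x j - l| <= e) ->
  (\forall j \near FF, `|x j| <= c) -> `|l| <= c.
Proof.
move=> xl xc; apply/ler_addgt0Pr => e e0.
have [j [h1 h2]] := filter_ex (filterI (xl e e0) xc).
rewrite -[l](subrK (x j)); apply: le_trans (ler_normD _ _) _.
by rewrite addrC lerD // distrC.
Qed.

Lemma ulim_ge (x : nat -> R) l c : (forall e, 0 < e -> \forall j \near FF, `|x j - l| <= e) ->
  (\forall j \near FF, c <= `|x j|) -> c <= `|l|.
Proof.
move=> xl xc; apply/ler_addgt0Pr => e e0.
have [j [h1 h2]] := filter_ex (filterI (xl e e0) xc).
apply: le_trans h2 _; have := ler_normD (x j - l) l; rewrite subrK.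
move: h1 => /=; lra.
Qed.

End Ultralimit.

Lemma ultrafilter_nat : exists FF : set_system nat,
  UltraFilter FF /\ forall N, FF [set j | (N <= j)%N].
Proof.
have [G [UG oG]] := ultraFilterLemma (eventually_filter : ProperFilter \oo).
exists G; split=> // N; apply: oG; exact: nbhs_infty_ge.
Qed.

Section UniformBoundedness.
Context {R : realType} {V : lmodType R}.
Variables (D : set V) (Cn : set (V * R)) (q : nat -> V -> R).
Hypotheses (sD : subsp D) (CD : forall x, Cn x -> D x.1).
Hypothesis Cb : forall f, D f -> exists c, Cn (f, c).
Hypothesis q0 : forall j f, D f -> 0 <= q j f.
Hypothesis qS : forall j k f, D f -> (j <= k)%N -> q j f <= q k f.

(** A pair [(f, c)] in [Cn] is a constraint on the size of [u f]. The set of forms obeying all of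
    them is pointwise bounded, and stable under ultralimits and under combinations whose
    coefficients have total modulus at most 1. *)
Definition polar (u : V -> R) := rlinear D u /\ forall x, Cn x -> `|u x.1| <= x.2.

(* Gliding hump: a signed series [\sum +- 4^-(j+1) u_j], each sign being
   chosen so that the partial sum stays large at [phi_j]. *)
Lemma polar_uniform_bound :
  (forall u, polar u -> exists M c, forall f, D f -> `|u f| <= c * q M f) ->
  exists M C, 0 < C /\ forall u, polar u -> forall f, D f -> `|u f| <= C * q M f.
Proof.
move=> Hpt; apply: contrapT => Hn.
have cge0 f c u : polar u -> Cn (f, c) -> 0 <= c.
  by move=> [_ Pu] Cf; apply: le_trans (Pu _ Cf).
(* At a vector violating the bound with a constant growing like [4 ^+ j], the form is chosen within
   a factor 2 of the supremum over the whole polar (which halves 24 to 12). So the later terms of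
   the series at [phi j] are controlled by [u j (phi j)] itself. *)
have H1 (j : nat) : exists uf : (V -> R) * V, [/\ polar uf.1, D uf.2,
    12 * 4 ^+ j * j.+1%:R * q j uf.2 < `|uf.1 uf.2| &
    forall u, polar u -> `|u uf.2| <= 2 * `|uf.1 uf.2| ].
  have [[u f] [Pu Df uf]] : exists uf : (V -> R) * V, [/\ polar uf.1, D uf.2 &
      24 * 4 ^+ j * j.+1%:R * q j uf.2 < `|uf.1 uf.2| ].
    apply: contrapT => nx; apply: Hn; exists j, (24 * 4 ^+ j * j.+1%:R).
    split=> [|u Pu f Df]; first by rewrite !mulr_gt0 // exprn_gt0.
    by rewrite leNgt; apply/negP => uf; apply: nx; exists (u, f).
  rewrite /= in uf Df Pu *; have [c Cf] := Cb Df.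
  pose S := [set t | exists2 w, polar w & t = `|w f|].
  have S0 : S !=set0 by exists `|u f|; exists u.
  have hS : has_ubound S by exists c => _ [w [_ Pw] ->]; exact: (Pw _ Cf).
  have uS : `|u f| <= sup S by apply: ub_le_sup => //; exists u.
  have qf : 0 <= 24 * 4 ^+ j * j.+1%:R * q j f by rewrite !mulr_ge0 ?exprn_ge0 ?q0.
  have sS : 0 < sup S by apply: lt_le_trans uS; exact: le_lt_trans uf.
  have [|_ [w Pw ->] wS] := @sup_adherent _ S (sup S / 2) (divr_gt0 sS _) (conj S0 hS).
    by [].
  have ws : sup S <= 2 * `|w f| by move: wS; lra.
  exists (w, f); split=> //=; last first.
    by move=> v Pv; apply: le_trans ws; apply: ub_le_sup => //; exists v.
  have := lt_le_trans uf (le_trans uS ws).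
  have -> : 24 * 4 ^+ j * j.+1%:R * q j f = 2 * (12 * 4 ^+ j * j.+1%:R * q j f) by ring.
  by rewrite ltr_pM2l.
have [uf Huf] := choice H1.
pose u j := (uf j).1; pose phi j := (uf j).2.
pose c4 j : R := 4^-1 ^+ j.+1.
have c40 j : 0 < c4 j by rewrite exprn_gt0 // invr_gt0.
(* Of [S + c4 j * u j] and [S - c4 j * u j], at least one has modulus at [phi j] no smaller than
   that of the added term. *)
pose step (S : V -> R) j : V -> R :=
  if c4 j * `|u j (phi j)| <= `|S (phi j) + c4 j * u j (phi j)|
  then fun f => S f + c4 j * u j f else fun f => S f - c4 j * u j f.
pose S := fix S j := if j is k.+1 then step (S k) k else (fun=> 0) : V -> R.
have stepE T j f : exists2 e : R, `|e| <= c4 j & step T j f = T f + e * u j f.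
  rewrite /step; case: ifP => _.
    by exists (c4 j) => //; rewrite gtr0_norm.
  by exists (- c4 j); rewrite ?normrN ?gtr0_norm // mulNr.
have stepL T j : rlinear D T -> rlinear D (step T j).
  move=> lT a f g Df Dg; have lu : rlinear D (u j) by have [[? _] _ _ _] := Huf j.
  by rewrite /step; case: ifP => _; rewrite lT // lu //; ring.
have stepB T j : c4 j * `|u j (phi j)| <= `|step T j (phi j)|.
  rewrite /step; case: ifP => // /negbT; rewrite -ltNge => h.
  set a := T _ in h *; set b := u j _ in h *; have cj := c40 j.
  have : 2 * (c4 j * `|b|) <= `|a + c4 j * b| + `|a - c4 j * b|.
    have -> : 2 * (c4 j * `|b|) = `|(a + c4 j * b) - (a - c4 j * b)|.
      have -> : (a + c4 j * b) - (a - c4 j * b) = 2 * (c4 j * b) by ring.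
      by rewrite !normrM (gtr0_norm cj) ger0_norm.
    exact: ler_normB.
  lra.
have lS j : rlinear D (S j).
  elim: j => [|j IH] /=; last exact: stepL.
  by move=> a f g _ _; rewrite mulr0 addr0.
have tail f K : (forall j, `|u j f| <= K) -> forall j i,
    `|S (i + j)%N f - S j f| <= K * (4^-1 ^+ j - 4^-1 ^+ (i + j)) / 3.
  move=> uK j; elim=> [|i IH]; first by rewrite add0n !subrr normr0 mulr0 mul0r.
  have [e eC E] := stepE (S (i + j)%N) (i + j)%N f.
  rewrite addSn /= E addrAC; apply: le_trans (ler_normD _ _) _.
  have : `|e * u (i + j)%N f| <= c4 (i + j)%N * K by rewrite normrM; exact: ler_pM.
  rewrite /c4 (exprS _ (i + j)); move: IH.
  set p4 := 4^-1 ^+ (i + j); set p4' := 4^-1 ^+ j => h1 h2.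
  have -> : K * (p4' - 4^-1 * p4) / 3 = K * (p4' - p4) / 3 + 4^-1 * p4 * K by field.
  exact: lerD.
have tail' f K j i : (forall j, `|u j f| <= K) ->
    `|S (i + j)%N f - S j f| <= K * 4^-1 ^+ j / 3.
  move=> uK; apply: le_trans (tail f K uK j i) _.
  rewrite ler_pM2r ?invr_gt0 // ler_wpM2l ?gerBl ?exprn_ge0 //.
  exact: le_trans (uK 0%N).
have SP j x : Cn x -> `|S j x.1| <= x.2.
  case: x => f c Cf /=; have uc i : `|u i f| <= c by have [[_ Pu] _ _ _] := Huf i; exact: (Pu _ Cf).
  have := tail' f c 0%N j uc; rewrite addn0 /= subr0 expr0 mulr1 => /le_trans; apply.
  by rewrite ler_pdivrMr // ler_peMr //; [exact: le_trans (uc 0%N)|lra].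
have [FF [UF FN]] := ultrafilter_nat.
have [|v lv Hv] := ulim_functional UF sD lS.
  by move=> f /Cb[c Cf]; exists c => j; exact: (SP j _ Cf).
have Pv : polar v.
  split=> // x Cx; apply: (ulim_le UF (Hv _ (CD Cx))).
  by apply: filterE => j; exact: SP.
(* The terms after [j] contribute at [phi j] at most a third of [c4 j] times [2 * |u j (phi j)|], so
   one third of the [j]-th term survives in the limit. *)
have low j : 3^-1 * (c4 j * `|u j (phi j)|) <= `|v (phi j)|.
  have [_ Dj _ uj] := Huf j.
  apply: (ulim_ge UF (Hv _ Dj)); apply: filterS (FN j.+1) => i /= ji.
  have := tail' (phi j) (2 * `|u j (phi j)|) j.+1 (i - j.+1)%N.
  rewrite subnK //; move=> /(_ _)H.
  have {}H := H (fun k => uj (u k) (let: And4 a _ _ _ := Huf k in a)).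
  have sB := stepB (S j) j; rewrite -/(S j.+1) in sB.
  have := ler_normD (S i (phi j)) (S j.+1 (phi j) - S i (phi j)).
  rewrite addrC subrK [`|_ - S i _|]distrC; move: H sB; rewrite -/(c4 j).
  lra.
have [M [c Hc]] := Hpt v Pv.
(* Large enough for [q M <= q j] and [|c| <= j.+1]. The factor 12 cancels the [3^-1] of [low] and
   one 4 of [c4 j], leaving exactly [j.+1 * q j]. *)
pose j := (M + (Num.truncn `|c|).+1)%N.
have [_ Dj bj _] := Huf j; rewrite -/(u j) -/(phi j) in Dj bj.
have qj0 := q0 j Dj.
have h1 : `|v (phi j)| <= `|c| * q j (phi j).
  apply: le_trans (Hc _ Dj) _; apply: le_trans (_ : `|c| * q M (phi j) <= _).
    by rewrite ler_wpM2r ?q0 // ler_norm.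
  by rewrite ler_wpM2l // qS // /j leq_addr.
have h2 : 3^-1 * (c4 j * (12 * 4 ^+ j * j.+1%:R * q j (phi j))) < `|v (phi j)|.
  by apply: lt_le_trans (low j); rewrite ltr_pM2l ?invr_gt0 // ltr_pM2l.
have h3 : 3^-1 * (c4 j * (12 * 4 ^+ j * j.+1%:R * q j (phi j))) = j.+1%:R * q j (phi j).
  rewrite /c4 exprS exprVn; field.
  by rewrite expf_neq0.
have cj : `|c| <= j.+1%:R.
  apply: ltW; apply: lt_le_trans (truncnS_gt _) _; rewrite ler_nat.
  by rewrite ltnW // ltnS /j leq_addl.
have := ler_wpM2r qj0 cj; rewrite h3 in h2; move: (lt_le_trans h2 h1).
by move=> a b; have := lt_le_trans a b; rewrite ltxx.
Qed.

End UniformBoundedness.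

(** * Seminorms on test functions *)

Section Seminorms.
Context {R : realType} {n : nat}.
Local Notation E := 'rV[R]_n.
Local Notation C := R[i].
Local Notation V := (E -> Rcomplex R).
Implicit Types (f g phi psi : E -> C) (w : seq 'I_n) (x : E) (r A : R) (N M : nat)
  (om : nat -> R).
Variable x0 : E.

(* Complex valued functions as a real vector space: the functionals to which
   Hahn-Banach is applied are real valued and real linear. *)
Lemma rscaleE (a : R) f : (a *: (f : V)) = (fun x => a%:C * f x) :> V.
Proof.
apply/funext => x; have -> : (a *: (f : V)) x = a *: (f x : Rcomplex R) by [].
case: (f x) => p q; apply/eqP; rewrite eq_complex /=.
by rewrite !mul0r subr0 addr0 !eqxx.
Qed.

Lemma rlinE (a : R) f g : (a *: (f : V) + (g : V)) = (fun x => a%:C * f x + g x) :> V.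
Proof. by rewrite rscaleE. Qed.

(* [sup] is [0] on unbounded sets, so [wsemi] is a seminorm only on [wbounded]
   functions. *)
Definition wsemi om r f : R :=
  sup [set t | exists w x, cbox x0 r x /\ t = om (size w) * cmod (pw w f x)].

Definition wbounded om r f :=
  exists A, forall w x, cbox x0 r x -> om (size w) * cmod (pw w f x) <= A.

Lemma wsemi_ge om r f w x : wbounded om r f -> cbox x0 r x ->
  om (size w) * cmod (pw w f x) <= wsemi om r f.
Proof.
move=> [A HA] xr; apply: ub_le_sup; last by exists w, x.
by exists A => _ [w' [x' [xr' ->]]]; exact: HA.
Qed.

Lemma wsemi_le om r f A : 0 <= r ->
  (forall w x, cbox x0 r x -> om (size w) * cmod (pw w f x) <= A) ->
  wsemi om r f <= A.
Proof.
move=> r0 H; apply: ge_sup; last by move=> _ [w [x [xr ->]]]; exact: H.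
by exists (om 0%N * cmod (f x0)); exists [::], x0; split=> //; exact: cbox_center.
Qed.

(** A truncating weight gives the C^N seminorm on the box; the inverse power of the factorial in
    [star] gives the Gevrey seminorm with [h = 1]. *)
Definition pN N r f := wsemi (fun k => (k <= N)%N%:R) r f.
Definition star (s : R) r f := wsemi (fun k => (k`!%:R `^ s)^-1) r f.

Lemma pN_bounded N r f : smooth setT f -> wbounded (fun k => (k <= N)%N%:R) r f.
Proof.
move=> sf; have [A A0 HA] := smooth_bounded N sf (@cbox_compact _ _ x0 r) (fun _ _ => I).
exists A => w x xr; case: leqP => wN; last by rewrite mul0r.
by rewrite mul1r; exact: HA.
Qed.

Lemma pN_ge N r f w x : smooth setT f -> (size w <= N)%N -> cbox x0 r x ->
  cmod (pw w f x) <= pN N r f.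
Proof.
by move=> sf wN xr; have := wsemi_ge w (pN_bounded N r sf) xr; rewrite wN mul1r.
Qed.

Lemma pN_le N r f A : 0 <= r -> 0 <= A ->
  (forall w x, (size w <= N)%N -> cbox x0 r x -> cmod (pw w f x) <= A) ->
  pN N r f <= A.
Proof.
move=> r0 A0 H; apply: wsemi_le => // w x xr; case: leqP => wN; last by rewrite mul0r.
by rewrite mul1r; exact: H.
Qed.

Lemma pN_ge0 N r f : 0 <= r -> smooth setT f -> 0 <= pN N r f.
Proof.
move=> r0 sf; apply: le_trans (cmod_ge0 (f x0)) _.
exact: (pN_ge (w := [::]) sf (leq0n _) (cbox_center _ r0)).
Qed.

Lemma pN_mono N N' r r' f : 0 <= r -> (N <= N')%N -> r <= r' -> smooth setT f ->
  pN N r f <= pN N' r' f.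
Proof.
move=> r0 NN rr sf; apply: pN_le => //; first by rewrite pN_ge0 // (le_trans r0).
move=> w x wN xr; apply: pN_ge => //; first exact: leq_trans NN.
exact: subset_cbox xr.
Qed.

Lemma pND N r f g : 0 <= r -> smooth setT f -> smooth setT g ->
  pN N r (fun x => f x + g x) <= pN N r f + pN N r g.
Proof.
move=> r0 sf sg; apply: pN_le => //; first by rewrite addr_ge0 ?pN_ge0.
move=> w x wN xr; rewrite (pwD w openT sf sg I); apply: le_trans (cmodD _ _) _.
by apply: lerD; exact: pN_ge.
Qed.

Lemma pNZ_le N r (c : C) f : 0 <= r -> smooth setT f ->
  pN N r (fun x => c * f x) <= cmod c * pN N r f.
Proof.
move=> r0 sf; apply: pN_le => //; first by rewrite mulr_ge0 ?cmod_ge0 ?pN_ge0.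
move=> w x wN xr; rewrite (pwZ w c openT sf I) cmodM ler_wpM2l ?cmod_ge0 //.
exact: pN_ge.
Qed.

Lemma pN_eq0 N r r' f : r < r' -> 0 <= r ->
  (forall x, obox x0 r' x -> f x = 0) -> pN N r f <= 0.
Proof.
move=> rr r0 f0; apply: pN_le => // w x _ xr.
rewrite (eq_pw (@obox_open _ _ x0 r') w (g := fun=> 0)) ?pw_cst0 ?cmod0 //.
exact: cbox_obox xr.
Qed.

Lemma star_eq0 s r r' f : r < r' -> 0 <= r ->
  (forall x, obox x0 r' x -> f x = 0) -> star s r f <= 0.
Proof.
move=> rr r0 f0; apply: wsemi_le => // w x xr.
rewrite (eq_pw (@obox_open _ _ x0 r') w (g := fun=> 0)) ?pw_cst0 ?cmod0 ?mulr0 //.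
exact: cbox_obox xr.
Qed.

Section Gevrey.
Variables (Om : set E) (s : R).
Hypotheses (oOm : open Om) (s1 : 1 < s).
Let s0 : 0 <= s. Proof. by rewrite (le_trans _ (ltW s1)). Qed.

Definition TF := gevrey_test_fun s Om.

Lemma TF_test phi : TF phi -> test_fun Om phi. Proof. by case. Qed.
Lemma TF_gevrey phi : TF phi -> gevrey s Om phi. Proof. by case. Qed.
Lemma TF_smooth phi : TF phi -> smooth setT phi. Proof. by case=> /test_fun_smooth. Qed.

Lemma star_bounded r f : cbox x0 r `<=` Om -> gevrey s Om f ->
  wbounded (fun k => (k`!%:R `^ s)^-1) r f.
Proof.
move=> rO /(gevreyP _ _ oOm)[sf H].
have [c c0 Hc] := H _ (@cbox_compact _ _ x0 r) rO 1 ltr01.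
exists c => w x xr; have f0 : 0 < (size w)`!%:R `^ s :> R.
  by rewrite powR_gt0 // ltr0n fact_gt0.
rewrite ler_pdivrMl // mulrC.
by have := Hc w x xr; rewrite /gevrey_weight expr1n mul1r.
Qed.

Lemma star_ge r f w x : cbox x0 r `<=` Om -> gevrey s Om f -> cbox x0 r x ->
  cmod (pw w f x) <= (size w)`!%:R `^ s * star s r f.
Proof.
move=> rO gf xr; have f0 : 0 < (size w)`!%:R `^ s :> R.
  by rewrite powR_gt0 // ltr0n fact_gt0.
by rewrite -ler_pdivrMl //; exact: wsemi_ge (star_bounded rO gf) xr.
Qed.

Lemma star_le r f A : 0 <= r ->
  (forall w x, cbox x0 r x -> cmod (pw w f x) <= (size w)`!%:R `^ s * A) ->
  star s r f <= A.
Proof.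
move=> r0 H; apply: wsemi_le => // w x xr.
by rewrite ler_pdivrMl ?powR_gt0 ?ltr0n ?fact_gt0 //; exact: H.
Qed.

Lemma star_ge0 r f : 0 <= r -> cbox x0 r `<=` Om -> gevrey s Om f -> 0 <= star s r f.
Proof.
move=> r0 rO gf; have := star_ge [::] rO gf (cbox_center x0 r0).
rewrite fact0 powR1 mul1r; exact/le_trans/cmod_ge0.
Qed.

Lemma star_mono r r' f : 0 <= r -> r <= r' -> cbox x0 r' `<=` Om -> gevrey s Om f ->
  star s r f <= star s r' f.
Proof.
move=> r0 rr rO gf; apply: star_le => // w x xr.
by apply: star_ge => //; exact: subset_cbox xr.
Qed.

Lemma starZ_le r (c : C) f : 0 <= r -> cbox x0 r `<=` Om -> gevrey s Om f ->
  star s r (fun x => c * f x) <= cmod c * star s r f.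
Proof.
move=> r0 rO gf; apply: star_le => // w x xr.
rewrite (pwZ w c oOm (gevrey_smooth gf) (rO _ xr)) cmodM mulrCA.
by rewrite ler_wpM2l ?cmod_ge0 //; exact: star_ge.
Qed.

Lemma pN_star N r f : 0 <= r -> cbox x0 r `<=` Om -> gevrey s Om f ->
  pN N r f <= N`!%:R `^ s * star s r f.
Proof.
move=> r0 rO gf; apply: pN_le => //; first by rewrite mulr_ge0 ?powR_ge0 ?star_ge0.
move=> w x wN xr; apply: le_trans (star_ge w rO gf xr) _.
rewrite ler_wpM2r ?star_ge0 //; apply: ge0_ler_powR; rewrite ?nnegrE //.
by rewrite ler_nat leq_fact.
Qed.

Lemma TF_lin (c : C) phi psi : TF phi -> TF psi -> TF (fun x => c * phi x + psi x).
Proof.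
move=> [tp gp] [ts gs]; split; first exact: (test_funD (test_funZ c tp) ts).
exact: (gevreyD oOm (gevreyZ s0 c oOm gp) gs).
Qed.

Lemma TF0 : TF (fun=> 0).
Proof. by split; [exact: test_fun0|exact: gevrey_cst]. Qed.

Lemma TFM f phi : gevrey s Om f -> TF phi -> TF (fun x => f x * phi x).
Proof.
move=> gf [tp gp]; split; last exact: (gevreyM s0 oOm gf gp).
exact: (test_funM oOm (gevrey_smooth gf) tp).
Qed.

Lemma TF_pw w phi : TF phi -> TF (pw w phi).
Proof.
by move=> [tp gp]; split; [exact: test_fun_pw|exact: gevrey_pw].
Qed.

Lemma subsp_TF : subsp (TF : set V).
Proof.
split=> [|a f g Ff Fg]; first exact: TF0.
by rewrite rlinE; exact: TF_lin.
Qed.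

Lemma subsp_test : subsp (test_fun Om : set V).
Proof.
split=> [|a f g Ff Fg]; first exact: test_fun0.
by rewrite rlinE; exact: (test_funD (test_funZ _ Ff) Fg).
Qed.

Lemma pN_sublinear N r : 0 <= r -> sublinear (test_fun Om : set V) (pN N r).
Proof.
move=> r0; split=> [f g Df Dg|a f a0 Df|].
- exact: (pND N r0 (test_fun_smooth Df) (test_fun_smooth Dg)).
- have sf := test_fun_smooth Df; have aC : cmod (a%:C : C) = a.
    by rewrite cmod_real gtr0_norm.
  rewrite rscaleE; apply/eqP; rewrite eq_le; apply/andP; split.
    by have := pNZ_le N a%:C r0 sf; rewrite aC.
  have := pNZ_le N (a^-1)%:C r0 (smoothZ a%:C openT sf).
  rewrite cmod_real gtr0_norm ?invr_gt0 // mulrC ler_pdivlMr // mulrC.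
  congr (_ * pN _ _ _ <= _); apply/funext => x.
  by rewrite mulrA -rmorphM /= mulVf ?mul1r // gt_eqF.
- have -> : (0 : V) = (fun=> 0) by [].
  apply/eqP; rewrite eq_le; apply/andP; split.
    by apply: pN_le => // w x _ _; rewrite pw_cst0 cmod0.
  exact: (pN_ge0 N r0 (smooth_cst _ _)).
Qed.

Lemma pN_opp N r f : 0 <= r -> smooth setT f -> pN N r (fun x => - f x) = pN N r f.
Proof.
move=> r0 sf; have le g : smooth setT g -> pN N r (fun x => - g x) <= pN N r g.
  move=> sg; have := pNZ_le N (-1) r0 sg; rewrite cmodN cmod1 mul1r.
  by under eq_fun do rewrite mulN1r.
apply/eqP; rewrite eq_le le //=.
have sN : smooth setT (fun x => - f x).
  by apply: (eq_smooth openT _ (smoothZ (-1) openT sf)) => x _; rewrite mulN1r.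
by have := le _ sN; under eq_fun do rewrite opprK.
Qed.

End Gevrey.
End Seminorms.

(** * Complex forms, and bounds for the transposed operator *)

Section Complexification.
Context {R : realType} {n : nat}.
Local Notation E := 'rV[R]_n.
Local Notation C := R[i].
Local Notation V := (E -> Rcomplex R).
Local Notation ii := (0 +i* 1 : C).
Implicit Types (f g phi psi : E -> C) (u : (E -> C) -> R) (U : (E -> C) -> C).

Lemma cmod_ii : cmod ii = 1.
Proof. by rewrite /cmod /= expr0n expr1n add0r sqrtr1. Qed.

Variable D : (E -> C) -> Prop.
Definition clinear := D (fun=> 0) /\
  forall (c : C) phi psi, D phi -> D psi -> D (fun x => c * phi x + psi x).
Hypothesis cD : clinear.

Lemma clinear_subsp : subsp (D : set V).
Proof. by case: cD => D0 DL; split=> // a f g Df Dg; rewrite rlinE; exact: DL. Qed.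

Lemma clinearZ c phi : D phi -> D (fun x => c * phi x).
Proof.
case: cD => D0 DL Dp; have := DL c _ _ Dp D0.
by under eq_fun do rewrite addr0.
Qed.

Lemma clinearB phi psi : D phi -> D psi -> D (fun x => phi x - psi x).
Proof.
case: cD => D0 DL Dp Ds; have := DL (-1) _ _ Ds Dp.
by congr D; apply/funext => x; rewrite mulN1r addrC.
Qed.

Lemma clinear_sum (J : Type) (r : seq J) (Q : pred J) (F : J -> E -> C) c :
  (forall j, Q j -> D (F j)) -> D (fun x => \sum_(j <- r | Q j) c j * F j x).
Proof.
case: cD => D0 DL DF; elim: r => [|j r IH].
  by under eq_fun do rewrite big_nil.
under eq_fun do rewrite big_cons.
by case Qj: (Q j) => //; apply: DL => //; exact: DF.
Qed.

Lemma linear_form0 U : linear_form D U -> U (fun=> 0) = 0.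
Proof.
case: cD => D0 _ lU; have := lU 1 _ _ D0 D0.
rewrite (_ : (fun _ : E => 1 * (0 : C) + 0) = fun=> 0); last first.
  by apply/funext => x; rewrite mulr0 addr0.
rewrite mul1r.
by move/eqP; rewrite -subr_eq subrr => /eqP <-.
Qed.

Lemma linear_form_sum U (J : Type) (r : seq J) (Q : pred J) (F : J -> E -> C) c :
  linear_form D U -> (forall j, Q j -> D (F j)) ->
  U (fun x => \sum_(j <- r | Q j) c j * F j x) = \sum_(j <- r | Q j) c j * U (F j).
Proof.
move=> lU DF; elim: r => [|j r IH].
  rewrite big_nil (_ : (fun x => _) = fun=> 0) ?linear_form0 //.
  by apply/funext => x; rewrite big_nil.
rewrite big_cons (_ : (fun x => _) = (fun x => if Q j then c j * F j x +
   \sum_(j <- r | Q j) c j * F j x else \sum_(j <- r | Q j) c j * F j x)); last first.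
  by apply/funext => x; rewrite big_cons.
case Qj: (Q j) => //; rewrite lU ?IH //; first exact: DF.
exact: clinear_sum.
Qed.

(* The complex linear form with real part [u]. *)
Definition complexify u : (E -> C) -> C :=
  fun phi => u phi +i* (- u (fun x => ii * phi x)).

Lemma complexify_linear u : rlinear (D : set V) u -> linear_form D (complexify u).
Proof.
move=> lu [a b] phi psi Dp Ds; have Dip := clinearZ ii Dp; have Dis := clinearZ ii Ds.
have [_ DL] := cD.
have L (x y : R) f g h k : D f -> D g -> D h ->
    (forall t, k t = x%:C * f t + (y%:C * g t + h t)) ->
    u k = x * u f + (y * u g + u h).
  move=> Df Dg Dh kE.
  have -> : k = (x *: (f : V) + (y *: (g : V) + (h : V)) : V).
    by apply/funext => t; rewrite kE !rscaleE.
  by rewrite lu ?lu //; have [_ SL] := clinear_subsp; exact: SL.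
have e1 : u (fun x => (a +i* b) * phi x + psi x) =
    a * u phi + (b * u (fun x => ii * phi x) + u psi).
  apply: L => // t; apply/eqP; rewrite eq_complex; case: (phi t) (psi t) => [p q] [p' q'].
  by apply/andP; split; apply/eqP; rewrite /=; ring.
have e2 : u (fun x => ii * ((a +i* b) * phi x + psi x)) =
    a * u (fun x => ii * phi x) + (- b * u phi + u (fun x => ii * psi x)).
  apply: L => // t; apply/eqP; rewrite eq_complex; case: (phi t) (psi t) => [p q] [p' q'].
  by apply/andP; split; apply/eqP; rewrite /=; ring.
rewrite /complexify e1 e2; apply/eqP; rewrite eq_complex.
by apply/andP; split; apply/eqP; rewrite /=; ring.
Qed.

Lemma complexify_bound u phi A : `|u phi| <= A -> `|u (fun x => ii * phi x)| <= A ->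
  cmod (complexify u phi) <= 2 * A.
Proof.
move=> h1 h2; have -> : 2 * A = A + A by ring.
by apply: cmod_le2 => //=; rewrite normrN.
Qed.

Lemma complexify_ge u phi : `|u phi| <= cmod (complexify u phi).
Proof. exact: (cmod_Re (complexify u phi)). Qed.

Lemma complexify_eq0 u phi : u phi = 0 -> u (fun x => ii * phi x) = 0 ->
  complexify u phi = 0.
Proof. by rewrite /complexify => -> ->; rewrite oppr0. Qed.

Lemma pdo_form_transpose (P : pdo R n) U phi : linear_form D U ->
  (forall a, (mabs a <= pdo_order P)%N -> D (dpart a (fun y => pdo_coef P a y * phi y))) ->
  pdo_form P U phi = U (transpose P phi).
Proof.
move=> lU DF; rewrite /pdo_form /transpose /pdo_sum /mul_form /dpart_form.
by rewrite (linear_form_sum _ _ lU) // => b; exact: DF.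
Qed.

End Complexification.

Section TransposeBounds.
Context {R : realType} {n : nat}.
Local Notation E := 'rV[R]_n.
Local Notation C := R[i].
Local Notation V := (E -> Rcomplex R).
Implicit Types (f g phi psi : E -> C) (r A : R) (N M : nat).
Variables (Om : set E) (s : R) (P : pdo R n).
Hypotheses (oOm : open Om) (s1 : 1 < s) (gP : coefs_in (gevrey s Om) P).

Lemma coefs_smooth : coefs_in (smooth Om) P.
Proof. by move=> a aP; exact: gevrey_smooth (gP aP). Qed.

Lemma clinear_TF : clinear (TF Om s).
Proof. by split=> [|c phi psi]; [exact: TF0|exact: TF_lin]. Qed.

Lemma clinear_test : clinear (test_fun Om).
Proof.
split=> [|c phi psi tp ts]; first exact: test_fun0.
exact: (test_funD (test_funZ c tp) ts).
Qed.

Lemma TF_transpose_term phi a : TF Om s phi -> (mabs a <= pdo_order P)%N ->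
  TF Om s (dpart a (fun y => pdo_coef P a y * phi y)).
Proof. by move=> tp aP; rewrite dpartE; apply: TF_pw => //; apply: TFM => //; exact: gP. Qed.

Lemma test_transpose_term phi a : test_fun Om phi -> (mabs a <= pdo_order P)%N ->
  test_fun Om (dpart a (fun y => pdo_coef P a y * phi y)).
Proof.
by move=> tp aP; rewrite dpartE; apply/test_fun_pw/(test_funM oOm) => //; exact: coefs_smooth.
Qed.

Lemma TF_transpose phi : TF Om s phi -> TF Om s (transpose P phi).
Proof.
move=> tp; apply: (clinear_sum clinear_TF) => b bP; exact: TF_transpose_term.
Qed.

Lemma transpose_lin c phi psi : test_fun Om phi -> test_fun Om psi ->
  transpose P (fun x => c * phi x + psi x) =
  (fun x => c * transpose P phi x + transpose P psi x).
Proof.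
move=> tp ts; apply/funext => x; rewrite /transpose /pdo_sum mulr_sumr -big_split.
apply: eq_bigr => b bP /=; rewrite !dpartE; set a := [ffun i => _].
have cs := coefs_smooth bP; rewrite -/a in cs.
have sp := test_fun_smooth (test_funM oOm cs tp).
have ss := test_fun_smooth (test_funM oOm cs ts).
have -> : (fun y => pdo_coef P a y * (c * phi y + psi y)) =
  (fun y => c * (pdo_coef P a y * phi y) + pdo_coef P a y * psi y).
  by apply/funext => y; ring.
by rewrite (pwZD (word a) c openT sp ss I); ring.
Qed.

Lemma transposeZ c phi : test_fun Om phi ->
  transpose P (fun x => c * phi x) = (fun x => c * transpose P phi x).
Proof.
move=> tp; have t0 := test_fun0 Om.
have T0 : transpose P (fun=> 0) = fun=> 0.
  apply/funext => x; rewrite /transpose /pdo_sum big1 // => b bP.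
  set a := [ffun i => _]; have -> : (fun y => pdo_coef P a y * 0) = fun=> 0.
    by apply/funext => y; rewrite mulr0.
  by rewrite dpartE pw_cst0 mulr0.
have := transpose_lin c tp t0; rewrite T0.
have K f : (fun x : E => c * f x + 0) = (fun x => c * f x).
  by apply/funext => x; rewrite addr0.
by rewrite !K.
Qed.

Variables (x0 : E) (R0 : R).
Hypothesis KO : cbox x0 R0 `<=` Om.

Lemma pN_mul_smooth f N : smooth Om f -> exists2 A, 0 <= A &
  forall r phi, 0 <= r <= R0 -> smooth setT phi -> forall w x, (size w <= N)%N ->
  cbox x0 r x -> cmod (pw w (fun y => f y * phi y) x) <= A * pN x0 N r phi.
Proof.
move=> sf; have [A A0 HA] := smooth_bounded N sf (@cbox_compact _ _ x0 R0) KO.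
exists (A * 2 ^+ N); first by rewrite mulr_ge0 ?exprn_ge0.
move=> r phi /andP[r0 rR] sp w x wN xr.
have xR := subset_cbox rR xr; have p0 := pN_ge0 x0 N r0 sp.
have := @leibniz_bound R n Om f phi x N A (pN x0 N r phi) (fun=> 1) oOm sf
  (subset_smooth (fun _ _ => I) sp) (KO xR) A0 p0 (fun=> ler01).
move=> /(_ _ _ _ w wN) H; apply: le_trans (H _ _ _) _ => {H}.
- by move=> k l _; rewrite mulr1.
- by move=> v vN; rewrite mulr1; exact: HA.
- by move=> v vN; rewrite mulr1; exact: pN_ge.
rewrite mulr1 mulrAC ler_wpM2r // ler_wpM2l //.
by rewrite ler_eXn2l // ltr1n.
Qed.

Lemma pN_transpose N : exists M A, 0 <= A /\ forall r phi, 0 <= r <= R0 ->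
  test_fun Om phi -> pN x0 N r (transpose P phi) <= A * pN x0 M r phi.
Proof.
pose M := (N + pdo_order P)%N; exists M.
pose idx (b : {ffun 'I_n -> 'I_(pdo_order P).+1}) : multi_index n := [ffun i => b i : nat].
have H b : exists A, 0 <= A /\ ((mabs (idx b) <= pdo_order P)%N ->
    forall r phi, 0 <= r <= R0 -> smooth setT phi -> forall w x, (size w <= M)%N ->
    cbox x0 r x ->
    cmod (pw w (fun y => pdo_coef P (idx b) y * phi y) x) <= A * pN x0 M r phi).
  case: (boolP (mabs (idx b) <= pdo_order P)%N) => bP; last by exists 0.
  by have [A A0 HA] := pN_mul_smooth M (coefs_smooth bP); exists A.
have [A HA] := choice H; exists (\sum_(b | (mabs (idx b) <= pdo_order P)%N) A b).
split; first by apply: sumr_ge0 => b _; case: (HA b).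
move=> r phi rR tp; have /andP[r0 _] := rR; have sp := test_fun_smooth tp.
have sT b : (mabs (idx b) <= pdo_order P)%N -> smooth setT
    (fun x => (-1) ^+ mabs (idx b) * dpart (idx b) (fun y => pdo_coef P (idx b) y * phi y) x).
  move=> bP; exact: (test_fun_smooth (test_funZ _ (test_transpose_term tp bP))).
apply: pN_le => //.
  by rewrite mulr_ge0 ?pN_ge0 // sumr_ge0 // => b _; case: (HA b).
move=> w x wN xr; rewrite (pw_sum w _ openT sT I) mulr_suml.
apply: le_trans (cmod_sum _ _ _) _; apply: ler_sum => b bP.
have sb := test_fun_smooth (test_transpose_term tp bP).
rewrite (pwZ w _ openT sb I) cmodM cmodX cmodN cmod1 expr1n mul1r dpartE -pw_cat.
have [_ /(_ bP)Hb] := HA b; apply: Hb => //.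
by rewrite size_cat size_word leq_add.
Qed.

(** The product vanishes off the box of radius [b < r1], so an estimate valid at every point of the
    space needs [phi] only on the box of radius [r1]. *)
Lemma cutoff_bound chi b r1 N : 0 <= r1 -> b < r1 -> smooth setT chi ->
  vanishes_off (cbox x0 b) chi -> exists2 A, 0 <= A &
  forall phi, smooth setT phi -> forall w x, (size w <= N)%N ->
    cmod (pw w (fun y => chi y * phi y) x) <= A * pN x0 N r1 phi.
Proof.
move=> r10 br sc c0.
have [A A0 HA] := smooth_bounded N sc (@cbox_compact _ _ x0 b) (fun _ _ => I).
exists (A * 2 ^+ N); first by rewrite mulr_ge0 ?exprn_ge0.
move=> phi sp w x wN; have p0 := pN_ge0 x0 N r10 sp.
have [xb|xb] := pselect (cbox x0 b x); last first.
  rewrite (vanish_pw w (@cbox_closed _ _ x0 b)) ?cmod0 ?mulr_ge0 ?exprn_ge0 //.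
  by move=> y /c0 ->; rewrite mul0r.
have xr := subset_cbox (ltW br) xb.
have := @leibniz_bound R n setT chi phi x N A (pN x0 N r1 phi) (fun=> 1) openT sc sp I
  A0 p0 (fun=> ler01).
move=> /(_ _ _ _ w wN) H; apply: le_trans (H _ _ _) _ => {H}.
- by move=> k l _; rewrite mulr1.
- by move=> v vN; rewrite mulr1; exact: HA.
- by move=> v vN; rewrite mulr1; exact: pN_ge.
rewrite mulr1 mulrAC ler_wpM2r // ler_wpM2l //.
by rewrite ler_eXn2l // ltr1n.
Qed.

End TransposeBounds.

(** * A priori estimates *)

Section Regularity.
Context {R : realType} {n : nat}.
Local Notation E := 'rV[R]_n.
Local Notation C := R[i].
Local Notation V := (E -> Rcomplex R).
Local Notation ii := (0 +i* 1 : C).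
Implicit Types (f g phi psi : E -> C) (r A c : R) (N M : nat) (u v : V -> R).
Variables (Om : set E) (s : R) (P : pdo R n) (x0 : E) (R0 : R).
Hypotheses (oOm : open Om) (s1 : 1 < s) (gP : coefs_in (gevrey s Om) P).
Hypothesis KO : cbox x0 R0 `<=` Om.
Local Notation F := (TF Om s).
Local Notation D := (test_fun Om).
Local Notation T := (transpose P).
Local Notation p := (pN x0).
Local Notation q := (star x0 s).
Let sF : subsp (F : set V). Proof. exact: subsp_TF. Qed.
Let cF : clinear F. Proof. exact: clinear_TF. Qed.

Lemma boxO r : r <= R0 -> cbox x0 r `<=` Om.
Proof. by move=> rR x /(subset_cbox rR)/KO. Qed.

Lemma star_le_weight r phi A : 0 <= r -> smooth setT phi ->
  (forall a x, cmod (dpart a phi x) <= A * gevrey_weight s 1 (mabs a)) -> q r phi <= A.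
Proof.
move=> r0 sp H; apply: star_le => // w x _; rewrite (pw_dpart w openT sp I).
by have := H (wcount w) x; rewrite mabs_wcount /gevrey_weight expr1n mul1r mulrC.
Qed.

Lemma pN_le_dpart N r phi A : 0 <= r -> smooth setT phi ->
  (forall a x, (mabs a <= N)%N -> cmod (dpart a phi x) <= A) -> p N r phi <= A.
Proof.
move=> r0 sp H; have A0 : 0 <= A.
  by apply: le_trans (cmod_ge0 _) (H (wcount [::]) x0 _); rewrite mabs_wcount.
apply: pN_le => // w x wN _; rewrite (pw_dpart w openT sp I).
by apply: H; rewrite mabs_wcount.
Qed.

Lemma star_ultradistribution u r : 0 <= r <= R0 -> rlinear (F : set V) u ->
  (forall f, F f -> `|u f| <= q r f) -> ultradistribution s Om (complexify u).
Proof.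
move=> /andP[r0 rR] lu ub; split; first exact: (complexify_linear cF lu).
move=> K cK KO'; exists 2, 1; split=> // phi tp _ A HA.
have qA := star_le_weight r0 (TF_smooth tp) HA.
apply: complexify_bound; first exact: le_trans (ub _ tp) qA.
apply: le_trans (ub _ (clinearZ cF _ tp)) _; apply: le_trans qA.
by have := starZ_le oOm ii r0 (boxO rR) (TF_gevrey tp); rewrite cmod_ii mul1r.
Qed.

Lemma pN_distribution v N r c : 0 <= r -> 0 < c -> rlinear (D : set V) v ->
  (forall f, D f -> `|v f| <= c * p N r f) -> distribution Om (complexify v).
Proof.
move=> r0 c0 lv vb; have cD := clinear_test Om; split; first exact: (complexify_linear cD lv).
move=> K cK KO'; exists (2 * c), N; split; first by rewrite mulr_gt0.
move=> phi tp _ A HA; have sp := test_fun_smooth tp.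
have pA := pN_le_dpart r0 sp HA; rewrite -mulrA.
apply: complexify_bound; first by apply: le_trans (vb _ tp) _; rewrite ler_pM2l.
apply: le_trans (vb _ (clinearZ cD _ tp)) _; rewrite ler_pM2l //; apply: le_trans pA.
by have := pNZ_le x0 N ii r0 sp; rewrite cmod_ii mul1r.
Qed.

Lemma complexify_transpose u phi : rlinear (F : set V) u -> F phi ->
  pdo_form P (complexify u) phi = complexify (fun f => u (T f)) phi.
Proof.
move=> lu tp; rewrite (pdo_form_transpose cF (complexify_linear cF lu)); last first.
  by move=> a; exact: TF_transpose_term.
by rewrite /complexify (transposeZ oOm gP _ (TF_test tp)).
Qed.

Lemma rlinear_transpose (W : set V) u : W `<=` D -> (forall f, W f -> W (T f)) ->
  rlinear W u -> rlinear W (fun f => u (T f)).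
Proof.
move=> WD WT lu a f g Wf Wg.
rewrite -lu; [|exact: WT|exact: WT]; rewrite !rlinE.
by rewrite (transpose_lin oOm gP a%:C (WD _ Wf) (WD _ Wg)).
Qed.

Lemma extend_pN (W : set V) u N r c : subsp W -> W `<=` D -> 0 <= r -> 0 < c ->
  rlinear W u -> (forall f, W f -> `|u f| <= c * p N r f) ->
  exists v, [/\ rlinear (D : set V) v, forall f, W f -> v f = u f &
    forall f, D f -> `|v f| <= c * p N r f].
Proof.
move=> sW WD r0 c0 lu ub.
have [pD pZ p0] := pN_sublinear x0 Om N r0.
apply: (@hahn_banach_norm R V D W (fun f => c * p N r f)) => //.
- exact: subsp_test.
- split=> [f g Df Dg|a f a0 Df|]; first by rewrite -mulrDr ler_pM2l // pD.
    by rewrite pZ // mulrCA.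
  by rewrite p0 mulr0.
- by move=> f Df; congr (c * _); exact: (pN_opp x0 N r0 (test_fun_smooth Df)).
Qed.

(** The form is carried by the closed box of radius [r]: it sees only the behaviour of a function
    near this box, and is thus insensitive to cutoffs equal to 1 there. *)
Definition local_form (W : set V) u r := forall a f g, r < a -> W f -> W g ->
  (forall x, obox x0 a x -> f x = g x) -> u f = u g.

Lemma local_bound (W : set V) u r c (pp : V -> R) : subsp W -> 0 <= c ->
  (forall f a, r < a -> (forall x, obox x0 a x -> f x = 0) -> pp f <= 0) ->
  rlinear W u -> (forall f, W f -> `|u f| <= c * pp f) -> local_form W u r.
Proof.
move=> sW c0 pp0 lu ub a f g ra Wf Wg fg; apply/eqP; rewrite -subr_eq0 -normr_le0.
rewrite -(rlinearB sW lu Wf Wg); apply: le_trans (ub _ (subspB sW Wf Wg)) _.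
rewrite mulr_ge0_le0 //; apply: (pp0 _ a ra) => x xa.
by have := fg x xa => e; rewrite -[LHS]/(f x - g x) e subrr.
Qed.

Lemma local_star u r c : 0 <= r -> 0 <= c -> rlinear (F : set V) u ->
  (forall f, F f -> `|u f| <= c * q r f) -> local_form F u r.
Proof. by move=> r0 c0; apply: local_bound => // f a ra f0; exact: (star_eq0 s ra r0 f0). Qed.

Lemma local_pN (W : set V) u N r c : subsp W -> 0 <= r -> 0 <= c -> rlinear W u ->
  (forall f, W f -> `|u f| <= c * p N r f) -> local_form W u r.
Proof. by move=> sW r0 c0; apply: local_bound => // f a ra f0; exact: (pN_eq0 N ra r0 f0). Qed.

Lemma cutoff_near r r1 : 0 <= r -> r < r1 -> r1 <= R0 -> exists chi a b,
  [/\ r < a, b < r1, gevrey s setT chi, vanishes_off (cbox x0 b) chi &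
      forall x, obox x0 a x -> chi x = 1].
Proof.
move=> r0 rr rR; have [chi [a [b [ra br gc c1 c0]]]] := gevrey_cutoff x0 s1 rr.
by exists chi, a, b; split=> // x /obox_cbox/c1.
Qed.

Lemma TF_cutoff chi phi : gevrey s setT chi -> F phi -> F (fun x => chi x * phi x).
Proof. by move=> gc; apply: (TFM oOm s1); exact: (subset_gevrey (fun _ _ => I) gc). Qed.

Hypothesis hP : h_ultradistribution_distribution s Om P.

(* For a fixed form this is the hypothesis on [P]: composing with [T] gives, by
   Hahn-Banach, a distribution.  The uniform version is a uniform boundedness
   principle. *)
Lemma regularity r r1 N : 0 <= r -> r < r1 -> r1 <= R0 -> exists M c, 0 < c /\
  forall u, rlinear (F : set V) u -> (forall f, F f -> `|u f| <= q r f) ->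
  (forall f, F f -> `|u (T f)| <= p N r f) -> forall f, F f -> `|u f| <= c * p M r1 f.
Proof.
move=> r0 rr rR; have r10 : 0 <= r1 by rewrite ltW // (le_lt_trans r0).
have rR0 : r <= R0 by rewrite (le_trans (ltW rr)).
have [chi [a [b [ra br gc c0 c1]]]] := cutoff_near r0 rr rR.
(* Both bounds on [u], the Gevrey one and the one on [u (T f)], are written as constraints, so that
   the forms in the conclusion are exactly a polar. *)
pose Cn : set (V * R) := [set x | (F x.1 /\ x.2 = q r x.1) \/
  exists2 f, F f & x = (T f : V, p N r f)].
have [|||||M [c [cp Hc]]] := @polar_uniform_bound R V F Cn (fun M => p M r1) sF.
- by move=> [f t] [[]//|[g Fg [-> _]]]; exact: (TF_transpose oOm s1 gP).
- by move=> f Ff; exists (q r f); left.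
- by move=> M f /TF_smooth sf; exact: pN_ge0.
- by move=> M M' f /TF_smooth sf MM; exact: pN_mono.
- move=> u [lu Cu].
  have ub f : F f -> `|u f| <= q r f by move=> Ff; apply: (Cu (f, q r f)); left.
  have uT f : F f -> `|u (T f)| <= 1 * p N r f.
    by move=> Ff; rewrite mul1r; apply: (Cu (T f, p N r f)); right; exists f.
  have FD : F `<=` D by move=> f /TF_test.
  have lT := rlinear_transpose FD (TF_transpose oOm s1 gP) lu.
  have [w [lw wu wb]] := extend_pN sF FD r0 ltr01 lT uT.
  have U1 : ultradistribution s Om (complexify u).
    by apply: (star_ultradistribution (r := r)) => //; rewrite r0.
  have [|v [_ vK] uv] := hP oOm (fun _ => id) U1.
    exists (complexify w); first exact: (pN_distribution r0 ltr01 lw wb).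
    move=> phi tp; rewrite (complexify_transpose lu tp) /complexify.
    by rewrite !wu //; exact: (clinearZ cF).
  have [c [M [cp Hc]]] := vK _ (@cbox_compact _ _ x0 b) (boxO (le_trans (ltW br) rR)).
  have [A A0 HA] := cutoff_bound M r10 br (gevrey_smooth gc) c0.
  exists M, (c * A) => f Ff; have Fcf := TF_cutoff gc Ff.
  (* The distribution obtained from the hypothesis has an order on each fixed compact set only; the
     cutoff brings every [f] into functions supported in one box. *)
  have -> : u f = u (fun x => chi x * f x).
    have lo : local_form F u r.
      by apply: (local_star r0 ler01 lu) => g Fg; rewrite mul1r ub.
    by apply: (lo a) => // x xa; rewrite c1 // mul1r.
  apply: le_trans (complexify_ge u _) _; rewrite (uv _ Fcf) -mulrA.
  apply: Hc => [||al x aM]; first exact: (TF_test Fcf).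
    by apply: (supp_sub (@cbox_closed _ _ x0 b)) => x /c0 ->; rewrite mul0r.
  by rewrite dpartE; exact: (HA f (TF_smooth Ff) _ x
    (etrans (congr1 (fun k => k <= M)%N (size_word al)) aM)).
exists M, c; split=> // u lu ub uT f Ff; apply: Hc => //; split=> //.
by move=> [g t] [[/= Fg ->]|[h Fh [-> ->]]]; [exact: ub|exact: uT].
Qed.

End Regularity.

Section Preliminaries.
Context {R : realType}.

Lemma small_eq0 (x K : R) : (forall e, 0 < e -> `|x| <= K * e) -> x = 0.
Proof.
move=> H; apply/eqP; rewrite -normr_le0; apply/ler_addgt0Pr => e e0; rewrite add0r.
have K1 : 0 < `|K| + 1 by rewrite ltr_wpDl.
apply: le_trans (H (e / (`|K| + 1)) (divr_gt0 e0 K1)) _.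
rewrite mulrCA ger_pMr // ler_pdivrMr // mul1r.
by apply: le_trans (ler_norm K) _; rewrite lerDl.
Qed.

(** [t] is the norm of [u], the supremum over the unit ball of [pp]: finite by the bound with [A],
    positive because of [f0], and attained up to a factor 2. *)
Lemma normalization (V : lmodType R) (W : set V) (u pp : V -> R) (A : R) (f0 : V) :
  subsp W -> rlinear W u -> (forall f, W f -> 0 <= pp f) ->
  (forall a f, 0 < a -> W f -> pp (a *: f) <= a * pp f) ->
  (forall f, W f -> `|u f| <= A * pp f) -> W f0 -> u f0 != 0 ->
  exists t f, [/\ 0 < t, forall g, W g -> `|u g| <= t * pp g, W f, pp f <= 1 &
    t / 2 <= `|u f| ].
Proof.
move=> sW lu pp0 ppZ ub W0 u0; pose S := [set t | exists2 f, W f /\ pp f <= 1 & t = `|u f|].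
have scale f : W f -> 0 < pp f -> W ((pp f)^-1 *: f) /\ pp ((pp f)^-1 *: f) <= 1.
  move=> Wf fp; have ip : 0 < (pp f)^-1 by rewrite invr_gt0.
  split; first exact: subspZ.
  by apply: le_trans (ppZ _ _ ip Wf) _; rewrite mulVf // gt_eqF.
have pos f : W f -> u f != 0 -> 0 < pp f.
  move=> Wf uf; rewrite lt_neqAle pp0 // andbT; apply/eqP => e.
  by have := ub f Wf; rewrite -e mulr0 normr_le0 (negbTE uf).
have hS : has_ubound S.
  exists `|A| => _ [f [Wf f1] ->]; apply: le_trans (ub f Wf) _.
  apply: le_trans (_ : `|A| * pp f <= _); first by rewrite ler_wpM2r ?pp0 // ler_norm.
  by rewrite ler_piMr.
have uS f : W f -> u f != 0 -> `|u f| <= sup S * pp f.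
  move=> Wf uf; have fp := pos f Wf uf; have [Ws s1] := scale f Wf fp.
  rewrite -ler_pdivrMr // mulrC; apply: ub_le_sup => //; exists ((pp f)^-1 *: f) => //.
  by rewrite (rlinearZ _ sW lu Wf) normrM gtr0_norm ?invr_gt0.
have t0 : 0 < sup S.
  have := uS f0 W0 u0; have : 0 < `|u f0| by rewrite normr_gt0.
  by move=> /lt_le_trans H /H; rewrite pmulr_lgt0 // pos.
have S0 : S !=set0.
  have [Ws s1] := scale f0 W0 (pos _ W0 u0).
  by exists `|u ((pp f0)^-1 *: f0)|, ((pp f0)^-1 *: f0).
have [|_ [f [Wf f1] ->] xS] := @sup_adherent _ S (sup S / 2) _ (conj S0 hS).
  exact: divr_gt0.
exists (sup S), f; split=> // [g Wg|]; last by move: xS; lra.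
have [->|ug] := eqVneq (u g) 0; last exact: uS.
by rewrite normr0 mulr_ge0 ?pp0 // ltW.
Qed.

(** There are finitely many words of length at most [M], so finitely many members of the filter are
    intersected. *)
Lemma words_near (n : nat) (FF : set_system nat) (Q : seq 'I_n -> nat -> Prop) M :
  Filter FF -> (forall w, \forall j \near FF, Q w j) ->
  \forall j \near FF, forall w, (size w <= M)%N -> Q w j.
Proof.
move=> fF; elim: M Q => [|M IH] Q HQ.
  by apply: filterS (HQ [::]) => j Qj [].
have H (i : 'I_n) : \forall j \near FF, forall w, (size w <= M)%N -> Q (i :: w) j.
  exact: (IH (fun w => Q (i :: w))).
apply: filterS (filterI (HQ [::]) (filter_forall fF H)) => j [Q0 Qi].
by move=> [|i w] //= wM; exact: Qi.
Qed.

End Preliminaries.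

Section Density.
Context {R : realType} {n : nat}.
Local Notation E := 'rV[R]_n.
Local Notation C := R[i].
Variables (Om : set E) (s : R) (x0 : E) (R0 R1 : R).
Hypotheses (s1 : 1 < s) (R01 : R0 < R1) (KO1 : cbox x0 R1 `<=` Om).

Lemma compact_TF (K : set E) f : compact K -> K `<=` Om -> gevrey s setT f ->
  vanishes_off K f -> TF Om s f.
Proof.
move=> cK KO gf f0; split; last exact: (subset_gevrey (fun _ _ => I) gf).
by apply/test_funP; split; [exact: (gevrey_smooth gf)|exists K].
Qed.

Lemma TF_dense (phi : E -> C) r M (e : R) : 0 <= r <= R0 -> smooth setT phi -> 0 < e ->
  exists2 psi, TF Om s psi & pN x0 M r (fun x => phi x - psi x) <= e.
Proof.
move=> /andP[r0 rR] sp e0; have s0 : 0 <= s by rewrite (le_trans _ (ltW s1)).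
have [chi [a [b [ra br gc c1 c0]]]] := gevrey_cutoff x0 s1 R01.
have [g gg Hg] := smooth_gevrey_approximable s1 sp x0 r M e0.
have gcg := gevreyM s0 openT gc gg.
exists (fun x => chi x * g x).
  apply: (compact_TF (@cbox_compact _ _ x0 b)) => //.
    by move=> x /(subset_cbox (ltW br))/KO1.
  by move=> x /c0 ->; rewrite mul0r.
apply: pN_le => //; first exact: ltW.
move=> w x wM xr; apply: le_trans (Hg w x wM xr).
rewrite -(pwB w openT sp (gevrey_smooth gg) I).
rewrite (eq_pw (@obox_open _ _ x0 a) w (g := fun y => phi y - g y)) //.
  by move=> y /obox_cbox/c1 ->; rewrite mul1r.
exact: (cbox_obox (le_lt_trans rR ra)).
Qed.

End Density.

Section UniformLimit.
Context {R : realType} {n : nat}.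
Local Notation E := 'rV[R]_n.
Local Notation C := R[i].
Variable FF : set_system nat.
Hypothesis UF : UltraFilter FF.

Lemma bounded_culim (z : nat -> C) A : (forall j, cmod (z j) <= A) ->
  exists l, forall e : R, 0 < e -> \forall j \near FF, cmod (z j - l) <= e.
Proof.
move=> zA.
have [a Ha] := bounded_ulim UF (fun j => le_trans (cmod_Re (z j)) (zA j)).
have [b Hb] := bounded_ulim UF (fun j => le_trans (cmod_Im (z j)) (zA j)).
exists (a +i* b) => e e0; have e2 : 0 < e / 2 by rewrite divr_gt0.
apply: filterS (filterI (Ha _ e2) (Hb _ e2)) => j [h1 h2].
rewrite [X in _ <= X]splitr; apply: cmod_le2.
  by move: h1; case: (z j).
by move: h2; case: (z j).
Qed.

Lemma rect_setT (c : E) : rect setT c = setT.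
Proof. by apply/seteqP; split. Qed.

Lemma smooth_ulimit (psi : nat -> E -> C) : (forall j, smooth setT (psi j)) ->
  (forall w, exists2 A, 0 <= A & forall j x, cmod (pw w (psi j) x) <= A) ->
  exists2 G, smooth setT G & forall w x e, 0 < e ->
    \forall j \near FF, cmod (pw w (psi j) x - pw w G x) <= e.
Proof.
move=> sp bp; have H (wx : seq 'I_n * E) : exists l, forall e : R, 0 < e ->
    \forall j \near FF, cmod (pw wx.1 (psi j) wx.2 - l) <= e.
  by have [A A0 HA] := bp wx.1; exact: (bounded_culim (fun j => HA j wx.2)).
have [G HG] := choice H; pose G' w x := G (w, x).
have cI : conv1 (setT : set R) by [].
have oI : open (rect setT (0 : E)) by rewrite rect_setT; exact: openT.
have [|||sG eG] := @smooth_limit R n setT 0 cI oI nat FF _ psi G'.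
- by move=> j; rewrite rect_setT.
- by move=> w; have [A A0 HA] := bp w; exists A.
- by move=> w x _ e e0; exact: (HG (w, x)).
rewrite rect_setT in sG eG.
by exists (G' [::]) => // w x e e0; rewrite eG //; exact: (HG (w, x)).
Qed.

(** Ascoli's argument: bounds on one further derivative give a common Lipschitz constant, which
    spreads closeness from a point to a ball, and a compact box is covered by finitely many such
    balls. *)
Lemma uniform_ulimit (psi : nat -> E -> C) G x0 r M e :
  (forall j, smooth setT (psi j)) -> smooth setT G ->
  (forall w, exists2 A, 0 <= A & forall j x, cmod (pw w (psi j) x) <= A) ->
  (forall w x e, 0 < e -> \forall j \near FF, cmod (pw w (psi j) x - pw w G x) <= e) ->
  0 <= r -> 0 < e -> \forall j \near FF, pN x0 M r (fun x => psi j x - G x) <= e.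
Proof.
move=> sp sG bp Hl r0 e0.
have HQ w : \forall j \near FF, forall x, cbox x0 r x ->
    cmod (pw w (fun x => psi j x - G x) x) <= e.
  have bw (i : 'I_n) : exists A : R, 0 <= A /\
      forall j x, cmod (pw (i :: w) (psi j) x) <= A.
    by have [A A0 HA] := bp (i :: w); exists A.
  have [A HA] := choice bw.
  pose B := \sum_i A i; have B0 : 0 <= B by apply: sumr_ge0 => i _; case: (HA i).
  have lip j x y : cmod (pw w (psi j) y - pw w (psi j) x) <= n%:R * (B + B) * `|y - x|.
    have cI : conv1 (setT : set R) by [].
    apply: (@lipschitz_rect_norm R n setT 0 cI setT (pw w (psi j)) B (fun _ _ => I)
      (smooth_pw w (sp j)) _ B0 x y (fun _ => I) (fun _ => I)).
    move=> i z _; have [_ Hi] := HA i; apply: le_trans (Hi j z) _.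
    by rewrite /B (bigD1 i) //= lerDl sumr_ge0 // => k _; case: (HA k).
  have lipG x y : cmod (pw w G y - pw w G x) <= n%:R * (B + B) * `|y - x|.
    apply/ler_addgt0Pr => d d0; have d2 : 0 < d / 2 by rewrite divr_gt0.
    have [j [/= h1 h2]] := filter_ex (filterI (Hl w x _ d2) (Hl w y _ d2)).
    have -> : pw w G y - pw w G x = (pw w (psi j) y - pw w (psi j) x) +
      ((pw w (psi j) x - pw w G x) - (pw w (psi j) y - pw w G y)) by ring.
    apply: le_trans (cmodD _ _) _; apply: lerD; first exact: lip.
    by apply: le_trans (cmodB _ _) _; rewrite [leRHS]splitr lerD.
  have /compact_near_coveringP nc := @cbox_compact _ _ x0 r.
  apply: (nc nat FF (fun j x => cmod (pw w (fun x => psi j x - G x) x) <= e)) => x _.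
  pose K := n%:R * (B + B) + 1; have K0 : 0 < K by rewrite ltr_wpDl // mulr_ge0 ?addr_ge0.
  have e3 : 0 < e / 3 by rewrite divr_gt0.
  exists (ball x (e / 3 / K), [set j | cmod (pw w (psi j) x - pw w G x) <= e / 3]).
    by split; [exact: nbhsx_ballx (divr_gt0 e3 K0)|exact: Hl].
  move=> [y j] [/= xy hj]; rewrite (pwB w openT (sp j) sG I).
  have yx : n%:R * (B + B) * `|y - x| <= e / 3.
    move: xy; rewrite -ball_normE /= distrC ltr_pdivlMr // => /ltW; apply: le_trans.
    by rewrite mulrC ler_wpM2l // /K lerDl.
  have -> : pw w (psi j) y - pw w G y = (pw w (psi j) y - pw w (psi j) x) +
    ((pw w (psi j) x - pw w G x) - (pw w G y - pw w G x)) by ring.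
  have -> : e = e / 3 + (e / 3 + e / 3) by field.
  apply: le_trans (cmodD _ _) _; apply: lerD; first exact: le_trans (lip _ _ _) yx.
  apply: le_trans (cmodB _ _) _; apply: lerD => //; exact: le_trans (lipG _ _) yx.
apply: filterS (words_near M _ HQ) => j Hj.
by apply: pN_le => // [|w x wM xr]; [exact: ltW|exact: Hj].
Qed.

End UniformLimit.

Section Kernel.
Context {R : realType} {n : nat}.
Local Notation E := 'rV[R]_n.
Local Notation C := R[i].
Local Notation V := (E -> Rcomplex R).
Implicit Types (f g phi psi : E -> C) (r A c : R) (N M : nat) (u v : V -> R).
Variables (Om : set E) (s : R) (P : pdo R n) (x0 : E) (R0 R1 : R).
Hypotheses (oOm : open Om) (s1 : 1 < s) (gP : coefs_in (gevrey s Om) P).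
Hypotheses (R01 : R0 < R1) (KO1 : cbox x0 R1 `<=` Om).
Hypothesis hP : h_ultradistribution_distribution s Om P.
Local Notation F := (TF Om s).
Local Notation T := (transpose P).
Local Notation p := (pN x0).
Local Notation q := (star x0 s).
Let sF : subsp (F : set V). Proof. exact: subsp_TF. Qed.
Let cF : clinear F. Proof. exact: clinear_TF. Qed.
Let KO : cbox x0 R0 `<=` Om. Proof. by move=> x /(subset_cbox (ltW R01))/KO1. Qed.
Let TFT f : F f -> F (T f). Proof. exact: (TF_transpose oOm s1 gP). Qed.

Lemma starZ_real r a f : 0 <= r <= R0 -> 0 < a -> F f -> q r (a *: (f : V)) <= a * q r f.
Proof.
move=> /andP[r0 rR] a0 Ff; rewrite rscaleE.
have := starZ_le oOm a%:C r0 (boxO KO rR) (TF_gevrey Ff).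
by rewrite cmod_real gtr0_norm.
Qed.

Lemma pNB_le N r f g h : 0 <= r -> smooth setT f -> smooth setT g -> smooth setT h ->
  p N r (fun x => f x - h x) <= p N r (fun x => f x - g x) + p N r (fun x => g x - h x).
Proof.
move=> r0 sf sg sh.
have -> : (fun x => f x - h x) = (fun x => (f x - g x) + (g x - h x)).
  by apply/funext => x; ring.
exact: (pND x0 N r0 (smoothB openT sf sg) (smoothB openT sg sh)).
Qed.

Section Compactness.
Variable FF : set_system nat.
Hypothesis UF : UltraFilter FF.
Hypothesis FN : forall N, FF [set j | (N <= j)%N].

(* After a cutoff, the [phi j] have uniformly bounded derivatives, hence converge
   (Ascoli) to a smooth function, and the bound of [regularity] passes to the limit. *)
Lemma normalized_limit (r r' r1 : R) N (v : nat -> V -> R) (phi : nat -> E -> C) :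
  0 <= r -> r < r' -> r' < r1 -> r1 <= R0 ->
  (forall j, [/\ rlinear (F : set V) (v j), forall f, F f -> `|v j f| <= q r' f,
    forall f, F f -> `|v j (T f)| <= p N r' f / j.+1%:R & local_form x0 F (v j) r]) ->
  (forall j, [/\ F (phi j), q r' (phi j) <= 1 & 2^-1 <= `|v j (phi j)| ]) ->
  exists w : V -> R, [/\ rlinear (F : set V) w,
    forall f, F f -> `|w f| <= q r' f, forall f, F f -> w (T f) = 0,
    exists2 f, F f & w f != 0 &
    forall f, F f -> forall e, 0 < e -> \forall j \near FF, `|v j f - w f| <= e].
Proof.
move=> r0 rr' r'r1 r1R Hv Hphi.
have r'0 : 0 <= r' by rewrite (le_trans r0) // ltW.
have r'R : r' <= R0 by rewrite (le_trans (ltW r'r1)).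
have r10 : 0 <= r1 by rewrite (le_trans r'0) // ltW.
have lv j : rlinear (F : set V) (v j) by case: (Hv j).
(* The same [M] and [c] serve all [v j]: this C^M bound is what makes convergence of the [psi j] in
   C^M sufficient below. *)
have [M [c [c0 reg]]] := regularity oOm s1 gP KO hP N r'0 r'r1 r1R.
have vb j f : F f -> `|v j f| <= c * p M r1 f.
  have [_ h1 h2 _] := Hv j; move=> Ff; apply: (reg (v j)) => // g Fg.
  apply: le_trans (h2 g Fg) _; rewrite ler_pdivrMr // ler_peMr ?ler1n //.
  by apply: pN_ge0 => //; exact: (TF_smooth Fg).
have [w lw Hw] : exists2 w : V -> R, rlinear (F : set V) w & forall f, F f ->
    forall e, 0 < e -> \forall j \near FF, `|v j f - w f| <= e.
  apply: (ulim_functional UF sF lv) => f Ff; exists (q r' f) => j.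
  by case: (Hv j) => _ + _ _; exact.
exists w; split=> // [f Ff|f Ff|].
- apply: (ulim_le UF (Hw f Ff)); apply: filterE => j.
  by case: (Hv j) => _ + _ _; exact.
- apply: (@small_eq0 _ _ 1) => e e0; rewrite mul1r; apply: (ulim_le UF (Hw _ (TFT Ff))).
  apply: filterS (FN (Num.truncn (p N r' f / e))) => j /= hj.
  case: (Hv j) => _ _ /(_ f Ff) h _; apply: le_trans h _.
  rewrite ler_pdivrMr // mulrC -ler_pdivrMr //; apply: ltW.
  by apply: lt_le_trans (truncnS_gt _) _; rewrite ler_nat ltnS.
have [chi [a [b [ra br gc c0' c1]]]] := cutoff_near x0 s1 r0 rr' r'R.
(* As [v j] is carried by the smaller box, its value at [phi j] is unchanged, whereas the Gevrey
   bounds on the box of radius [r'] become bounds on the whole space. *)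
pose psi j := (fun x => chi x * phi j x) : E -> C.
have Fphi j : F (phi j) by case: (Hphi j).
have Fpsi j : F (psi j) by exact: (TF_cutoff oOm s1 gc (Fphi j)).
have vpsi j : v j (phi j) = v j (psi j).
  case: (Hv j) => _ _ _ lo; apply: (lo a) => // x xa.
  by rewrite /psi c1 // mul1r.
have sp j : smooth setT (psi j) by exact: (TF_smooth (Fpsi j)).
have bp w' : exists2 A, 0 <= A & forall j x, cmod (pw w' (psi j) x) <= A.
  have [A A0 HA] := cutoff_bound (size w') r'0 br (gevrey_smooth gc) c0'.
  exists (A * (size w')`!%:R `^ s); first by rewrite mulr_ge0 ?powR_ge0.
  move=> j x; apply: le_trans (HA (phi j) (TF_smooth (Fphi j)) w' x (leqnn _)) _.
  rewrite ler_wpM2l //; have [_ q1 _] := Hphi j.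
  apply: le_trans (pN_star oOm s1 _ r'0 (boxO KO r'R) (TF_gevrey (Fphi j))) _.
  by rewrite ler_piMr // powR_ge0.
have [G sG HG] := smooth_ulimit UF sp bp.
(* Spent twice, from [psi j] to [G] and from [G] to [g]: after multiplication by [c] the loss is
   [4^-1], and [2^-1] leaves [4^-1]. *)
have e0 : 0 < (8 * c)^-1 by rewrite invr_gt0 mulr_gt0.
have r1i : 0 <= r1 <= R0 by rewrite r10.
have [g Fg Hg] := TF_dense s1 R01 KO1 M r1i sG e0.
exists g => //; rewrite -normr_gt0; apply: (lt_le_trans (y := 4^-1)) => //.
apply: (ulim_ge UF (Hw g Fg)).
apply: filterS (uniform_ulimit UF x0 M sp sG bp HG r10 e0) => j Hj.
have [_ _ v2] := Hphi j; rewrite vpsi in v2.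
have h : `|v j (psi j) - v j g| <= 4^-1.
  rewrite -(rlinearB sF (lv j) (Fpsi j) Fg).
  apply: le_trans (vb j _ (clinearB cF (Fpsi j) Fg)) _.
  have : p M r1 (fun x => psi j x - g x) <= (8 * c)^-1 + (8 * c)^-1.
    by apply: le_trans (pNB_le M r10 (sp j) sG (TF_smooth Fg)) _; exact: lerD.
  move=> h; apply: le_trans (_ : c * ((8 * c)^-1 + (8 * c)^-1) <= _).
    by rewrite ler_pM2l.
  rewrite le_eqVlt; apply/orP; left; apply/eqP; field.
  by rewrite gt_eqF.
have := ler_normD (v j (psi j) - v j g) (v j g); rewrite subrK.
by move: h v2; lra.
Qed.
End Compactness.
End Kernel.

(** * Solutions of delta type, and triviality of the kernel in a small box *)

Section DeltaSolutions.
Context {R : realType} {n : nat}.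
Local Notation E := 'rV[R]_n.
Local Notation C := R[i].
Local Notation V := (E -> Rcomplex R).
Local Notation ii := (0 +i* 1 : C).
Implicit Types (f g phi psi : E -> C) (r A c : R) (N M : nat) (u v : V -> R).
Variables (Om : set E) (s : R) (P : pdo R n) (x0 : E) (R0 R1 : R).
Hypotheses (oOm : open Om) (s1 : 1 < s) (gP : coefs_in (gevrey s Om) P).
Hypotheses (R00 : 0 < R0) (R01 : R0 < R1) (KO1 : cbox x0 R1 `<=` Om).
Let s0 : 0 <= s. Proof. by rewrite (le_trans _ (ltW s1)). Qed.
Local Notation F := (TF Om s).
Local Notation D := (test_fun Om).
Local Notation T := (transpose P).
Local Notation p := (pN x0).
Let sF : subsp (F : set V). Proof. exact: subsp_TF. Qed.
Let sD : subsp (D : set V). Proof. exact: subsp_test. Qed.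
Let cF : clinear F. Proof. exact: clinear_TF. Qed.
Let cD : clinear D. Proof. exact: clinear_test. Qed.
Let KO : cbox x0 R0 `<=` Om. Proof. by move=> x /(subset_cbox (ltW R01))/KO1. Qed.
Let FD : F `<=` D. Proof. by move=> f /TF_test. Qed.
Let TFT f : F f -> F (T f). Proof. exact: (TF_transpose oOm s1 gP). Qed.

(** Carries an identity known for Gevrey functions to all functions of [K]: the value of [u] is
    bounded by the distance to Gevrey test functions, which is 0 by density. *)
Lemma dense_vanish (K : (E -> C) -> Prop) (u : V -> R) M c : 0 <= c ->
  (forall phi psi, K phi -> F psi -> `|u phi| <= c * p M R0 (fun x => phi x - psi x)) ->
  (forall phi, K phi -> smooth setT phi) -> forall phi, K phi -> u phi = 0.
Proof.
move=> c0 uK sK phi Kp; apply: (@small_eq0 _ _ c) => e e0.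
have RR : 0 <= R0 <= R0 by rewrite lexx ltW.
have [psi Fpsi He] := TF_dense s1 R01 KO1 M RR (sK _ Kp) e0.
by apply: le_trans (uK _ _ Kp Fpsi) _; rewrite ler_wpM2l.
Qed.

(** The C^M bound lets [u] extend by Hahn-Banach to all test functions; that the extension is killed
    by [T] and is supported at [x0] is known on Gevrey functions and follows by density. *)
Lemma delta_solution u M c f0 : 0 < c -> rlinear (F : set V) u ->
  (forall f, F f -> `|u f| <= c * p M R0 f) -> (forall f, F f -> u (T f) = 0) ->
  (forall r, 0 < r -> local_form x0 (F : set V) u r) -> F f0 -> u f0 != 0 ->
  has_delta_solution Om P x0.
Proof.
move=> c0 lu ub uT lo F0 u0; have R0' := ltW R00.
have RR : 0 <= R0 <= R0 by rewrite lexx R0'.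
have [w [lw wu wb]] := extend_pN sF FD R0' c0 lu ub.
have dw := pN_distribution R0' c0 lw wb.
have wT phi : D phi -> w (T phi) = 0.
  have [M' [A [A0 HA]]] := pN_transpose oOm gP KO M.
  move: phi; apply: (@dense_vanish D (fun f => w (T f)) M' (c * A)) => [|phi psi Dp Fp|phi].
  - by rewrite mulr_ge0 // ltW.
  - have Ds := FD Fp; have TD f : D f -> D (T f).
      exact: (test_fun_transpose oOm (coefs_smooth gP)).
    have lT := rlinear_transpose oOm gP (fun _ => id) TD lw.
    have -> : w (T phi) = w (T (fun x => phi x - psi x)).
      rewrite (rlinearB sD lT Dp Ds) (_ : w (T psi) = 0) ?subr0 //.
      by rewrite wu ?uT //; exact: TFT.
    have Dps := clinearB cD Dp Ds.
    apply: le_trans (wb _ (TD _ Dps)) _; rewrite -mulrA ler_pM2l //.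
    exact: HA.
  - exact: test_fun_smooth.
have wlo r phi : 0 < r -> r <= R0 -> D phi -> (forall x, obox x0 r x -> phi x = 0) -> w phi = 0.
  move=> r0 rR; have r4 : r / 4 < r / 2 by lra.
  have r40 : 0 <= r / 4 by rewrite divr_ge0 // ltW.
  have r2R : r / 2 <= R0 by lra.
  have [chi [a [b [ra br gc c0' c1]]]] := cutoff_near x0 s1 r40 r4 r2R.
  (* [eta] does not change a function vanishing on the box of radius [r], and it makes every Gevrey
     approximation vanish near [x0], where [u] is concentrated. *)
  pose eta := (fun x => 1 - chi x) : E -> C.
  have ge : gevrey s setT eta.
    have gN := gevreyZ s0 (-1) openT gc.
    apply: (eq_gevrey openT _ (gevreyD openT (gevrey_cst s 1 openT) gN)) => x _.
    by rewrite mulN1r.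
  have se : smooth Om eta by exact: (subset_smooth (fun _ _ => I) (gevrey_smooth ge)).
  have [A A0 HA] := pN_mul_smooth oOm KO M se.
  move=> Dp fp; move: phi {Dp fp} (conj Dp fp).
  apply: (@dense_vanish _ w M (c * A)) => [|phi psi [Dp fp] Fp|phi [Dp _]].
  - by rewrite mulr_ge0 // ltW.
  - have Ds := FD Fp; have Fe := TF_cutoff oOm s1 ge Fp.
    have -> : w phi = w (fun x => eta x * (phi x - psi x)).
      have ep : phi = (fun x => eta x * phi x).
        apply/funext => x; rewrite /eta; have [xr|xr] := pselect (obox x0 r x).
          by rewrite fp // mulr0.
        rewrite c0' ?subr0 ?mul1r // => xb; apply: xr.
        by apply: (cbox_obox _ xb); apply: lt_trans br _; lra.
      have De : D (fun x => eta x * phi x) by rewrite -ep.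
      have -> : (fun x => eta x * (phi x - psi x)) =
          ((fun x => eta x * phi x) : V) - ((fun x => eta x * psi x) : V).
        by apply/funext => x; rewrite mulrBr.
      rewrite (rlinearB sD lw De (FD Fe)) -ep (_ : w (fun x => eta x * psi x) = 0) ?subr0 //.
      rewrite wu //; have r4p : 0 < r / 4 by rewrite divr_gt0.
      rewrite (lo _ r4p a _ (fun=> 0) ra Fe (proj1 cF)); first exact: (rlinear0 sF lu).
      by move=> x xa; rewrite /eta c1 // subrr mul0r.
    have Dps := clinearB cD Dp Ds; have sps := test_fun_smooth Dps.
    apply: le_trans (wb _ (test_funM oOm se Dps)) _; rewrite -mulrA ler_pM2l //.
    apply: pN_le => //; first by rewrite mulr_ge0 ?pN_ge0.
    by move=> v x vM xr; exact: HA.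
  - exact: (test_fun_smooth Dp).
have sub : dsupp Om (complexify w) = [set x0].
  apply/seteqP; split=> [x [Ox Hx]|x ->].
    apply: contrapT => /eqP xx0.
    have [i xi] : exists i, x 0 i != x0 0 i.
      apply: contrapT => nx; move/eqP: xx0; apply; apply/rowP => i.
      by apply: contrapT => /eqP xi; apply: nx; exists i.
    pose d := `|x 0 i - x0 0 i|; have d0 : 0 < d by rewrite normr_gt0 subr_eq0.
    pose r := Num.min R0 (d / 2).
    have r0 : 0 < r by rewrite lt_min R00 divr_gt0.
    have oW : open (Om `&` ~` cbox x0 r).
      by apply: openI => //; apply: closed_openC; exact: cbox_closed.
    have Wx : (Om `&` ~` cbox x0 r) x.
      split=> // /(_ i); rewrite -/d le_min; lra.
    have [|phi /test_funP[sp [K [cK KW p0]]]] := Hx _ oW Wx; first by move=> y [].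
    rewrite (_ : complexify w phi = 0) ?eqxx //.
    have Dp : D phi by apply/test_funP; split=> //; exists K; split=> // y /KW[].
    have p0' y : obox x0 r y -> phi y = 0.
      by move=> /obox_cbox yr; apply: p0 => /KW[].
    have rR : r <= R0 by rewrite ge_min lexx.
    apply: complexify_eq0; first exact: (wlo r phi r0 rR Dp p0').
    apply: (wlo r _ r0 rR (clinearZ cD ii Dp)) => y /p0' ->.
    by rewrite mulr0.
  split=> [|W oW Wx0 WO]; first exact: (KO (cbox_center x0 R0')).
  have [r r0 rW] := open_cbox oW Wx0.
  have r2r : r / 2 < r by lra.
  have [chi [a [b [ra br gc c1 c0']]]] := gevrey_cutoff x0 s1 r2r.
  have Fc := TF_cutoff oOm s1 gc F0; exists (fun x => chi x * f0 x).
    apply/test_funP; split; first exact: (TF_smooth Fc).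
    exists (cbox x0 b); split; first exact: cbox_compact.
      by move=> y /(subset_cbox (ltW br))/rW.
    by move=> y /c0' ->; rewrite mul0r.
  apply: contra_neq u0 => /(congr1 (@complex.Re R)) /=; rewrite wu // => <-.
  have r2p : 0 < r / 2 by rewrite divr_gt0.
  by apply: (lo _ r2p a _ _ ra F0 Fc) => y /obox_cbox/c1 ->; rewrite mul1r.
exists (complexify w); split=> //; first by split=> //; rewrite sub; exact: compact_set1.
move=> phi Dp; rewrite (pdo_form_transpose cD (complexify_linear cD lw)).
  apply: complexify_eq0; first exact: wT.
  by rewrite -(transposeZ oOm gP _ Dp); apply/wT/(clinearZ cD).
by move=> al; exact: (test_transpose_term oOm gP).
Qed.

End DeltaSolutions.

Section SmallBoxes.
Context {R : realType} {n : nat}.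
Local Notation E := 'rV[R]_n.
Local Notation C := R[i].
Local Notation V := (E -> Rcomplex R).
Implicit Types (f g phi psi : E -> C) (r A c : R) (N M : nat) (u v : V -> R).
Variables (Om : set E) (s : R) (P : pdo R n) (x0 : E) (R0 R1 : R).
Hypotheses (oOm : open Om) (s1 : 1 < s) (gP : coefs_in (gevrey s Om) P).
Hypotheses (R00 : 0 < R0) (R01 : R0 < R1) (KO1 : cbox x0 R1 `<=` Om).
Hypothesis hP : h_ultradistribution_distribution s Om P.
Hypothesis ndelta : ~ has_delta_solution Om P x0.
Local Notation F := (TF Om s).
Local Notation T := (transpose P).
Local Notation q := (star x0 s).
Let sF : subsp (F : set V). Proof. exact: subsp_TF. Qed.
Let cF : clinear F. Proof. exact: clinear_TF. Qed.
Let KO : cbox x0 R0 `<=` Om. Proof. by move=> x /(subset_cbox (ltW R01))/KO1. Qed.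


Lemma local_formS (W : set V) u r r' : r <= r' -> local_form x0 W u r -> local_form x0 W u r'.
Proof. by move=> rr lo a f g ra; apply: lo; exact: le_lt_trans ra. Qed.

Lemma local_form_div (W : set V) u r t : local_form x0 W u r ->
  local_form x0 W (fun f => u f / t) r.
Proof. by move=> lo a f g ra Wf Wg fg; rewrite (lo a f g ra Wf Wg fg). Qed.

Lemma rlinear_div (W : set V) u t : rlinear W u -> rlinear W (fun f => u f / t).
Proof. by move=> lu a f g Wf Wg; rewrite lu // mulrDl mulrA. Qed.

Lemma normalized u r A f0 : 0 <= r <= R0 -> rlinear (F : set V) u ->
  (forall f, F f -> `|u f| <= A * q r f) -> F f0 -> u f0 != 0 ->
  exists t phi, [/\ 0 < t, forall f, F f -> `|u f| <= t * q r f,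
    forall f, F f -> `|u f / t| <= q r f, F phi /\ q r phi <= 1 &
    2^-1 <= `|u phi / t| ].
Proof.
move=> /andP[r0 rR] lu ub F0 u0.
have [t [phi [t0 ut Fp p1 up]]] : exists t (phi : V), [/\ 0 < t,
    forall f, F f -> `|u f| <= t * q r f, F phi, q r phi <= 1 & t / 2 <= `|u phi| ].
  apply: (normalization sF lu _ _ ub F0 u0) => [f Ff|a f a0 Ff].
    exact: (star_ge0 oOm r0 (boxO KO rR) (TF_gevrey Ff)).
  by apply: (starZ_real oOm R01 KO1 _ a0 Ff); rewrite r0.
exists t, phi; split=> // [f Ff|]; rewrite normrM normfV (gtr0_norm t0).
  by rewrite ler_pdivrMr // mulrC ut.
by rewrite ler_pdivlMr // mulrC.
Qed.

Lemma star_le_mono r r' f : 0 <= r -> r <= r' -> r' <= R0 -> F f -> q r f <= q r' f.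
Proof.
by move=> r0 rr rR Ff; exact: (star_mono oOm r0 rr (boxO KO rR) (TF_gevrey Ff)).
Qed.

Lemma kernel_trivial : exists2 rho, 0 < rho <= R0 &
  forall u A, rlinear (F : set V) u -> (forall f, F f -> `|u f| <= A * q rho f) ->
  (forall f, F f -> u (T f) = 0) -> forall f, F f -> u f = 0.
Proof.
apply: contrapT => nk; have R0p := R00.
(* The carriers shrink with [rho j], but all forms are normalized in the fixed seminorm [q r'], so
   that their limit cannot vanish. *)
pose r' := R0 / 2; pose r := R0 / 4; pose rho (j : nat) := R0 / 4 / j.+1%:R.
have r0 : 0 <= r by rewrite /r divr_ge0 // ltW.
have rr : r < r' by rewrite /r /r'; lra.
have r'R : r' < R0 by rewrite /r'; lra.
have r'i : 0 <= r' <= R0 by rewrite ltW ?(le_lt_trans r0) // ltW.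
have rho0 j : 0 < rho j by rewrite !divr_gt0.
have rhor j : rho j <= r by rewrite /rho -/r ler_pdivrMr // ler_peMr // ler1n.
have H (j : nat) : exists vp : (V -> R) * (E -> C), [/\ rlinear (F : set V) vp.1 /\
    local_form x0 (F : set V) vp.1 (rho j), forall f, F f -> `|vp.1 f| <= q r' f,
    forall f, F f -> vp.1 (T f) = 0, F vp.2 /\ q r' vp.2 <= 1 & 2^-1 <= `|vp.1 vp.2| ].
  have [u [A [f0 [lu ub uT [F0 u0]]]]] : exists u A f0, [/\ rlinear (F : set V) u,
      forall f, F f -> `|u f| <= A * q (rho j) f, forall f, F f -> u (T f) = 0 &
      F f0 /\ u f0 != 0].
    apply: contrapT => nx; apply: nk; exists (rho j).
      by rewrite rho0 (le_trans (rhor j)) // ltW // (lt_trans rr).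
    move=> u A lu ub uT f Ff; apply: contrapT => /eqP uf; apply: nx.
    by exists u, A, f.
  have rj := ltW (rho0 j).
  have ub0 f : F f -> `|u f| <= `|A| * q (rho j) f.
    move=> Ff; apply: le_trans (ub f Ff) _; rewrite ler_wpM2r ?ler_norm //.
    apply: (star_ge0 oOm rj (boxO KO _) (TF_gevrey Ff)).
    by rewrite (le_trans (rhor j)) // ltW // (lt_trans rr).
  have ub' f : F f -> `|u f| <= `|A| * q r' f.
    move=> Ff; apply: le_trans (ub0 f Ff) _; rewrite ler_wpM2l //.
    apply: (star_le_mono rj _ (ltW r'R) Ff).
    by rewrite (le_trans (rhor j)) // ltW.
  have [t [phi [t0 ut ut' Fp up]]] := normalized r'i lu ub' F0 u0.
  exists (fun f => u f / t, phi); split=> //=.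
  - split; first exact: rlinear_div.
    apply: local_form_div; exact: (local_star oOm s1 rj (normr_ge0 A) lu ub0).
  - by move=> f Ff; rewrite uT // mul0r.
have [vp Hvp] := choice H; have [FF [UF FN]] := ultrafilter_nat.
pose v j := (vp j).1; pose phi j := (vp j).2.
have [||w [lw wb wT [f0 F0 w0] Hw]] := normalized_limit oOm s1 gP R01 KO1 hP UF FN
  (N := 0) (v := v) (phi := phi) r0 rr r'R (lexx _).
- move=> j; have [[lv lo] vb vT _ _] := Hvp j; split=> //.
    move=> f Ff; rewrite /v vT // normr0 divr_ge0 //.
    by apply: pN_ge0; [case/andP: r'i|exact: TF_smooth Ff].
  exact: (local_formS (rhor j) lo).
- by move=> j; have [_ _ _ [? ?] ?] := Hvp j.
(* The limit is so far bounded only by a Gevrey seminorm; since [w] composed with [T] is 0,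
   [regularity] supplies the C^M bound that [delta_solution] needs. *)
have [M [c [c0 reg]]] := regularity oOm s1 gP KO hP 0 (proj1 (andP r'i)) r'R (lexx _).
apply: ndelta; apply: (delta_solution oOm s1 gP R00 R01 KO1 c0 lw _ wT _ F0 w0).
  apply: (reg w lw wb) => f Ff; rewrite wT // normr0.
  by apply: pN_ge0; [case/andP: r'i|exact: TF_smooth Ff].
(* For a given [d], all but finitely many [v j] are carried by boxes of radius at most [d], so their
   values at [f - g] are 0. *)
move=> d d0 a f g da Ff Fg fg; apply/eqP; rewrite -subr_eq0 -normr_le0.
have Ffg := clinearB cF Ff Fg; rewrite -(rlinearB sF lw Ff Fg).
apply: (ulim_le UF (Hw _ Ffg)).
apply: filterS (FN (Num.truncn (r / d))) => j /= hj.
have [[lv lo] _ _ _ _] := Hvp j.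
rewrite (_ : v j _ = (vp j).1 f - (vp j).1 g); last exact: (rlinearB sF lv Ff Fg).
rewrite (lo a f g _ Ff Fg fg) ?subrr ?normr0 //.
apply: le_lt_trans da; rewrite /rho -/r ler_pdivrMr // mulrC -ler_pdivrMr //.
by apply: ltW; apply: lt_le_trans (truncnS_gt _) _; rewrite ler_nat ltnS.
Qed.

End SmallBoxes.

(** * Duality and approximate solutions *)

Section InfConvolution.
Context {R : realType} {V : lmodType R}.
Variables (D : set V) (T : V -> V) (p1 p2 : V -> R).
Hypotheses (sD : subsp D) (TD : forall f, D f -> D (T f)).
Hypothesis lT : forall a f g, D f -> D g -> T (a *: f + g) = a *: T f + T g.
Hypotheses (s1 : sublinear D p1) (s2 : sublinear D p2).
Hypotheses (n1 : forall f, D f -> p1 (- f) = p1 f) (n2 : forall f, D f -> p2 (- f) = p2 f).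
Hypotheses (g1 : forall f, D f -> 0 <= p1 f) (g2 : forall f, D f -> 0 <= p2 f).

(** The cost of [f] as an approximate solution of [T f = h]. Its infimum [q] is a seminorm with
    [q h <= p2 h] (take [f = 0]) and [q (T f) <= p1 f] (zero residual), the two bounds inherited by
    a functional below [q]. *)
Let val h f := p1 f + p2 (h - T f).
Let q h := inf [set t | exists2 f, D f & t = val h f].

Let D0 : D 0. Proof. by case: sD. Qed.
Let TZ a f : D f -> T (a *: f) = a *: T f.
Proof.
move=> Df; have T0 : T 0 = 0.
  by have := lT 1 D0 D0; rewrite !scale1r addr0 => /eqP; rewrite -subr_eq subrr => /eqP.
by rewrite -[_ *: f]addr0 lT // T0 addr0.
Qed.

Let val_ge0 h f : D h -> D f -> 0 <= val h f.
Proof. by move=> Dh Df; rewrite addr_ge0 ?g1 // g2 //; apply: subspB => //; exact: TD. Qed.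

Let q_le h f : D h -> D f -> q h <= val h f.
Proof.
move=> Dh Df; apply: ge_inf; last by exists f.
by exists 0 => _ [g Dg ->]; exact: val_ge0.
Qed.

Let le_q h b : D h -> (forall f, D f -> b <= val h f) -> b <= q h.
Proof.
move=> Dh H; apply: lb_le_inf; first by exists (val h 0), 0.
by move=> _ [f Df ->]; exact: H.
Qed.

Let q_scale a h : 0 < a -> D h -> q (a *: h) <= a * q h.
Proof.
move=> a0 Dh; rewrite -ler_pdivrMl //; apply: le_q => // f Df.
rewrite ler_pdivrMl //; apply: le_trans (q_le (subspZ _ sD Dh) (subspZ a sD Df)) _.
have [_ z1 _] := s1; have [_ z2 _] := s2.
rewrite /val TZ // -scalerBr z1 // z2 ?mulrDr //.
by apply: subspB => //; exact: TD.
Qed.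

Let q_sublinear : sublinear D q.
Proof.
have [a1 z1 o1] := s1; have [a2 z2 o2] := s2.
split=> [h k Dh Dk|a h a0 Dh|].
- rewrite -lerBlDr; apply: le_q => // f Df; rewrite lerBlDr [val _ _ + _]addrC -lerBlDr.
  apply: le_q => // f' Df'; rewrite lerBlDr [val _ _ + _]addrC.
  apply: le_trans (q_le (subspD sD Dh Dk) (subspD sD Df Df')) _.
  have -> : val h f + val k f' = (p1 f + p1 f') + (p2 (h - T f) + p2 (k - T f')).
    by rewrite /val addrACA.
  apply: lerD; first exact: a1.
  have -> : h + k - T (f + f') = (h - T f) + (k - T f').
    by rewrite -[f]scale1r lT // !scale1r opprD addrACA.
  by apply: a2; apply: subspB => //; exact: TD.
- apply/eqP; rewrite eq_le q_scale //=; rewrite -ler_pdivlMl //.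
  have ai : 0 < a^-1 by rewrite invr_gt0.
  have := q_scale ai (subspZ a sD Dh).
  by rewrite scalerA mulVf ?scale1r // gt_eqF.
- apply/eqP; rewrite eq_le le_q ?andbT //; last by move=> f Df; exact: val_ge0.
  apply: le_trans (q_le D0 D0) _.
  by rewrite /val -[X in T X](scale0r 0) TZ // scale0r subr0 o1 o2 addr0.
Qed.

Let q_opp h : D h -> q (- h) = q h.
Proof.
have K k : D k -> q (- k) <= q k.
  move=> Dk; have DN f : D f -> D (- f) by rewrite -scaleN1r => /(subspZ (-1) sD).
  apply: (le_q Dk) => f Df; apply: le_trans (q_le (DN _ Dk) (DN _ Df)) _.
  have DkT : D (k - T f) by apply: subspB => //; exact: TD.
  have TN : T (- f) = - T f by rewrite -scaleN1r TZ // scaleN1r.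
  by rewrite /val n1 // TN opprK -(n2 DkT) opprB [T f - k]addrC.
move=> Dh; apply/eqP; rewrite eq_le K //= -{1}[h]opprK K //.
by rewrite -scaleN1r; exact: subspZ.
Qed.

(* Duality: the least cost of approximately solving [T f = g] is attained by a
   functional bounded by [p2], whose composite with [T] is bounded by [p1]. *)
Lemma approximate_solution g b b' : D g ->
  (forall v, rlinear D v -> (forall h, D h -> `|v h| <= p2 h) ->
     (forall f, D f -> `|v (T f)| <= p1 f) -> `|v g| <= b) ->
  b < b' -> exists2 f, D f & p1 f + p2 (g - T f) < b'.
Proof.
move=> Dg H bb; have [v [lv vg vb]] := hahn_banach_point sD q_sublinear q_opp Dg.
have [_ _ o1] := s1; have [_ _ o2] := s2.
have gb : `|v g| <= b.
  apply: H => // [h Dh|f Df].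
    apply: le_trans (vb h Dh) _; apply: le_trans (q_le Dh D0) _.
    by rewrite /val -[X in T X](scale0r 0) TZ // scale0r subr0 o1 add0r.
  apply: le_trans (vb _ (TD Df)) _; apply: le_trans (q_le (TD Df) Df) _.
  by rewrite /val subrr o2 addr0.
apply: contrapT => nf; have : b' <= q g.
  apply: le_q => // f Df; rewrite leNgt; apply/negP => h; apply: nf.
  by exists f.
by rewrite -vg => /(lt_le_trans bb); rewrite ltNge (le_trans (ler_norm _) gb).
Qed.

End InfConvolution.

Section Solvability.
Context {R : realType} {n : nat}.
Local Notation E := 'rV[R]_n.
Local Notation C := R[i].
Local Notation V := (E -> Rcomplex R).
Implicit Types (f g phi psi : E -> C) (r A c : R) (N M : nat) (u v : V -> R).
Variables (Om : set E) (s : R) (P : pdo R n) (x0 : E) (R0 R1 : R).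
Hypotheses (oOm : open Om) (s1 : 1 < s) (gP : coefs_in (gevrey s Om) P).
Hypotheses (R01 : R0 < R1) (KO1 : cbox x0 R1 `<=` Om).
Hypothesis hP : h_ultradistribution_distribution s Om P.
Variable rho : R.
Hypothesis rho_i : 0 < rho <= R0.
Local Notation F := (TF Om s).
Local Notation D := (test_fun Om).
Local Notation T := (transpose P).
Local Notation p := (pN x0).
Local Notation q := (star x0 s).
Hypothesis ker : forall u A, rlinear (F : set V) u ->
  (forall f, F f -> `|u f| <= A * q rho f) -> (forall f, F f -> u (T f) = 0) ->
  forall f, F f -> u f = 0.
Let sF : subsp (F : set V). Proof. exact: subsp_TF. Qed.
Let sD : subsp (D : set V). Proof. exact: subsp_test. Qed.
Let cD : clinear D. Proof. exact: clinear_test. Qed.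
Let KO : cbox x0 R0 `<=` Om. Proof. by move=> x /(subset_cbox (ltW R01))/KO1. Qed.
Let FD : F `<=` D. Proof. by move=> f /TF_test. Qed.


(** [A] and [L] may vary with [u] and do not enter the conclusion: they serve only to make each form
    finite in the Gevrey seminorm, so that it can be normalized, and to locate its carrier. *)
Lemma local_regularity r r1 N : 0 <= r -> r < r1 -> r1 <= rho -> exists M c, 0 < c /\
  forall u, rlinear (F : set V) u ->
  (exists A L, forall f, F f -> `|u f| <= A * p L r f) ->
  (forall f, F f -> `|u (T f)| <= p N r f) -> forall f, F f -> `|u f| <= c * p M r1 f.
Proof.
move=> r0 rr r1rho; have [rho0 rhoR] := andP rho_i.
(* One half of the loss of radius pays for the uniform Gevrey bound, the other half for
   [regularity]. *)
pose r' := (r + r1) / 2; have r'r : r < r' by rewrite /r'; lra.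
have r'r1 : r' < r1 by rewrite /r'; lra.
have r'0 : 0 <= r' by rewrite (le_trans r0) // ltW.
have r1R : r1 <= R0 by rewrite (le_trans r1rho).
have r'R : r' <= R0 by rewrite (le_trans (ltW r'r1)).
have rR : r <= R0 by rewrite (le_trans (ltW r'r)).
have q0 f : F f -> 0 <= q r' f.
  by move=> Ff; exact: (star_ge0 oOm r'0 (boxO KO r'R) (TF_gevrey Ff)).
have pmono f : F f -> p N r f <= p N r' f.
  by move=> Ff; exact: (pN_mono x0 r0 (leqnn N) (ltW r'r) (TF_smooth Ff)).
have [B B1 HB] : exists2 B : R, 1 <= B & forall u, rlinear (F : set V) u ->
    (exists A L, forall f, F f -> `|u f| <= A * p L r f) ->
    (forall f, F f -> `|u (T f)| <= p N r f) -> forall f, F f -> `|u f| <= B * q r' f.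
  apply: contrapT => nB.
  have H (j : nat) : exists vp : (V -> R) * (E -> C), [/\ rlinear (F : set V) vp.1 /\
      local_form x0 (F : set V) vp.1 r, forall f, F f -> `|vp.1 f| <= q r' f,
      forall f, F f -> `|vp.1 (T f)| <= p N r' f / j.+1%:R, F vp.2 /\ q r' vp.2 <= 1 &
      2^-1 <= `|vp.1 vp.2| ].
    have [u [A [L [f0 [lu ub uT [F0 u0]]]]]] : exists u A L f0, [/\ rlinear (F : set V) u,
        forall f, F f -> `|u f| <= A * p L r f, forall f, F f -> `|u (T f)| <= p N r f &
        F f0 /\ j.+1%:R * q r' f0 < `|u f0| ].
      apply: contrapT => nx; apply: nB; exists j.+1%:R; first by rewrite ler1n.
      move=> u lu [A [L ub]] uT f Ff; rewrite leNgt; apply/negP => uf; apply: nx.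
      by exists u, A, L, f.
    have ub0 f : F f -> `|u f| <= `|A| * p L r f.
      move=> Ff; apply: le_trans (ub f Ff) _; rewrite ler_wpM2r ?ler_norm //.
      exact: (pN_ge0 x0 L r0 (TF_smooth Ff)).
    have ub' f : F f -> `|u f| <= `|A| * (L`!%:R `^ s) * q r' f.
      move=> Ff; apply: le_trans (ub0 f Ff) _; rewrite -mulrA ler_wpM2l //.
      apply: le_trans (pN_mono x0 r0 (leqnn L) (ltW r'r) (TF_smooth Ff)) _.
      exact: (pN_star oOm s1 L r'0 (boxO KO r'R) (TF_gevrey Ff)).
    have u0' : u f0 != 0.
      by rewrite -normr_gt0; apply: le_lt_trans u0; rewrite mulr_ge0 ?q0.
    have r'i : 0 <= r' <= R0 by rewrite r'0.
    have [t [phi [t0 ut ut' Fp up]]] :=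
      normalized oOm s1 R01 KO1 r'i lu ub' F0 u0'.
    (* The counterexample exceeds [j.+1] times the seminorm, so its norm [t] is at least [j.+1];
       division by [t] then makes the composite with [T] tend to 0. *)
    have jt : j.+1%:R <= t.
      rewrite leNgt; apply/negP => tj; move: (lt_le_trans u0 (ut f0 F0)).
      by rewrite ltNge ler_wpM2r ?q0 // ltW.
    exists (fun f => u f / t, phi); split=> //=.
    - split; first exact: rlinear_div.
      by apply: local_form_div; exact: (local_pN sF r0 (normr_ge0 A) lu ub0).
    - move=> f Ff; rewrite normrM normfV (gtr0_norm t0).
      have pf := pN_ge0 x0 N r'0 (TF_smooth Ff).
      apply: ler_pM; rewrite ?invr_ge0 ?(ltW t0) //.
        exact: le_trans (uT f Ff) (pmono f Ff).
      by rewrite lef_pV2 ?posrE // ltr0n.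
  have [vp Hvp] := choice H; have [FF [UF FN]] := ultrafilter_nat.
  have [||w [lw wb wT [f0 F0 w0] _]] := normalized_limit oOm s1 gP R01 KO1 hP UF FN
    (N := N) (v := fun j => (vp j).1) (phi := fun j => (vp j).2) r0 r'r r'r1 r1R.
  - by move=> j; have [[lv lo] vb vT _ _] := Hvp j.
  - by move=> j; have [_ _ _ [? ?] ?] := Hvp j.
  move/eqP: w0; apply; apply: (ker (A := 1) lw) => // f Ff; rewrite mul1r.
  apply: le_trans (wb f Ff) _.
  exact: (star_le_mono oOm R01 KO1 r'0 (le_trans (ltW r'r1) r1rho) rhoR Ff).
have B0 : 0 < B by rewrite (lt_le_trans ltr01).
have [M [c [c0 reg]]] := regularity oOm s1 gP KO hP N r'0 r'r1 r1R.
exists M, (B * c); split=> [|u lu uA uT f Ff]; first by rewrite mulr_gt0.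
have nB (x : R) : `|x / B| = `|x| / B by rewrite normrM normfV (gtr0_norm B0).
have := reg (fun f => u f / B) (rlinear_div B lu); move=> /(_ _ _ f Ff).
rewrite nB ler_pdivrMr // mulrC mulrA; apply=> g Fg; rewrite nB ler_pdivrMr //.
  by rewrite mulrC HB.
apply: le_trans (uT g Fg) _; apply: le_trans (pmono g Fg) _.
by rewrite ler_peMr //; exact: (pN_ge0 x0 N r'0 (TF_smooth Fg)).
Qed.

(** A Gevrey approximation close in both the order [L] of the given form and the order [M] of the
    estimate transfers the bound to test functions; [A] and [L] disappear as the error tends to
    0. *)
Lemma test_regularity r r1 N : 0 <= r -> r < r1 -> r1 <= rho -> exists M c, 1 <= c /\
  forall u, rlinear (D : set V) u ->
  (exists A L, forall f, D f -> `|u f| <= A * p L r f) ->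
  (forall f, D f -> `|u (T f)| <= p N r f) -> forall f, D f -> `|u f| <= c * p M r1 f.
Proof.
move=> r0 rr r1rho; have [rho0 rhoR] := andP rho_i.
have r10 : 0 <= r1 by rewrite (le_trans r0) // ltW.
have r1i : 0 <= r1 <= R0 by rewrite r10 (le_trans r1rho).
have [M [c [c0 reg]]] := local_regularity N r0 rr r1rho.
exists M, (c + 1); split=> [|u lu [A [L ub]] uT f Df]; first by rewrite lerDr ltW.
have sf := test_fun_smooth Df; have pf := pN_ge0 x0 M r10 sf.
apply: le_trans (_ : c * p M r1 f <= _); last by rewrite ler_wpM2r // lerDl.
apply/ler_addgt0Pr => e e0; have K0 : 0 < `|A| + c by rewrite ltr_wpDl.
have [g Fg Hg] := TF_dense s1 R01 KO1 (maxn L M) r1i sf (divr_gt0 e0 K0).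
have Dg := FD Fg; have sg := test_fun_smooth Dg.
have sfg := smoothB openT sf sg.
rewrite -[u f](subrK (u g)) -(rlinearB sD lu Df Dg).
apply: le_trans (ler_normD _ _) _.
have h1 : `|u (f - g : V)| <= `|A| * (e / (`|A| + c)).
  apply: le_trans (ub _ (clinearB cD Df Dg)) _.
  apply: le_trans (_ : `|A| * p L r (fun x => f x - g x) <= _).
    by rewrite ler_wpM2r ?ler_norm //; exact: (pN_ge0 x0 L r0 sfg).
  rewrite ler_wpM2l //; apply: le_trans Hg.
  exact: (pN_mono x0 r0 (leq_maxl _ _) (ltW rr) sfg).
have h2 : `|u g| <= c * (p M r1 f + e / (`|A| + c)).
  have [lF bF tF] : [/\ rlinear (F : set V) u,
     forall f, F f -> `|u f| <= A * p L r f & forall f, F f -> `|u (T f)| <= p N r f].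
    by split=> [a h k /FD ? /FD ?|h /FD ?|h /FD ?]; [exact: lu|exact: ub|exact: uT].
  apply: le_trans (reg u lF (ex_intro _ A (ex_intro _ L bF)) tF g Fg) _.
  rewrite ler_pM2l //.
  have -> : g = (fun x => f x + (-1) * (f x - g x)) by apply/funext => x; ring.
  apply: le_trans (pND x0 M r10 sf (smoothZ (-1) openT sfg)) _; rewrite lerD2l.
  apply: le_trans (pNZ_le x0 M (-1) r10 sfg) _; rewrite cmodN cmod1 mul1r.
  apply: le_trans Hg; exact: (pN_mono x0 r10 (leq_maxr _ _) (lexx _) sfg).
apply: le_trans (lerD h1 h2) _; rewrite mulrDr addrCA -mulrDl lerD2l.
by rewrite mulrC mulfVK // gt_eqF.
Qed.

(** Duality is applied with residual cost [A * p L r], where [A = b / e]: a total cost below [b]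
    bounds both the solution by [b] and the residual by [e]. The dual forms obey a bound
    [A * p L r], which [test_regularity] allows for arbitrary [A] and [L]; hence [L] and [e] may be
    chosen after [M] and [c]. *)
Lemma solve_step r r1 N : 0 <= r -> r < r1 -> r1 <= rho -> exists M c, 1 <= c /\
  forall g eta L e, D g -> 0 < eta -> p M r1 g <= eta -> 0 < e ->
  exists2 f, D f & p N r f <= 2 * c * eta /\ p L r (fun x => g x - T f x) <= e.
Proof.
move=> r0 rr r1rho; have [M [c [c1 reg]]] := test_regularity N r0 rr r1rho.
exists M, c; split=> // g eta L e Dg eta0 geta e0; have c0 : 0 < c by rewrite (lt_le_trans ltr01).
pose b := 2 * c * eta; have b0 : 0 < b by rewrite !mulr_gt0.
pose A := b / e; have A0 : 0 < A by rewrite divr_gt0.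
have TD f : D f -> D (T f) by exact: (test_fun_transpose oOm (coefs_smooth gP)).
have [pD pZ p0] := pN_sublinear x0 Om L r0.
have [||||||||f Df Hf] := @approximate_solution R V D T (p N r) (fun f => A * p L r f) sD TD
  _ (pN_sublinear x0 Om N r0) _ _ _ _ _ g (c * eta) b Dg.
- by move=> a f h Df Dh; rewrite !rlinE; exact: (transpose_lin oOm gP a%:C Df Dh).
- split=> [f h Df Dh|a f a0 Df|]; first by rewrite -mulrDr ler_pM2l // pD.
    by rewrite pZ // mulrCA.
  by rewrite p0 mulr0.
- by move=> f Df; exact: (pN_opp x0 N r0 (test_fun_smooth Df)).
- by move=> f Df; congr (A * _); exact: (pN_opp x0 L r0 (test_fun_smooth Df)).
- by move=> f Df; exact: (pN_ge0 x0 N r0 (test_fun_smooth Df)).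
- by move=> f Df; rewrite mulr_ge0 ?(ltW A0) //; exact: (pN_ge0 x0 L r0 (test_fun_smooth Df)).
- move=> v lv vA vT; apply: le_trans (reg v lv _ vT g Dg) _; first by exists A, L.
  by rewrite ler_pM2l.
- by rewrite /b -mulrA ltr_pMl ?mulr_gt0 // ltr1n.
have Dgf := clinearB cD Dg (TD _ Df).
have pf := pN_ge0 x0 N r0 (test_fun_smooth Df).
have pg := pN_ge0 x0 L r0 (test_fun_smooth Dgf).
exists f => //; split; first by apply: le_trans (ltW Hf); rewrite lerDl mulr_ge0 // ltW.
have : A * p L r (fun x => g x - T f x) <= A * e.
  rewrite /A divfK ?gt_eqF //; apply: le_trans (ltW Hf); by rewrite lerDr.
by rewrite ler_pM2l.
Qed.

End Solvability.

(** * Successive corrections on shrinking boxes, and the conclusion *)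

Section Iteration.
Context {R : realType} {n : nat}.
Local Notation E := 'rV[R]_n.
Local Notation C := R[i].
Implicit Types (f g phi psi S : E -> C) (r A c : R) (N M : nat).
Variables (Om : set E) (s : R) (P tP : pdo R n) (x0 : E) (rho : R).
Hypotheses (oOm : open Om) (gP : coefs_in (gevrey s Om) P) (rho0 : 0 < rho).
Hypothesis ft : formal_transpose Om P tP.
Local Notation D := (test_fun Om).
Local Notation T := (transpose P).
Local Notation p := (pN x0).
Hypothesis step : forall r r1 N, 0 <= r -> r < r1 -> r1 <= rho -> exists M c, 1 <= c /\
  forall g eta L e, D g -> 0 < eta -> p M r1 g <= eta -> 0 < e ->
  exists2 f, D f & p N r f <= 2 * c * eta /\ p L r (fun x => g x - T f x) <= e.
Let cD : clinear D. Proof. exact: clinear_test. Qed.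
Let TD f : D f -> D (T f). Proof. exact: (test_fun_transpose oOm (coefs_smooth gP)). Qed.
Let h (k : nat) : R := 2^-1 ^+ k.

Let h0 k : 0 < h k. Proof. by rewrite /h exprn_gt0 // invr_gt0. Qed.
Let hz : h 0%N = 1. Proof. exact: expr0. Qed.
Let hS k : h k.+1 = h k / 2. Proof. by rewrite /h exprSr. Qed.
Let h1 k : h k <= 1. Proof. by rewrite /h exprn_ile1 // ?invr_ge0 // invf_le1 // ler1n. Qed.
Let hle k : h k <= k.+1%:R^-1.
Proof. by rewrite /h exprVn lef_pV2 ?posrE ?exprn_gt0 // -natrX ler_nat ltn_expl. Qed.

Let hadd i j : h (i + j)%N <= h i.
Proof. by rewrite /h exprD; apply: ler_piMr; [exact: ltW (h0 i)|exact: h1]. Qed.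

(** Radii decreasing strictly from [rho] towards [rho / 2]: every step may lose some radius, yet all
    estimates hold on the box of radius [rho / 2]. *)
Let rk k := rho / 2 * (1 + h k).
Let rk0 k : rho / 2 <= rk k.
Proof. by rewrite /rk ler_peMr ?divr_ge0 ?ltW // ltrDl. Qed.
Let rk_ge0 k : 0 <= rk k. Proof. by apply: le_trans (rk0 k); rewrite divr_ge0 ?ltW. Qed.
Let rkS k : rk k.+1 < rk k.
Proof. by rewrite /rk ltr_pM2l ?divr_gt0 // ltrD2l hS ltr_pdivrMr // ltr_pMr // ltr1n. Qed.
Let rk_le k : rk k <= rho.
Proof. by rewrite /rk mulrAC ler_pdivrMr // ler_pM2l //; have := h1 k; lra. Qed.

Lemma approximating_sequence g0 : D g0 -> exists (S : nat -> E -> C) (A : R),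
  [/\ 0 < A, forall k, D (S k),
    forall k, p k (rho / 2) (fun x => S k.+1 x - S k x) <= A * h k &
    forall k x, cbox x0 (rho / 2) x -> cmod (g0 x - T (S k) x) <= A * h k].
Proof.
move=> Dg0; have stepk (k : nat) : exists mc : nat * R, 1 <= mc.2 /\
    forall g eta L e, D g -> 0 < eta -> p mc.1 (rk k) g <= eta -> 0 < e ->
    exists2 f, D f & p k (rk k.+1) f <= 2 * mc.2 * eta /\
      p L (rk k.+1) (fun x => g x - T f x) <= e.
  by have [M [c H]] := step k (rk_ge0 k.+1) (rkS k) (rk_le k); exists (M, c).
have [Mc HMc] := choice stepk.
pose M k := (Mc k).1; pose c k := (Mc k).2.
have c1 k : 1 <= c k by case: (HMc k).
have c0 k : 0 < c k by rewrite (lt_le_trans ltr01).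
have pg0 : 0 <= p (M 0%N) (rk 0%N) g0 by exact: (pN_ge0 x0 _ (rk_ge0 _) (test_fun_smooth Dg0)).
(* Makes the initial residual [g0] at most [dl 0], so that the zero function starts the iteration;
   the added 1 keeps [A] positive. *)
pose A := 1 + 2 * c 0%N * p (M 0%N) (rk 0%N) g0.
have A0 : 0 < A by rewrite ltr_pwDl // mulr_ge0 // mulr_ge0 // ltW.
(* A residual of size [dl k] yields a correction of size at most [2 * c k * dl k = A * h k], which
   is summable. *)
pose dl k := A * h k / (2 * c k).
have dl0 k : 0 < dl k by rewrite divr_gt0 ?mulr_gt0.
pose good k S := D S /\ p (M k) (rk k) (fun x => g0 x - T S x) <= dl k.
(* The residual left by step [k] is made small in the seminorm of order [M k.+1], the one in which
   step [k.+1] measures its right-hand side. *)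
have next (kS : nat * (E -> C)) : exists S', good kS.1 kS.2 -> good kS.1.+1 S' /\
    p kS.1 (rk kS.1.+1) (fun x => S' x - kS.2 x) <= A * h kS.1.
  case: kS => k S /=; have [[DS HS]|nx] := pselect (good k S); last by exists S.
  have Dg := clinearB cD Dg0 (TD DS).
  have [_ /(_ _ _ (M k.+1) (dl k.+1) Dg (dl0 k) HS (dl0 _))[f Df [Hf Hg]]] := HMc k.
  exists (fun x => 1 * f x + S x) => _; split; first split.
  - by have [_ DL] := cD; exact: DL.
  - rewrite (transpose_lin oOm gP 1 Df DS).
    rewrite (_ : (fun x => _) = (fun x => g0 x - T S x - T f x)) //.
    by apply/funext => x; ring.
  - rewrite (_ : (fun x => _) = f); last by apply/funext => x; ring.
    apply: le_trans Hf _; rewrite -/(c k) /dl mulrC divfK // gt_eqF //.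
    by rewrite mulr_gt0.
have [nx Hnx] := choice next.
pose S := fix S k := if k is j.+1 then nx (j, S j) else (fun=> 0) : E -> C.
have T0 : T (fun=> 0) = fun=> 0.
  have := transposeZ oOm gP 0 (test_fun0 Om).
  rewrite (_ : (fun _ : E => 0 * 0) = fun=> 0); last by apply/funext => x; rewrite mul0r.
  by move=> ->; apply/funext => x; rewrite mul0r.
have gS k : good k (S k).
  elim: k => [|k IH]; last by have [] := Hnx (k, S k) IH.
  split; first exact: test_fun0.
  rewrite [S _]/= T0 (_ : (fun x => _) = g0); last by apply/funext => x; rewrite subr0.
  by rewrite /dl hz mulr1 ler_pdivlMr ?mulr_gt0 // mulrC lerDr.
have DS k : D (S k) by case: (gS k).
exists S, A; split=> // [k|k x xr].
  have [_] := Hnx (k, S k) (gS k); apply: le_trans.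
  have sS := smoothB openT (test_fun_smooth (DS k.+1)) (test_fun_smooth (DS k)).
  by apply: (pN_mono x0 _ (leqnn k) (rk0 _) sS); rewrite divr_ge0 ?ltW.
have sg := test_fun_smooth (clinearB cD Dg0 (TD (DS k))).
apply: le_trans (pN_ge (w := [::]) sg (leq0n (M k)) (subset_cbox (rk0 k) xr)) _.
have [_ /le_trans] := gS k; apply; rewrite /dl ler_pdivrMr ?mulr_gt0 //.
by rewrite ler_peMr ?mulr_ge0 ?ltW //; have := c1 k; lra.
Qed.

(** The increment of index [k] is controlled only to order [k]. From the index [size w] on, the
    increments of [pw w] are dominated by a geometric series of sum at most [2 * A]; the finitely
    many earlier terms are bounded directly. *)
Lemma telescoping_bound (S : nat -> E -> C) A r w : 0 <= r -> 0 <= A ->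
  (forall k, smooth setT (S k)) ->
  (forall k, p k r (fun x => S k.+1 x - S k x) <= A * h k) ->
  exists2 B, 0 <= B & forall k x, cbox x0 r x -> cmod (pw w (S k) x) <= B.
Proof.
move=> r0 A0 sS dS; pose N := size w; pose a j := p N r (S j).
have a0 j : 0 <= a j by exact: pN_ge0.
have S0 : 0 <= \sum_(j < N.+1) a j by exact: sumr_ge0.
exists (\sum_(j < N.+1) a j + 2 * A); first by rewrite addr_ge0 // mulr_ge0.
have aS j : (j <= N)%N -> a j <= \sum_(j < N.+1) a j.
  move=> jN; rewrite (bigD1 (Ordinal (jN : j < N.+1)%N)) //= lerDl.
  by apply: sumr_ge0.
have base j x : cbox x0 r x -> cmod (pw w (S j) x) <= a j.
  by move=> xr; apply: pN_ge.
move=> k x xr; have [kN|Nk] := leqP k N.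
  apply: le_trans (base k x xr) _; apply: le_trans (aS k kN) _.
  by rewrite lerDl mulr_ge0.
have H i : cmod (pw w (S (i + N)%N) x) <= a N + 2 * A * (1 - h i).
  elim: i => [|i IH]; first by rewrite hz subrr mulr0 addr0 add0n; exact: base.
  have -> : pw w (S (i.+1 + N)%N) x = pw w (S (i + N)%N) x +
      pw w (fun x => S (i + N).+1 x - S (i + N)%N x) x.
    by rewrite (pwB w openT (sS _) (sS _) I) addrC subrK.
  apply: le_trans (cmodD _ _) _.
  have : cmod (pw w (fun x => S (i + N).+1 x - S (i + N)%N x) x) <= A * h i.
    have sB := smoothB openT (sS (i + N).+1) (sS (i + N)%N).
    apply: le_trans (pN_ge sB (leq_addl i N) xr) _.
    by apply: le_trans (dS _) _; rewrite ler_wpM2l // hadd.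
  move: IH; rewrite hS; set P1 := cmod _; set P2 := cmod _; set y := h i => IH2 IH1.
  apply: le_trans (lerD IH2 IH1) _.
  by rewrite le_eqVlt; apply/orP; left; apply/eqP; field.
have := H (k - N)%N; rewrite subnK 1?ltnW // => /le_trans; apply.
apply: lerD; first exact: aS.
by rewrite ler_piMr ?mulr_ge0 // gerBl ltW.
Qed.

(** At a fixed point the equation involves finitely many derivatives, so pointwise limits of the
    derivatives of [S k] along an ultrafilter are enough; [transpose_unique] replaces [T] by [tP] on
    the test functions [S k]. *)
Lemma smooth_solution g0 : D g0 -> exists2 f, smooth (obox x0 (rho / 2)) f &
  forall x, obox x0 (rho / 2) x -> pdo_fun tP f x = g0 x.
Proof.
move=> Dg0; have [S [A [A0 DS dS TS]]] := approximating_sequence Dg0.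
have r0 : 0 <= rho / 2 by rewrite divr_ge0 // ltW.
have sS k : smooth setT (S k) := test_fun_smooth (DS k).
have bS w := telescoping_bound w r0 (ltW A0) sS dS.
have [FF [UF FN]] := ultrafilter_nat.
have H (wx : seq 'I_n * E) : exists l, obox x0 (rho / 2) wx.2 -> forall e : R, 0 < e ->
    \forall k \near FF, cmod (pw wx.1 (S k) wx.2 - l) <= e.
  case: wx => w x /=; have [xr|nx] := pselect (obox x0 (rho / 2) x); last by exists 0.
  have [B B0 HB] := bS w.
  have [l Hl] := bounded_culim UF (fun k => HB k x (obox_cbox xr)).
  by exists l.
have [G HG] := choice H; pose G' w x := G (w, x).
pose J := [set t : R | `|t| < rho / 2].
have cJ : conv1 J by exact: conv1_lt.
have oJ : open (rect J x0) := @obox_open _ _ x0 (rho / 2).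
have [|||sG eG] := @smooth_limit R n J x0 cJ oJ nat FF _ S G'.
- by move=> k; exact: (subset_smooth (fun _ _ => I) (sS k)).
- move=> w; have [B B0 HB] := bS w; exists B => // k x xr.
  exact: (HB k x (obox_cbox xr)).
- by move=> w x xr e e0; exact: (HG (w, x) xr).
exists (G' [::]); first exact: sG.
move=> x xr; apply/eqP; rewrite -subr_eq0; apply/eqP; apply: cmod_eq0.
pose idx (b : {ffun 'I_n -> 'I_(pdo_order tP).+1}) : multi_index n := [ffun i => b i : nat].
pose K := \sum_b cmod (pdo_coef tP (idx b) x); apply: (@small_eq0 _ _ (K + 1)) => e e0.
have near_dpart (b : {ffun 'I_n -> 'I_(pdo_order tP).+1}) :
    \forall k \near FF, cmod (dpart (idx b) (S k) x - dpart (idx b) (G' [::]) x) <= e.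
  apply: filterS (HG (word (idx b), x) xr e e0) => k.
  by rewrite !dpartE (eG _ _ xr).
have [k [/= Hk kN]] := filter_ex (filterI (filter_forall _ near_dpart)
  (FN (Num.truncn (A / e)))).
rewrite ger0_norm ?cmod_ge0 //.
have -> : pdo_fun tP (G' [::]) x - g0 x =
  - (pdo_fun tP (S k) x - pdo_fun tP (G' [::]) x) - (g0 x - T (S k) x).
  by rewrite (transpose_unique oOm (coefs_smooth gP) ft (DS k)); ring.
apply: le_trans (cmodB _ _) _; rewrite mulrDl mul1r cmodN; apply: lerD.
  rewrite /pdo_fun /pdo_sum -sumrB; apply: le_trans (cmod_sum _ _ _) _.
  rewrite /K mulr_suml [leRHS](bigID (fun b => mabs (idx b) <= pdo_order tP)%N) /=.
  rewrite ler_wpDr //; first by apply: sumr_ge0 => b _; rewrite mulr_ge0 ?cmod_ge0 // ltW.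
  apply: ler_sum => b _; rewrite -mulrBr cmodM ler_wpM2l ?cmod_ge0 //.
  exact: Hk.
apply: le_trans (TS k x (obox_cbox xr)) _.
apply: le_trans (_ : A / k.+1%:R <= _); first by rewrite ler_pM2l // hle.
rewrite ler_pdivrMr // mulrC -ler_pdivrMr //.
by apply: ltW; apply: lt_le_trans (truncnS_gt _) _; rewrite ler_nat ltnS.
Qed.

End Iteration.

Theorem theorem8p11 (R : realType) (n : nat) (Om : set 'rV[R]_n) (s : R)
    (P tP : pdo R n) (x0 : 'rV[R]_n) :
  open Om -> 1 < s -> coefs_in (gevrey s Om) P -> Om x0 ->
  ~ has_delta_solution Om P x0 ->
  h_ultradistribution_distribution s Om P ->
  formal_transpose Om P tP ->
  smoothly_locally_solvable Om tP x0.
Proof.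
move=> oOm s1 gP Ox0 nd hP ft U oU UO Ux0 g sg.
have [R1 R1p KU] := open_cbox oU Ux0.
have R00 : 0 < R1 / 2 by rewrite divr_gt0.
have R01 : R1 / 2 < R1 by rewrite ltr_pdivrMr // ltr_pMr // ltr1n.
have KO : cbox x0 R1 `<=` Om := subset_trans KU UO.
have [rho rho_i ker] := kernel_trivial oOm s1 gP R00 R01 KO hP nd.
have [rho0 rhoR] := andP rho_i; have rhoR1 := le_lt_trans rhoR R01.
(* The right-hand side is cut off outside the box of radius [rho], where the solution is sought, and
   inside [U], where [g] is smooth. *)
have [chi [a [b [ra br gc c1 c0]]]] := gevrey_cutoff x0 s1 rhoR1.
have bU : cbox x0 b `<=` U by move=> x /(subset_cbox (ltW br))/KU.
have Dg : test_fun Om (fun x => g x * chi x).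
  apply/test_funP; split.
    exact: (smooth_mul_vanish oU sg (gevrey_smooth gc) (@cbox_closed _ _ x0 b) bU).
  exists (cbox x0 b); split; [exact: cbox_compact|exact: subset_trans bU UO|].
  by move=> x /c0 ->; rewrite mulr0.
have step := solve_step oOm s1 gP R01 KO hP rho_i ker.
have [f sf fE] := smooth_solution oOm gP rho0 ft step Dg.
have r2 : rho / 2 <= rho by rewrite ler_pdivrMr // ler_peMr ?ler1n // ltW.
have Vrho x : obox x0 (rho / 2) x -> cbox x0 rho x by move=> /obox_cbox/(subset_cbox r2).
exists (obox x0 (rho / 2)); split; first exact: obox_open.
- by apply: obox_center; rewrite divr_gt0.
- by move=> x /Vrho/(subset_cbox (ltW rhoR1))/KU.
- exists f => // x xr.
  by rewrite fE // c1 ?mulr1 //; apply: (subset_cbox (ltW ra)); exact: Vrho.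
Qed.
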